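(* Let $M=\mathbb{C}^*\times\mathbb{C}$ with coordinates $(z,\check z)$, let $(z,\check z,\theta,\check\theta)$ be the induced coordinates on $TM$, and consider the A1 pre-Joyce structure with formal relative connection $$\mathcal{A}_{\partial_z}=\partial_z+\frac1\epsilon\partial_\theta+\frac{\theta}{2\pi\mathrm{i}z}\partial_{\check\theta},\qquad \mathcal{A}_{\partial_{\check z}}=\partial_{\check z}+\frac1\epsilon\partial_{\check\theta},$$ and $\mathcal{A}^{\mathrm{st}}_{\partial_z}=\partial_z+\frac1\epsilon\partial_\theta$, $\mathcal{A}^{\mathrm{st}}_{\partial_{\check z}}=\partial_{\check z}+\frac1\epsilon\partial_{\check\theta}$. Define $$\dot g=\left(\sum_{k=1}^\infty\left(\frac{2\pi\mathrm{i}\,\epsilon}{z}\right)^kB_{k+1}\!\left(\frac{\pi\mathrm{i}-\theta}{2\pi\mathrm{i}}\right)\frac{(-1)^k}{(k+1)k}\right)\partial_{\check\theta},$$ where $B_m$ is the $m$-th Bernoulli polynomial. Then: (1) $e^{\mathcal{L}_{\dot g}}\mathcal{A}^{\mathrm{st}}=\mathcal{A}$, and $\dot g$ is resurgent. (2) With $x^{1,\mathrm{st}}=\theta-z/\epsilon$, $x^{2,\mathrm{st}}=\check\theta-\check z/\epsilon$ and $x^i=e^{\dot g}x^{i,\mathrm{st}}$, the series $x^i-x^{i,\mathrm{st}}$ ($i=1,2$) are resurgent, and the associated Stokes automorphisms match the logarithms of the jumps of the Riemann–Hilbert problem associated to the DT invariants of the A1 quiver; that is, for $x^2-x^{2,\mathrm{st}}$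 they are $$\log\left(1+e^{\theta-z/\epsilon}\right)\ \text{ along } \mathbb{R}_{>0}\cdot z,\qquad -\log\left(1+e^{z/\epsilon-\theta}\right)\ \text{ along } \mathbb{R}_{>0}\cdot(-z),$$ and there is no other ray along which a nontrivial Stokes automorphism occurs.
   Context: The symplectic form is $\Omega=\frac{1}{2\pi \mathrm{i}}\mathrm{d}z\wedge\mathrm{d}\check z$, the lattice bundle $\Gamma$ is spanned over $\mathbb{Z}$ by $\partial_z,\partial_{\check z}$, and $\mathcal{H}$ is the trivial flat connection $\mathcal{H}_{\partial_z}=\partial_z$, $\mathcal{H}_{\partial_{\check z}}=\partial_{\check z}$ on $\pi:TM\to M$. $\epsilon$ is a formal variable. For a formal series $\dot g=\sum_{k\ge1}\dot g_k\epsilon^k$ of vector fields on $TM$ vertical with respect to $\pi$: $(e^{\mathcal{L}_{\dot g}}\mathcal{A}^{\mathrm{st}})_X=\sum_{k\ge0}\frac1{k!}\mathcal{L}_{\dot g}^k(\mathcal{A}^{\mathrm{st}}_X)$ for vector fields $X$ on $M$, with $\mathcal{L}_{\dot g}Y=[\dot g,Y]$; and $e^{\dot g}f=\sum_{k\ge0}\frac{\dot g^k(f)}{k!}$ on functions. A formal series $f=\sum_{k\ge1}f_k\epsilon^k$ (at a fixed point of $TM$) is resurgent if its Borel transform $\mathcal{B}[f](\xi)=\sum_{k\ge1}\frac{f_k}{(k-1)!}\xi^{k-1}$ converges in a neighbourhood of $\xi=0$ and there is a closed discrete subset $S\subset\mathbb{C}$ such that $\mathcal{B}[f]$ admits analytic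 continuation along every path in $\mathbb{C}\setminus S$ starting in the neighbourhood of convergence. For a ray $\rho$ from $0$ avoiding $S$ the Borel sum is $f_\rho(\epsilon)=\int_\rho e^{-\eta/\epsilon}\mathcal{B}[f](\eta)\,\mathrm{d}\eta$. The Stokes automorphism along a ray $\ell$ meeting $S$ is identified here with the jump of the Borel sum across $\ell$: $f_{\rho_-}(\epsilon)-f_{\rho_+}(\epsilon)$, where $\rho_-$ and $\rho_+$ are rays obtained from $\ell$ by a sufficiently small clockwise, respectively counterclockwise, rotation, and $\epsilon$ has $|\epsilon|$ sufficiently small and argument sufficiently close to that of $\ell$. The logarithms of the jumps of the Riemann–Hilbert problem for the DT invariants of the A1 quiver (with the appropriate quadratic refinement) are the two displayed expressions along the rays $\mathbb{R}_{>0}\cdot z$ and $\mathbb{R}_{>0}\cdot(-z)$. *)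

(* Defs.v *)
(* Stdlib reals and Coquelicot; [C] is Coquelicot's type of complex numbers. *)
From Stdlib Require Export Reals ZArith.
From Stdlib Require Import Lia Lra.
From Coquelicot Require Export Coquelicot.

Open Scope C_scope.

Definition Cexp (w : C) : C :=
  ((exp (fst w) * cos (snd w))%R, (exp (fst w) * sin (snd w))%R).

(* Principal argument, with values in (-PI, PI]. *)
Definition Carg (w : C) : R :=
  if Rle_dec 0 (snd w) then acos (fst w / Cmod w)
  else (- acos (fst w / Cmod w))%R.

Definition Clog (w : C) : C := (ln (Cmod w), Carg w).

Definition twopii : C := RtoC (2 * PI) * Ci.

(** * Bernoulli polynomials *)

(* Comparing the coefficients of t^(n+1) in
   (e^t - 1) * \sum_j B_j(x) t^j / j! = t e^(x t) gives
   \sum_(j <= n) 'C(n+1, j) B_j(x) = (n+1) x^n, see [bernoulli_rec].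
   [bernoulli_table n x] tabulates B_0(x), ..., B_n(x). *)
Fixpoint bernoulli_table (n : nat) (x : C) : nat -> C :=
  match n with
  | O => fun _ => 1
  | S m => fun j =>
      if (j <=? m)%nat then bernoulli_table m x j
      else Cpow x (S m)
           - sum_n (fun i => RtoC (Binomial.C (S (S m)) i)
                             * bernoulli_table m x i) m
             / RtoC (INR (S (S m)))
  end.

Definition bernoulli (n : nat) (x : C) : C := bernoulli_table n x n.

Lemma bernoulli_table_le (x : C) (n j : nat) :
  (j <= n)%nat -> bernoulli_table n x j = bernoulli j x.
Proof.
induction n as [|n IH]; intros Hj.
- now replace j with 0%nat by lia.
- destruct (Nat.eq_dec j (S n)) as [->|Hn]; [reflexivity|].
  simpl; rewrite (proj2 (Nat.leb_le j n)) by lia; apply IH; lia.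
Qed.

Lemma bernoulli_rec (x : C) (n : nat) :
  sum_n (fun j => RtoC (Binomial.C (S n) j) * bernoulli j x) n
  = RtoC (INR (S n)) * Cpow x n.
Proof.
destruct n as [|m].
- rewrite sum_O; unfold bernoulli; simpl.
  replace (Binomial.C 1 0) with 1%R by (unfold Binomial.C; simpl; field).
  reflexivity.
- rewrite sum_Sn.
  assert (HB : bernoulli (S m) x = Cpow x (S m)
     - sum_n (fun i => RtoC (Binomial.C (S (S m)) i) * bernoulli i x) m
       / RtoC (INR (S (S m)))).
  { unfold bernoulli at 1; cbn [bernoulli_table].
    rewrite (proj2 (Nat.leb_gt (S m) m)) by lia.
    do 2 f_equal; apply sum_n_ext_loc; intros k Hk.
    now rewrite bernoulli_table_le. }
  rewrite HB.
  replace (Binomial.C (S (S m)) (S m)) with (INR (S (S m))).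
  2: { rewrite pascal_step1 by lia.
       replace (S (S m) - S m)%nat with 1%nat by lia.
       unfold Binomial.C; replace (S (S m) - 1)%nat with (S m) by lia.
       rewrite (fact_simpl (S m)), mult_INR.
       replace (INR (fact 1)) with 1%R by reflexivity.
       field; apply INR_fact_neq_0. }
  set (s := sum_n _ m : C).
  assert (HN : RtoC (INR (S (S m))) <> 0).
  { intros H; apply (not_0_INR (S (S m))); [lia | now injection H]. }
  change (s + RtoC (INR (S (S m))) * (Cpow x (S m) - s / RtoC (INR (S (S m))))
          = RtoC (INR (S (S m))) * Cpow x (S m)).
  field; exact HN.
Qed.

(** * Functions and vector fields on TM *)

(* Coordinates z, z-check, theta, theta-check on C^4; [on_TM] cuts out
   TM = T(C^* x C) as the open set where z <> 0. *)
Inductive coord : Set := cz | czc | cth | cthc.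

Definition coord_eqb (i j : coord) : bool :=
  match i, j with
  | cz, cz | czc, czc | cth, cth | cthc, cthc => true
  | _, _ => false
  end.

Definition point : Type := coord -> C.
Definition on_TM (p : point) : Prop := p cz <> 0.
Definition proj_M (p : point) : C * C := (p cz, p czc).

Definition upd (p : point) (i : coord) (w : C) : point :=
  fun j => if coord_eqb i j then w else p j.

Definition fct : Type := point -> C.
Definition vfield : Type := coord -> fct.

(* [C_derive] is total; it is the complex derivative of any function that is
   complex-differentiable at the point ([is_C_derive_unique]). *)
Definition partial (i : coord) (f : fct) : fct :=
  fun p => C_derive (fun w => f (upd p i w)) (p i).

Definition vapp (Y : vfield) (f : fct) : fct := fun p =>
  Y cz p * partial cz f p + Y czc p * partial czc f p
  + Y cth p * partial cth f p + Y cthc p * partial cthc f p.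

Definition bracket (X Y : vfield) : vfield :=
  fun i p => vapp X (Y i) p - vapp Y (X i) p.

Definition dd (i : coord) : vfield :=
  fun j _ => if coord_eqb i j then 1 else 0.

Definition vscal (h : fct) (Y : vfield) : vfield := fun i p => h p * Y i p.

Definition holomorphic_on_M (a : C * C -> C) : Prop :=
  forall q : C * C, fst q <> 0 ->
  ex_filterdiff (K := C_AbsRing)
    (U := prod_NormedModule C_AbsRing C_NormedModule C_NormedModule)
    (V := C_NormedModule) a (locally q).

(** * Formal Laurent series in epsilon *)

(* [s n] is the coefficient of epsilon^n. *)
Definition laurent (T : Type) : Type := Z -> T.

Definition monomial (k : Z) (Y : vfield) : laurent vfield :=
  fun n i p => if (n =? k)%Z then Y i p else 0.

Definition ladd (X Y : laurent vfield) : laurent vfield :=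
  fun n i p => X n i p + Y n i p.

(* The operations below take g = \sum_(k >= 1) g_k epsilon^k and an argument
   of order >= -1 in epsilon. Then the coefficient of epsilon^n in g(f) and in
   [g, Y] only involves g_1, ..., g_(n+1), and g^k(f) and L_g^k(Y) have order
   >= k - 1, so that the coefficient of epsilon^n in the exponential series is
   the finite sum over k <= n + 1. *)
Definition lapp (g : laurent vfield) (f : laurent fct) : laurent fct :=
  fun n p =>
  sum_n_m (fun j => vapp (g (Z.of_nat j)) (f (n - Z.of_nat j)%Z) p)
    1 (Z.to_nat (n + 1)).

Definition lbracket (g Y : laurent vfield) : laurent vfield :=
  fun n i p =>
  sum_n_m (fun j => bracket (g (Z.of_nat j)) (Y (n - Z.of_nat j)%Z) i p)
    1 (Z.to_nat (n + 1)).

Definition exp_app (g : laurent vfield) (f : laurent fct) : laurent fct :=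
  fun n p =>
  sum_n (fun k => Nat.iter k (lapp g) f n p / RtoC (INR (fact k)))
    (Z.to_nat (n + 1)).

Definition exp_Lie (g Y : laurent vfield) : laurent vfield :=
  fun n i p =>
  sum_n (fun k => Nat.iter k (lbracket g) Y n i p / RtoC (INR (fact k)))
    (Z.to_nat (n + 1)).

(** * The A1 pre-Joyce structure *)

(* A relative connection is linear over functions on M: the lift of
   X = a d/dz + b d/dz-check is determined by the lifts of d/dz, d/dz-check. *)
Definition conn (Yz Yzc : laurent vfield) (a b : C * C -> C) : laurent vfield :=
  fun n i p => a (proj_M p) * Yz n i p + b (proj_M p) * Yzc n i p.

Definition Ast_z : laurent vfield :=
  ladd (monomial 0 (dd cz)) (monomial (-1) (dd cth)).
Definition Ast_zc : laurent vfield :=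
  ladd (monomial 0 (dd czc)) (monomial (-1) (dd cthc)).
Definition Ast : (C * C -> C) -> (C * C -> C) -> laurent vfield :=
  conn Ast_z Ast_zc.

Definition A_z : laurent vfield :=
  ladd (ladd (monomial 0 (dd cz)) (monomial (-1) (dd cth)))
    (monomial 0 (vscal (fun p => p cth / (twopii * p cz)) (dd cthc))).
Definition A_zc : laurent vfield :=
  ladd (monomial 0 (dd czc)) (monomial (-1) (dd cthc)).
Definition A1conn : (C * C -> C) -> (C * C -> C) -> laurent vfield :=
  conn A_z A_zc.

Definition gdot_coef (k : nat) : fct := fun p =>
  Cpow (twopii / p cz) k
  * bernoulli (k + 1) ((RtoC PI * Ci - p cth) / twopii)
  * (Cpow (RtoC (-1)) k / (RtoC (INR (k + 1)) * RtoC (INR k))).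

Definition gdot : laurent vfield := fun n =>
  if (1 <=? n)%Z then vscal (gdot_coef (Z.to_nat n)) (dd cthc)
  else fun _ _ => 0.

Definition x1st : laurent fct := fun n p =>
  if (n =? 0)%Z then p cth else if (n =? -1)%Z then - p cz else 0.
Definition x2st : laurent fct := fun n p =>
  if (n =? 0)%Z then p cthc else if (n =? -1)%Z then - p czc else 0.

Definition x1 : laurent fct := exp_app gdot x1st.
Definition x2 : laurent fct := exp_app gdot x2st.

(** * Resurgent series and Stokes jumps *)

(* [b] is the Borel transform of [f], converging on |xi| < r. *)
Definition is_borel_transform (f : laurent C) (r : R) (b : C -> C) : Prop :=
  (0 < r)%R /\
  forall xi : C, (Cmod xi < r)%R ->
  is_pseries (K := C_AbsRing) (V := C_NormedModule)
    (fun n => f (Z.of_nat n + 1)%Z / RtoC (INR (fact n))) xi (b xi).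

(* [F t] represents the germ at [gam t] obtained by continuing the germ of [b]
   at [gam 0] along [gam], whose parameter ranges over an interval [I] with
   least element 0. *)
Definition is_continuation (I : R -> Prop) (gam : R -> C) (b : C -> C)
    (F : R -> C -> C) : Prop :=
  locally (gam 0%R) (fun w => F 0%R w = b w) /\
  (forall t : R, I t -> locally (gam t)
     (fun w => ex_derive (K := C_AbsRing) (V := C_NormedModule) (F t) w)) /\
  (forall t : R, I t -> exists delta : R, (0 < delta)%R /\
     forall s : R, I s -> (Rabs (s - t) < delta)%R ->
     locally (gam s) (fun w => F s w = F t w)).

Definition unit_itv (t : R) : Prop := (0 <= t <= 1)%R.

Definition is_path (gam : R -> C) : Prop :=
  forall t : R, unit_itv t ->
  filterlim gam (within unit_itv (locally t)) (locally (gam t)).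

Definition closed_discrete (S : C -> Prop) : Prop :=
  closed S /\ forall s : C, S s -> locally s (fun w => S w -> w = s).

Definition resurgent_wrt (S : C -> Prop) (f : laurent C) : Prop :=
  closed_discrete S /\
  (forall n : Z, (n <= 0)%Z -> f n = 0) /\
  exists (r : R) (b : C -> C), is_borel_transform f r b /\
  forall gam : R -> C, is_path gam ->
    (forall t : R, unit_itv t -> ~ S (gam t)) -> (Cmod (gam 0%R) < r)%R ->
    exists F : R -> C -> C, is_continuation unit_itv gam b F.

Definition resurgent (f : laurent C) : Prop :=
  exists S : C -> Prop, resurgent_wrt S f.

(* The ray R_{>0} d. *)
Definition on_ray (d w : C) : Prop :=
  exists s : R, (0 < s)%R /\ w = RtoC s * d.

Definition is_borel_sum (f : laurent C) (d eps v : C) : Prop :=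
  (exists S : C -> Prop,
     resurgent_wrt S f /\ forall w : C, on_ray d w -> ~ S w) /\
  exists (r : R) (b : C -> C) (F : R -> C -> C),
    is_borel_transform f r b /\
    is_continuation (fun s => (0 <= s)%R) (fun s => RtoC s * d) b F /\
    is_RInt_gen (V := C_R_NormedModule)
      (fun s : R => Cexp (- (RtoC s * d / eps)) * F s (RtoC s * d) * d)
      (at_point 0%R) (Rbar_locally p_infty) v.

Definition rot (alpha : R) : C := Cexp (RtoC alpha * Ci).

(* The jump of the Borel sum of [f] across the ray R_{>0} d is [J]: clockwise
   minus counterclockwise. *)
Definition stokes_jump (f : laurent C) (d : C) (J : C -> C) : Prop :=
  exists delta kappa r : R, (0 < delta)%R /\ (0 < kappa)%R /\ (0 < r)%R /\
  forall (alpha beta phi : R) (eps : C),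
    (0 < alpha < delta)%R -> (0 < beta < delta)%R ->
    (Rabs phi < kappa)%R -> on_ray (rot phi * d) eps -> (Cmod eps < r)%R ->
  exists vminus vplus : C,
    is_borel_sum f (rot (- alpha) * d) eps vminus /\
    is_borel_sum f (rot beta * d) eps vplus /\
    vminus - vplus = J eps.

(* Main.v *)
Require Import Defs.
From Stdlib Require Import List Lia Lra Psatz FunctionalExtensionality.
From Stdlib Require Classical_Prop.
Import ListNotations.

(** Why the statement is true.

    Formal part. The field gdot is a series in epsilon times the coordinate
    field of theta-check, and its coefficients g_n do not involve theta-check.
    Hence L_gdot applied twice kills A^st, and e^gdot fixes x^1 and adds the
    series of the g_n to x^2. The one bracket that survives is computed order by
    order in epsilon: d g_n / dz + d g_(n+1) / dtheta = 0 for n >= 1, and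
    - d g_1 / dtheta is the coefficient theta / (2 pi i z) of A. Both identities
    are B_m' = m B_(m-1), see [cderiv_bern] and [lbracket_Ast].

    Analytic part. By the generating function of the Bernoulli polynomials
    ([bernoulli_generating]) the Borel transform of x^2 - x^(2,st) is, in the
    variable w = xi / z and up to the factor 1 / z,
      (1 + theta w - e^(theta w) pi w / sin (pi w)) / (2 pi i w^2)
    ([borel_form], [gdot_borel]). This is a single-valued meromorphic function
    with simple poles at the nonzero integers and a removable singularity at 0,
    so analytic continuation along a path that avoids the points n z is just the
    function itself, which gives resurgence. Away from its poles it grows at most
    exponentially, so its Laplace integrals converge for small epsilon.

    Cut two rays on the two sides of R_(>0) d by a far segment. If there is no
    pole between the rays, Cauchy's theorem says that the two truncated
    integrals differ by the integral over that segment, which tends to 0: there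
    is no jump ([jump_off_poles]). Between two rays around R_(>0) z lie the
    poles w = n >= 1, where 2 pi i times the residue of the Laplace integrand is
      - (-q)^n / n   with   q = e^(theta - z / epsilon)
    ([borel_form_residue]). The jump is the sum of these numbers, log (1 + q)
    ([log_series]). The ray opposite to z reduces to this one since the
    closed form is invariant under (w, theta) -> (-w, -theta)
    ([borel_form_sym], [jump_at_poles]).

    Cauchy's theorem and the residue theorem are needed for polygons only, and
    both follow from [cauchy_cone]: the integral of h over the base of a triangle
    dilated by t from its apex has, as a function of t, the derivative
    h (A + t Q) Q - h (A + t P) P. Around a pole, four such triangles make a
    quadrilateral; the radial terms cancel, and shrinking the quadrilateral
    leaves 2 pi i times the residue ([quadrilateral_residue]). The sector between
    the two rays is cut by the lines Re w = N + 1/2 into quadrilaterals around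
    the single integers ([sector_residues]). *)

(** * Continuity and complex derivatives *)

Lemma Cmod_le_abs (a : C) : (Cmod a <= Rabs (fst a) + Rabs (snd a))%R.
Proof.
unfold Cmod; apply Rsqr_incr_0_var.
- rewrite Rsqr_sqrt by nra; unfold Rsqr.
  pose proof (Rabs_pos (fst a)); pose proof (Rabs_pos (snd a)).
  rewrite <- (pow2_abs (fst a)), <- (pow2_abs (snd a)); nra.
- pose proof (Rabs_pos (fst a)); pose proof (Rabs_pos (snd a)); lra.
Qed.

Lemma abs_fst_le (a : C) : (Rabs (fst a) <= Cmod a)%R.
Proof. exact (re_le_Cmod a). Qed.

Lemma abs_snd_le (a : C) : (Rabs (snd a) <= Cmod a)%R.
Proof.
apply Rle_trans with (2 := Rmax_Cmod a); apply Rmax_r.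
Qed.

Lemma Cmod_neq_0 (a : C) : (0 < Cmod a)%R -> a <> 0.
Proof. intros H E; rewrite E, Cmod_0 in H; lra. Qed.

Lemma RtoC_neq_0 (x : R) : x <> 0%R -> RtoC x <> 0.
Proof. intros H E; now apply H, RtoC_inj. Qed.

Lemma Cmod_ge_sub (a b : C) : (Cmod a - Cmod b <= Cmod (a + b))%R.
Proof.
pose proof (Cmod_triangle (a + b) (- b)) as H; rewrite Cmod_opp in H.
replace (a + b + - b) with a in H by ring; lra.
Qed.

Definition ccont (q : C -> C) (w : C) : Prop :=
  forall e : R, (0 < e)%R -> exists d : R, (0 < d)%R /\
  forall v : C, (Cmod (v - w) < d)%R -> (Cmod (q v - q w) < e)%R.

(** Caratheodory's form of the derivative: the difference quotient extends
    continuously to [w]. Sums, products, inverses and compositions then reduce to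
    algebra and continuity, and at a simple zero the factor [q] is what is left
    after dividing by [v - w]. *)
Definition cderiv (h : C -> C) (w l : C) : Prop :=
  exists q : C -> C, ccont q w /\ q w = l /\
  forall v : C, h v - h w = q v * (v - w).

Lemma ccont_const (c w : C) : ccont (fun _ => c) w.
Proof.
intros e He; exists 1%R; split; [lra|]; intros v _.
replace (c - c) with (RtoC 0) by ring; rewrite Cmod_0; exact He.
Qed.

Lemma ccont_id (w : C) : ccont (fun v => v) w.
Proof. intros e He; exists e; split; auto. Qed.

Lemma ccont_ext_loc (f g : C -> C) (w : C) :
  (exists d, (0 < d)%R /\ forall v, (Cmod (v - w) < d)%R -> f v = g v) ->
  ccont f w -> ccont g w.
Proof.
intros (d & Hd & E) Hf e He.
destruct (Hf e He) as (d1 & Hd1 & H1).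
exists (Rmin d d1); split; [now apply Rmin_pos|]; intros v Hv.
rewrite <- !E.
- apply H1, Rlt_le_trans with (1 := Hv), Rmin_r.
- replace (w - w) with (RtoC 0) by ring; now rewrite Cmod_0.
- apply Rlt_le_trans with (1 := Hv), Rmin_l.
Qed.

Lemma ccont_plus (f g : C -> C) (w : C) :
  ccont f w -> ccont g w -> ccont (fun v => f v + g v) w.
Proof.
intros Hf Hg e He.
destruct (Hf (e / 2)%R) as (d1 & Hd1 & H1); [lra|].
destruct (Hg (e / 2)%R) as (d2 & Hd2 & H2); [lra|].
exists (Rmin d1 d2); split; [now apply Rmin_pos|]; intros v Hv.
assert (Hv1 := H1 v (Rlt_le_trans _ _ _ Hv (Rmin_l _ _))).
assert (Hv2 := H2 v (Rlt_le_trans _ _ _ Hv (Rmin_r _ _))).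
replace (f v + g v - (f w + g w)) with ((f v - f w) + (g v - g w)) by ring.
pose proof (Cmod_triangle (f v - f w) (g v - g w)); lra.
Qed.

Lemma ccont_mult (f g : C -> C) (w : C) :
  ccont f w -> ccont g w -> ccont (fun v => f v * g v) w.
Proof.
intros Hf Hg e He.
set (A := (Cmod (f w) + Cmod (g w) + 2)%R).
assert (HA : (2 <= A)%R).
{ pose proof (Cmod_ge_0 (f w)); pose proof (Cmod_ge_0 (g w)); unfold A; lra. }
assert (Hm : (0 < Rmin 1 (e / A))%R).
{ apply Rmin_pos; [lra|]; apply Rdiv_lt_0_compat; lra. }
destruct (Hf _ Hm) as (d1 & Hd1 & H1).
destruct (Hg _ Hm) as (d2 & Hd2 & H2).
exists (Rmin d1 d2); split; [now apply Rmin_pos|]; intros v Hv.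
assert (Hv1 := H1 v (Rlt_le_trans _ _ _ Hv (Rmin_l _ _))).
assert (Hv2 := H2 v (Rlt_le_trans _ _ _ Hv (Rmin_r _ _))).
replace (f v * g v - f w * g w)
  with ((f v - f w) * (g v - g w) + ((f v - f w) * g w + f w * (g v - g w)))
  by ring.
pose proof (Cmod_triangle ((f v - f w) * (g v - g w))
  ((f v - f w) * g w + f w * (g v - g w))) as T1.
pose proof (Cmod_triangle ((f v - f w) * g w) (f w * (g v - g w))) as T2.
repeat rewrite Cmod_mult in T1; repeat rewrite Cmod_mult in T2.
pose proof (Rmin_l 1 (e / A)); pose proof (Rmin_r 1 (e / A)).
assert (HeA : (e / A * A = e)%R) by (field; lra).
set (m := Rmin 1 (e / A)) in *.
pose proof (Cmod_ge_0 (f v - f w)); pose proof (Cmod_ge_0 (g v - g w)).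
pose proof (Cmod_ge_0 (f w)); pose proof (Cmod_ge_0 (g w)).
assert (Cmod (f v - f w) * Cmod (g v - g w) <= m * 1)%R by
  (apply Rmult_le_compat; lra).
assert (Cmod (f v - f w) * Cmod (g w) <= m * Cmod (g w))%R by
  (apply Rmult_le_compat_r; lra).
assert (Cmod (f w) * Cmod (g v - g w) <= m * Cmod (f w))%R by nra.
assert (m * A <= e)%R by (rewrite <- HeA; apply Rmult_le_compat_r; lra).
assert (m * A = m * Cmod (f w) + m * Cmod (g w) + 2 * m)%R by (unfold A; ring).
lra.
Qed.

Ltac ccont_arith := repeat first
  [apply ccont_const | apply ccont_id | apply ccont_plus | apply ccont_mult].

Lemma ccont_bounded_below (f : C -> C) (w : C) :
  ccont f w -> f w <> 0 ->
  exists d, (0 < d)%R /\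
  forall v, (Cmod (v - w) < d)%R -> (Cmod (f w) / 2 < Cmod (f v))%R.
Proof.
intros Hf Hw; apply Cmod_gt_0 in Hw.
destruct (Hf (Cmod (f w) / 2)%R) as (d & Hd & H); [lra|].
exists d; split; [exact Hd|]; intros v Hv; specialize (H v Hv).
pose proof (Cmod_ge_sub (f w) (f v - f w)) as T.
replace (f w + (f v - f w)) with (f v) in T by ring; lra.
Qed.

Lemma ccont_inv (f : C -> C) (w : C) :
  ccont f w -> f w <> 0 -> ccont (fun v => / f v) w.
Proof.
intros Hf Hw e He.
destruct (ccont_bounded_below f w Hf Hw) as (d1 & Hd1 & H1).
pose proof (proj1 (Cmod_gt_0 _) Hw) as Hp.
set (m := Cmod (f w)) in *.
destruct (Hf (e * (m * m / 2))%R) as (d2 & Hd2 & H2).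
{ apply Rmult_lt_0_compat; [lra|]; nra. }
exists (Rmin d1 d2); split; [now apply Rmin_pos|]; intros v Hv.
assert (Hv1 := H1 v (Rlt_le_trans _ _ _ Hv (Rmin_l _ _))).
assert (Hv2 := H2 v (Rlt_le_trans _ _ _ Hv (Rmin_r _ _))).
assert (Hfv : f v <> 0) by (apply Cmod_neq_0; lra).
replace (/ f v - / f w) with (- (f v - f w) / (f v * f w)) by (field; split; assumption).
rewrite Cmod_div, Cmod_opp, Cmod_mult by now apply Cmult_neq_0.
fold m.
apply Rmult_lt_reg_r with (Cmod (f v) * m)%R; [nra|].
unfold Rdiv; rewrite Rmult_assoc, Rinv_l, Rmult_1_r by nra.
apply Rlt_trans with (1 := Hv2).
apply Rmult_lt_compat_l; [lra|]; nra.
Qed.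

Lemma ccont_comp (f g : C -> C) (w : C) :
  ccont f w -> ccont g (f w) -> ccont (fun v => g (f v)) w.
Proof.
intros Hf Hg e He.
destruct (Hg e He) as (d & Hd & H).
destruct (Hf d Hd) as (d' & Hd' & H').
exists d'; split; auto.
Qed.

Lemma cderiv_ccont (h : C -> C) (w l : C) : cderiv h w l -> ccont h w.
Proof.
intros (q & Hq & _ & E).
apply ccont_ext_loc with (fun v => h w + q v * (v + - w)).
- exists 1%R; split; [lra|]; intros v _.
  replace (v + - w) with (v - w) by ring; rewrite <- E; ring.
- apply ccont_plus; [apply ccont_const|].
  apply ccont_mult; [exact Hq|].
  apply ccont_plus; [apply ccont_id|apply ccont_const].
Qed.

(** Away from [w] the quotient can be taken literally, so the factorisation is
    only needed near [w]. *)
Lemma cderiv_local (h : C -> C) (w l : C) (q : C -> C) (d : R) :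
  (0 < d)%R -> ccont q w -> q w = l ->
  (forall v, (Cmod (v - w) < d)%R -> h v - h w = q v * (v - w)) ->
  cderiv h w l.
Proof.
intros Hd Hq Hl E.
exists (fun v => if Rlt_dec (Cmod (v - w)) d then q v
                 else (h v - h w) / (v - w)).
assert (H0 : (Cmod (w - w) < d)%R).
{ replace (w - w) with (RtoC 0) by ring; now rewrite Cmod_0. }
split; [|split].
- apply ccont_ext_loc with q; [|exact Hq].
  exists d; split; [exact Hd|]; intros v Hv.
  now destruct (Rlt_dec (Cmod (v - w)) d).
- now destruct (Rlt_dec (Cmod (w - w)) d).
- intros v; destruct (Rlt_dec (Cmod (v - w)) d) as [H|H]; [now apply E|].
  field; apply Cmod_neq_0; lra.
Qed.

Lemma cderiv_ext_loc (f g : C -> C) (w l : C) :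
  (exists d, (0 < d)%R /\ forall v, (Cmod (v - w) < d)%R -> f v = g v) ->
  cderiv f w l -> cderiv g w l.
Proof.
intros (d & Hd & E) (q & Hq & Hl & Eq).
apply cderiv_local with q d; try assumption.
intros v Hv; rewrite <- !E; auto.
replace (w - w) with (RtoC 0) by ring; now rewrite Cmod_0.
Qed.

Lemma cderiv_const (c w : C) : cderiv (fun _ => c) w 0.
Proof.
exists (fun _ => 0); split; [apply ccont_const|split; [reflexivity|]].
intros v; ring.
Qed.

Lemma cderiv_id (w : C) : cderiv (fun v => v) w 1.
Proof.
exists (fun _ => 1); split; [apply ccont_const|split; [reflexivity|]].
intros v; ring.
Qed.

Lemma cderiv_plus (f g : C -> C) (w l m : C) :
  cderiv f w l -> cderiv g w m -> cderiv (fun v => f v + g v) w (l + m).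
Proof.
intros (p & Hp & Hl & E) (q & Hq & Hm & E').
exists (fun v => p v + q v); split; [now apply ccont_plus|].
split; [now rewrite Hl, Hm|]; intros v.
replace (f v + g v - (f w + g w)) with ((f v - f w) + (g v - g w)) by ring.
rewrite E, E'; ring.
Qed.

Lemma cderiv_mult (f g : C -> C) (w l m : C) :
  cderiv f w l -> cderiv g w m ->
  cderiv (fun v => f v * g v) w (l * g w + f w * m).
Proof.
intros (p & Hp & Hl & E) Hg.
pose proof (cderiv_ccont _ _ _ Hg) as Cg.
destruct Hg as (q & Hq & Hm & E').
exists (fun v => p v * g v + f w * q v); split.
- apply ccont_plus; apply ccont_mult; auto using ccont_const.
- split; [now rewrite Hl, Hm|]; intros v.
  replace (f v * g v - f w * g w)
    with ((f v - f w) * g v + f w * (g v - g w)) by ring.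
  rewrite E, E'; ring.
Qed.

Lemma cderiv_eq (h : C -> C) (w l m : C) : cderiv h w l -> l = m -> cderiv h w m.
Proof. now intros H <-. Qed.

Lemma cderiv_affine (A B w : C) : cderiv (fun v => A + v * B) w B.
Proof.
eapply cderiv_eq.
- apply cderiv_plus; [apply cderiv_const|].
  apply cderiv_mult; [apply cderiv_id|apply cderiv_const].
- cbv beta; ring.
Qed.

Lemma cderiv_monomial (n : nat) (w : C) :
  cderiv (fun v => Cpow v (S n)) w (RtoC (INR (S n)) * Cpow w n).
Proof.
induction n as [|n IH].
- apply cderiv_ext_loc with (fun v => v).
  + exists 1%R; split; [lra|]; intros; simpl; ring.
  + eapply cderiv_eq; [apply cderiv_id|]; simpl; ring.
- apply (cderiv_eq (fun v => v * Cpow v (S n)) w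
    (1 * Cpow w (S n) + w * (RtoC (INR (S n)) * Cpow w n))).
  + now apply cderiv_mult; [apply cderiv_id|].
  + rewrite (S_INR (S n)), RtoC_plus, !Cpow_S; ring.
Qed.

Lemma ccont_monomial (x : C) (n : nat) (w : C) : ccont (fun v => x * Cpow v n) w.
Proof.
induction n as [|n IH].
- apply (ccont_const (x * 1)).
- apply ccont_ext_loc with (fun v => v * (x * Cpow v n)).
  + exists 1%R; split; [lra|]; intros; rewrite Cpow_S; ring.
  + apply ccont_mult; [apply ccont_id|exact IH].
Qed.

Lemma cderiv_inv (f : C -> C) (w l : C) :
  cderiv f w l -> f w <> 0 ->
  cderiv (fun v => / f v) w (- l * / (f w * f w)).
Proof.
intros Hf Hw; pose proof (cderiv_ccont _ _ _ Hf) as Cf.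
destruct (ccont_bounded_below f w Cf Hw) as (d & Hd & Hb).
destruct Hf as (p & Hp & Hl & E).
apply cderiv_local with (fun v => - (1) * p v * / (f v * f w)) d.
- exact Hd.
- apply ccont_mult.
  + apply ccont_mult; [apply ccont_const|exact Hp].
  + apply ccont_inv; [|now apply Cmult_neq_0].
    apply ccont_mult; [exact Cf|apply ccont_const].
- rewrite Hl; ring.
- intros v Hv.
  assert (Hfv : f v <> 0).
  { apply Cmod_neq_0; specialize (Hb v Hv); pose proof (Cmod_ge_0 (f w)); lra. }
  replace (/ f v - / f w) with (- (f v - f w) / (f v * f w)) by (field; split; assumption).
  rewrite E; field; split; assumption.
Qed.

Lemma cderiv_comp (f g : C -> C) (w l m : C) :
  cderiv f w l -> cderiv g (f w) m -> cderiv (fun v => g (f v)) w (m * l).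
Proof.
intros Hf (q & Hq & Hm & E').
pose proof (cderiv_ccont _ _ _ Hf) as Cf.
destruct Hf as (p & Hp & Hl & E).
exists (fun v => q (f v) * p v); split.
- apply ccont_mult; [|exact Hp]; now apply (ccont_comp f q).
- split; [now rewrite Hl, Hm|]; intros v; rewrite E', E; ring.
Qed.

Lemma cderiv_eps (h : C -> C) (w l : C) :
  (forall e, (0 < e)%R -> exists d, (0 < d)%R /\ forall v,
     (Cmod (v - w) < d)%R ->
     (Cmod (h v - h w - l * (v - w)) <= e * Cmod (v - w))%R) <->
  cderiv h w l.
Proof.
split.
- intros H.
  exists (fun v => if Ceq_dec v w then l else (h v - h w) / (v - w)).
  split; [|split].
  + intros e He; destruct (H (e / 2)%R) as (d & Hd & Hv); [lra|].
    exists d; split; [exact Hd|]; intros v Hvd; specialize (Hv v Hvd).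
    destruct (Ceq_dec w w) as [_|]; [|contradiction].
    destruct (Ceq_dec v w) as [_|Hne].
    * replace (l - l) with (RtoC 0) by ring; now rewrite Cmod_0.
    * assert (Hz : v - w <> 0) by (intros Z; apply Hne, Ceq_minus, Z).
      pose proof (proj1 (Cmod_gt_0 _) Hz).
      replace ((h v - h w) / (v - w) - l)
        with ((h v - h w - l * (v - w)) / (v - w)) by (now field).
      rewrite Cmod_div by assumption.
      apply Rle_lt_trans with (e / 2)%R; [|lra].
      now apply Rle_div_l.
  + now destruct (Ceq_dec w w).
  + intros v; destruct (Ceq_dec v w) as [->|Hne]; [ring|].
    field; intros Z; apply Hne, Ceq_minus, Z.
- intros (q & Hq & Hl & E) e He.
  destruct (Hq e He) as (d & Hd & H); exists d; split; [exact Hd|].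
  intros v Hv; specialize (H v Hv); rewrite E.
  replace (q v * (v - w) - l * (v - w)) with ((q v - q w) * (v - w))
    by (rewrite Hl; ring).
  rewrite Cmod_mult; apply Rmult_le_compat_r; [apply Cmod_ge_0|lra].
Qed.

Lemma locally_Cmod (w : C) (P : C -> Prop) :
  locally (T := C_UniformSpace) w P <->
  exists d, (0 < d)%R /\ forall v, (Cmod (v - w) < d)%R -> P v.
Proof.
split.
- intros H; apply locally_C in H; destruct H as (d & H).
  exists d; split; [apply cond_pos|]; intros v Hv; now apply H.
- intros (d & Hd & H); apply locally_C; exists (mkposreal d Hd).
  intros v Hv; now apply H.
Qed.

Lemma cderiv_is_derive (h : C -> C) (w l : C) :
  cderiv h w l ->
  is_derive (K := C_AbsRing) (V := C_NormedModule) h w l.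
Proof.
intros H; split.
- apply is_linear_scal_l.
- intros x Hx.
  apply (is_filter_lim_locally_unique (V := AbsRing_NormedModule C_AbsRing)) in Hx; subst x.
  intros e; apply cderiv_eps with (e := pos e) in H; [|apply cond_pos].
  destruct H as (d & Hd & H); exists (mkposreal d Hd); intros v Hv.
  specialize (H v Hv); rewrite (Cmult_comm l) in H; exact H.
Qed.

Lemma cderiv_C_derive (h : C -> C) (w l : C) :
  cderiv h w l -> C_derive h w = l.
Proof.
intros H; apply is_C_derive_unique; apply cderiv_is_derive in H; exact H.
Qed.

(** A path that is affine in a real parameter is the restriction of an affine map
    of C. Every integrand below is therefore the restriction to the real axis of a
    function of a complex variable, and differentiates like that function. *)
Lemma cderiv_real (h : C -> C) (t : R) (l : C) :
  cderiv h (RtoC t) l ->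
  is_derive (fun s => fst (h (RtoC s))) t (fst l) /\
  is_derive (fun s => snd (h (RtoC s))) t (snd l).
Proof.
intros H.
assert (K : forall e, (0 < e)%R -> exists d, (0 < d)%R /\ forall s,
  s <> 0%R -> (Rabs s < d)%R ->
  (Cmod ((h (RtoC (t + s)) - h (RtoC t)) / RtoC s - l) < e)%R).
{ intros e He; rewrite <- cderiv_eps in H.
  destruct (H (e / 2)%R) as (d & Hd & Hv); [lra|].
  exists d; split; [exact Hd|]; intros s Hs Hsd.
  specialize (Hv (RtoC (t + s))).
  replace (RtoC (t + s) - RtoC t) with (RtoC s) in Hv
    by (rewrite RtoC_plus; ring).
  rewrite Cmod_R in Hv; specialize (Hv Hsd).
  assert (Hz : RtoC s <> 0) by (intros Z; now apply Hs, RtoC_inj).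
  replace ((h (RtoC (t + s)) - h (RtoC t)) / RtoC s - l)
    with ((h (RtoC (t + s)) - h (RtoC t) - l * RtoC s) / RtoC s)
    by (now field).
  rewrite Cmod_div, Cmod_R by assumption.
  apply Rle_lt_trans with (e / 2)%R; [|lra].
  apply Rle_div_l; [now apply Rabs_pos_lt|exact Hv]. }
assert (D : forall (z : C) (s : R), s <> 0%R ->
  z / RtoC s = ((fst z / s)%R, (snd z / s)%R)).
{ intros z s Hs; unfold Cdiv, Cinv, Cmult, RtoC; simpl; f_equal; now field. }
split; apply is_derive_Reals; intros e He; destruct (K e He) as (d & Hd & Hs);
  exists (mkposreal d Hd); intros s Hs0 Hsd; specialize (Hs s Hs0 Hsd).
- eapply Rle_lt_trans; [|exact Hs].
  eapply Rle_trans; [|apply abs_fst_le].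
  rewrite D by assumption; simpl; apply Req_le; reflexivity.
- eapply Rle_lt_trans; [|exact Hs].
  eapply Rle_trans; [|apply abs_snd_le].
  rewrite D by assumption; simpl; apply Req_le; reflexivity.
Qed.

Lemma ccont_real (h : C -> C) (t : R) :
  ccont h (RtoC t) ->
  continuous (fun s => fst (h (RtoC s))) t /\
  continuous (fun s => snd (h (RtoC s))) t.
Proof.
intros H; split; intros P (e & HP); destruct (H e (cond_pos e)) as (d & Hd & K);
  exists (mkposreal d Hd); intros s Hs; apply HP.
- eapply Rle_lt_trans; [|apply (K (RtoC s))].
  + eapply Rle_trans; [|apply abs_fst_le]; apply Req_le; reflexivity.
  + rewrite <- RtoC_minus, Cmod_R; exact Hs.
- eapply Rle_lt_trans; [|apply (K (RtoC s))].
  + eapply Rle_trans; [|apply abs_snd_le]; apply Req_le; reflexivity.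
  + rewrite <- RtoC_minus, Cmod_R; exact Hs.
Qed.

(** * Integrals of complex functions of a real variable *)

Definition pcont (f : R -> C) (t : R) : Prop :=
  continuous (fun s => fst (f s)) t /\ continuous (fun s => snd (f s)) t.

(** Integrating the two components separately gives access to the theorems about
    real integrals; [Cint_is_RInt] returns to the integral in C. *)
Definition Cint (f : R -> C) (a b : R) : C :=
  (RInt (fun t => fst (f t)) a b, RInt (fun t => snd (f t)) a b).

Lemma Cint_ex (f : R -> C) (a b : R) :
  (a <= b)%R -> (forall t, (a <= t <= b)%R -> pcont f t) ->
  ex_RInt (fun t => fst (f t)) a b /\ ex_RInt (fun t => snd (f t)) a b.
Proof.
intros Hab H; split;
  apply (ex_RInt_continuous (V := R_CompleteNormedModule));
  rewrite Rmin_left, Rmax_right by lra; intros t Ht; now apply H.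
Qed.

Lemma Cint_is_RInt (f : R -> C) (a b : R) :
  (a <= b)%R -> (forall t, (a <= t <= b)%R -> pcont f t) ->
  is_RInt (V := C_R_NormedModule) f a b (Cint f a b).
Proof.
intros Hab H; destruct (Cint_ex f a b Hab H) as (H1 & H2).
apply (is_RInt_fct_extend_pair f a b);
  now apply (RInt_correct (V := R_CompleteNormedModule)).
Qed.

Lemma Cint_ext (f g : R -> C) (a b : R) :
  (a <= b)%R -> (forall t, (a <= t <= b)%R -> f t = g t) ->
  Cint f a b = Cint g a b.
Proof.
intros Hab H; unfold Cint; f_equal;
  apply (RInt_ext (V := R_CompleteNormedModule));
  rewrite Rmin_left, Rmax_right by lra; intros t Ht; rewrite H; auto; lra.
Qed.

Lemma Cint_plus (f g : R -> C) (a b : R) :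
  (a <= b)%R -> (forall t, (a <= t <= b)%R -> pcont f t) ->
  (forall t, (a <= t <= b)%R -> pcont g t) ->
  Cint (fun t => f t + g t) a b = Cint f a b + Cint g a b.
Proof.
intros Hab Hf Hg.
destruct (Cint_ex f a b Hab Hf) as (H1 & H2).
destruct (Cint_ex g a b Hab Hg) as (H3 & H4).
unfold Cint, Cplus; simpl; f_equal;
  now apply (RInt_plus (V := R_CompleteNormedModule)).
Qed.

Lemma Cint_scal (c : C) (f : R -> C) (a b : R) :
  (a <= b)%R -> (forall t, (a <= t <= b)%R -> pcont f t) ->
  Cint (fun t => c * f t) a b = c * Cint f a b.
Proof.
intros Hab Hf.
destruct (Cint_ex f a b Hab Hf) as (H1 & H2).
assert (S : forall (g : R -> R) k, ex_RInt g a b ->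
  ex_RInt (fun t => (k * g t)%R) a b /\
  RInt (fun t => (k * g t)%R) a b = (k * RInt g a b)%R).
{ intros g k Hg; split.
  - now apply (ex_RInt_scal (V := R_NormedModule)).
  - now apply (RInt_scal (V := R_CompleteNormedModule)). }
destruct (S _ (fst c) H1) as (E1 & I1), (S _ (fst c) H2) as (E2 & I2).
destruct (S _ (snd c) H1) as (E3 & I3), (S _ (snd c) H2) as (E4 & I4).
unfold Cint, Cmult; cbn [fst snd]; f_equal.
- rewrite <- I1, <- I4.
  now apply (RInt_minus (V := R_CompleteNormedModule)
    (fun t => (fst c * fst (f t))%R) (fun t => (snd c * snd (f t))%R)).
- rewrite <- I2, <- I3.
  now apply (RInt_plus (V := R_CompleteNormedModule)
    (fun t => (fst c * snd (f t))%R) (fun t => (snd c * fst (f t))%R)).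
Qed.

Lemma Cint_minus (f g : R -> C) (a b : R) :
  (a <= b)%R -> (forall t, (a <= t <= b)%R -> pcont f t) ->
  (forall t, (a <= t <= b)%R -> pcont g t) ->
  Cint (fun t => f t - g t) a b = Cint f a b - Cint g a b.
Proof.
intros Hab Hf Hg.
destruct (Cint_ex f a b Hab Hf) as (H1 & H2).
destruct (Cint_ex g a b Hab Hg) as (H3 & H4).
unfold Cint, Cminus, Cplus, Copp; simpl; f_equal;
  now apply (RInt_minus (V := R_CompleteNormedModule)).
Qed.

Lemma Cint_Chasles (f : R -> C) (a b c : R) :
  (a <= b)%R -> (b <= c)%R -> (forall t, (a <= t <= c)%R -> pcont f t) ->
  Cint f a b + Cint f b c = Cint f a c.
Proof.
intros Hab Hbc H.
destruct (Cint_ex f a b Hab) as (H1 & H2); [intros; apply H; lra|].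
destruct (Cint_ex f b c Hbc) as (H3 & H4); [intros; apply H; lra|].
unfold Cint, Cplus; simpl; f_equal;
  now apply (RInt_Chasles (V := R_CompleteNormedModule)).
Qed.

(** The factor 2 comes from bounding the two components separately; every
    application is to a quantity that tends to 0. *)
Lemma Cint_bound (f : R -> C) (a b M : R) :
  (a <= b)%R -> (forall t, (a <= t <= b)%R -> pcont f t) ->
  (forall t, (a <= t <= b)%R -> (Cmod (f t) <= M)%R) ->
  (Cmod (Cint f a b) <= 2 * (M * (b - a)))%R.
Proof.
intros Hab H HM.
destruct (Cint_ex f a b Hab H) as (H1 & H2).
eapply Rle_trans; [apply Cmod_le_abs|]; unfold Cint; cbn [fst snd].
assert (K : forall g : R -> R, ex_RInt g a b ->
  (forall t, (a <= t <= b)%R -> (Rabs (g t) <= M)%R) ->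
  (Rabs (RInt g a b) <= (b - a) * M)%R).
{ intros g Hg Hb; now apply abs_RInt_le_const. }
assert (K1 := K _ H1 (fun t Ht => Rle_trans _ _ _ (abs_fst_le _) (HM t Ht))).
assert (K2 := K _ H2 (fun t Ht => Rle_trans _ _ _ (abs_snd_le _) (HM t Ht))).
simpl in K1, K2; lra.
Qed.

Lemma Cint_derive (F f : R -> C) (a b : R) :
  (a <= b)%R -> (forall t, (a <= t <= b)%R -> pcont f t) ->
  (forall t, (a <= t <= b)%R ->
     is_derive (fun s => fst (F s)) t (fst (f t)) /\
     is_derive (fun s => snd (F s)) t (snd (f t))) ->
  Cint f a b = F b - F a.
Proof.
intros Hab H HF; unfold Cint.
assert (K : forall G g : R -> R,
  (forall t, (a <= t <= b)%R -> continuous g t) ->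
  (forall t, (a <= t <= b)%R -> is_derive G t (g t)) ->
  RInt g a b = (G b - G a)%R).
{ intros G g Hg HG; apply is_RInt_unique.
  apply (is_RInt_derive (V := R_CompleteNormedModule));
    rewrite Rmin_left, Rmax_right by lra; auto. }
rewrite (K (fun t => fst (F t))), (K (fun t => snd (F t)));
  try (intros t Ht; now (apply H || apply HF)).
reflexivity.
Qed.

Lemma Cint_comp_lin (f : R -> C) (u v a b : R) :
  (0 < u)%R -> (a <= b)%R ->
  (forall t, (u * a + v <= t <= u * b + v)%R -> pcont f t) ->
  Cint (fun t => RtoC u * f (u * t + v)%R) a b = Cint f (u * a + v) (u * b + v).
Proof.
intros Hu Hab H.
assert (Hab' : (u * a + v <= u * b + v)%R) by nra.
destruct (Cint_ex f _ _ Hab' H) as (H1 & H2).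
assert (K : forall g : R -> R, ex_RInt g (u * a + v) (u * b + v) ->
  RInt (fun t => (u * g (u * t + v))%R) a b = RInt g (u * a + v) (u * b + v)).
{ intros g Hg; now apply (RInt_comp_lin (V := R_CompleteNormedModule)). }
unfold Cint; f_equal; [rewrite <- K by exact H1|rewrite <- K by exact H2];
  apply RInt_ext; intros; unfold Cmult, RtoC; simpl; ring.
Qed.

Lemma ccont_pcont (h : C -> C) (t : R) :
  ccont h (RtoC t) -> pcont (fun s => h (RtoC s)) t.
Proof. exact (ccont_real h t). Qed.

(** * Cauchy's theorem for triangles *)

(** Continuity of the derivative is part of the notion: it is what allows
    differentiation under the integral sign in [cauchy_cone]. *)
Definition holo (O : C -> Prop) (h : C -> C) : Prop :=
  exists h' : C -> C, forall w, O w -> cderiv h w (h' w) /\ ccont h' w.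

Definition Copen (O : C -> Prop) : Prop :=
  forall w, O w -> exists d, (0 < d)%R /\
  forall v, (Cmod (v - w) < d)%R -> O v.

Definition seg (h : C -> C) (P Q : C) : C :=
  Cint (fun s => h (P + RtoC s * (Q - P)) * (Q - P)) 0 1.

Definition cont2 (F : R -> R -> C) (t s : R) : Prop :=
  continuity_2d_pt (fun u v => fst (F u v)) t s /\
  continuity_2d_pt (fun u v => snd (F u v)) t s.

Lemma cont2_mult (F G : R -> R -> C) (t s : R) :
  cont2 F t s -> cont2 G t s -> cont2 (fun u v => F u v * G u v) t s.
Proof.
intros (F1 & F2) (G1 & G2); split; simpl.
- apply continuity_2d_pt_minus; now apply continuity_2d_pt_mult.
- apply continuity_2d_pt_plus; now apply continuity_2d_pt_mult.
Qed.

Lemma cont2_plus (F G : R -> R -> C) (t s : R) :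
  cont2 F t s -> cont2 G t s -> cont2 (fun u v => F u v + G u v) t s.
Proof.
intros (F1 & F2) (G1 & G2); split; now apply continuity_2d_pt_plus.
Qed.

Lemma cont2_const (c : C) (t s : R) : cont2 (fun _ _ => c) t s.
Proof. split; apply continuity_2d_pt_const. Qed.

Lemma cont2_left (t s : R) : cont2 (fun u _ => RtoC u) t s.
Proof. split; [apply continuity_2d_pt_id1|apply (continuity_2d_pt_const t s 0)]. Qed.

Lemma cont2_right (t s : R) : cont2 (fun _ v => RtoC v) t s.
Proof. split; [apply continuity_2d_pt_id2|apply (continuity_2d_pt_const t s 0)]. Qed.

Lemma cont2_near (F : R -> R -> C) (t s e : R) :
  cont2 F t s -> (0 < e)%R -> exists d, (0 < d)%R /\
  forall u v, (Rabs (u - t) < d)%R -> (Rabs (v - s) < d)%R ->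
  (Cmod (F u v - F t s) < e)%R.
Proof.
intros (F1 & F2) He; assert (He2 : (0 < e / 2)%R) by lra.
destruct (F1 (mkposreal _ He2)) as (d1 & H1).
destruct (F2 (mkposreal _ He2)) as (d2 & H2).
exists (Rmin d1 d2); split; [apply Rmin_pos; apply cond_pos|].
intros u v Hu Hv.
assert (K1 := H1 u v (Rlt_le_trans _ _ _ Hu (Rmin_l _ _))
                     (Rlt_le_trans _ _ _ Hv (Rmin_l _ _))).
assert (K2 := H2 u v (Rlt_le_trans _ _ _ Hu (Rmin_r _ _))
                     (Rlt_le_trans _ _ _ Hv (Rmin_r _ _))).
simpl in K1, K2; pose proof (Cmod_le_abs (F u v - F t s)) as L.
unfold Cminus, Cplus, Copp in L; simpl in L; unfold Rminus in *.
apply Rle_lt_trans with (1 := L); lra.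
Qed.

Lemma cont2_comp (F : R -> R -> C) (k : C -> C) (t s : R) :
  cont2 F t s -> ccont k (F t s) -> cont2 (fun u v => k (F u v)) t s.
Proof.
intros HF Hk; split; intros e; destruct (Hk e (cond_pos e)) as (d & Hd & H);
  destruct (cont2_near F t s d HF Hd) as (d' & Hd' & H');
  exists (mkposreal d' Hd'); intros u v Hu Hv;
  eapply Rle_lt_trans; try apply (H _ (H' u v Hu Hv)).
- eapply Rle_trans; [|apply abs_fst_le]; apply Req_le; reflexivity.
- eapply Rle_trans; [|apply abs_snd_le]; apply Req_le; reflexivity.
Qed.

(** Differentiability is asked for on a neighbourhood of each point of the
    parameter segment (third hypothesis), since continuity of the partial
    derivative is a statement about both variables, and also uniformly along the
    segment (fourth hypothesis). *)
Lemma is_derive_Cint_param (F F' : R -> R -> C) (t d : R) :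
  (0 < d)%R ->
  (forall u s, (Rabs (u - t) < d)%R -> (0 <= s <= 1)%R -> pcont (F u) s) ->
  (forall s, (0 <= s <= 1)%R -> exists d', (0 < d')%R /\
     forall u v, (Rabs (u - t) < d')%R -> (Rabs (v - s) < d')%R ->
     is_derive (fun z => fst (F z v)) u (fst (F' u v)) /\
     is_derive (fun z => snd (F z v)) u (snd (F' u v))) ->
  (forall u v, (Rabs (u - t) < d)%R -> (0 <= v <= 1)%R ->
     is_derive (fun z => fst (F z v)) u (fst (F' u v)) /\
     is_derive (fun z => snd (F z v)) u (snd (F' u v))) ->
  (forall s, (0 <= s <= 1)%R -> cont2 F' t s) ->
  is_derive (fun u => fst (Cint (F u) 0 1)) t (fst (Cint (F' t) 0 1)) /\
  is_derive (fun u => snd (Cint (F u) 0 1)) t (snd (Cint (F' t) 0 1)).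
Proof.
intros Hd HF HD2 HD HC.
assert (K : forall G G' : R -> R -> R,
  (forall u s, (Rabs (u - t) < d)%R -> (0 <= s <= 1)%R -> continuous (G u) s) ->
  (forall s, (0 <= s <= 1)%R -> exists d', (0 < d')%R /\
     forall u v, (Rabs (u - t) < d')%R -> (Rabs (v - s) < d')%R ->
     is_derive (fun z => G z v) u (G' u v)) ->
  (forall u v, (Rabs (u - t) < d)%R -> (0 <= v <= 1)%R ->
     is_derive (fun z => G z v) u (G' u v)) ->
  (forall s, (0 <= s <= 1)%R -> continuity_2d_pt G' t s) ->
  is_derive (fun u => RInt (G u) 0 1) t (RInt (G' t) 0 1)).
{ intros G G' H1 H2 H3 H4.
  replace (RInt (G' t) 0 1)
    with (RInt (fun s => Derive (fun u => G u s) t) 0 1).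
  2:{ apply RInt_ext; rewrite Rmin_left, Rmax_right by lra; intros s Hs.
      apply is_derive_unique, H3; [rewrite Rminus_diag, Rabs_R0; lra|lra]. }
  apply (is_derive_RInt_param (fun u s => G u s)).
  - exists (mkposreal d Hd); intros u Hu s Hs.
    rewrite Rmin_left, Rmax_right in Hs by lra.
    eexists; apply H3; [exact Hu|exact Hs].
  - rewrite Rmin_left, Rmax_right by lra; intros s Hs.
    apply continuity_2d_pt_ext_loc with G'; [|now apply H4].
    destruct (H2 s Hs) as (d' & Hd' & H'); exists (mkposreal d' Hd').
    intros u v Hu Hv; symmetry; apply is_derive_unique; now apply H'.
  - exists (mkposreal d Hd); intros u Hu.
    apply (ex_RInt_continuous (V := R_CompleteNormedModule)).
    rewrite Rmin_left, Rmax_right by lra; intros s Hs; now apply H1. }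
split; [apply (K (fun u s => fst (F u s)) (fun u s => fst (F' u s)))
       |apply (K (fun u s => snd (F u s)) (fun u s => snd (F' u s)))].
all: try solve [intros; now apply HF | intros; now apply HD | intros; now apply HC].
all: intros s Hs; destruct (HD2 s Hs) as (d' & Hd' & H'); exists d';
  split; [exact Hd'|]; intros; now apply H'.
Qed.

(** With p(s) running through the base [P, Q], the t-derivative of
    h (A + t p(s)) t p'(s) equals the s-derivative of h (A + t p(s)) p(s). So the
    integral over the base dilated by [t] has derivative
    h (A + t Q) Q - h (A + t P) P, and the formula is the integral of this from
    [tau] to 1. The apex itself is never reached: it may be a pole. *)
Lemma cauchy_cone (O : C -> Prop) (h : C -> C) (A P Q : C) (tau t1 : R) :
  Copen O -> holo O h -> (0 < tau <= 1)%R -> (1 < t1)%R ->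
  (forall t s, (0 < t < t1)%R -> (0 <= s <= 1)%R ->
     O (A + RtoC t * (P + RtoC s * (Q - P)))) ->
  seg h (A + P) (A + Q) - seg h (A + RtoC tau * P) (A + RtoC tau * Q)
  = Cint (fun t => h (A + RtoC t * Q) * Q) tau 1
    - Cint (fun t => h (A + RtoC t * P) * P) tau 1.
Proof.
intros HO (h' & Hh) Htau Ht1 Hin.
set (p := fun s : R => P + RtoC s * (Q - P)).
set (F := fun t s : R => h (A + RtoC t * p s) * (RtoC t * (Q - P))).
set (F' := fun t s : R => h' (A + RtoC t * p s) * p s * (RtoC t * (Q - P))
                          + h (A + RtoC t * p s) * (Q - P)).
assert (Hpath : forall t s, cont2 (fun u v => A + RtoC u * p v) t s).
{ intros t s; apply cont2_plus; [apply cont2_const|].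
  apply cont2_mult; [apply cont2_left|].
  apply cont2_plus; [apply cont2_const|].
  apply cont2_mult; [apply cont2_right|apply cont2_const]. }
assert (HDt : forall t v, O (A + RtoC t * p v) ->
  cderiv (fun z => h (A + z * p v) * (z * (Q - P))) (RtoC t) (F' t v)).
{ intros t v HOv; eapply cderiv_eq.
  - apply cderiv_mult.
    + apply (cderiv_comp (fun z => A + z * p v) h);
        [apply cderiv_affine|apply Hh, HOv].
    + apply cderiv_mult; [apply cderiv_id|apply cderiv_const].
  - unfold F'; cbv beta; ring. }
assert (HDs : forall t s, O (A + RtoC t * p s) ->
  cderiv (fun z => h (A + RtoC t * (P + z * (Q - P))) * (P + z * (Q - P)))
    (RtoC s) (F' t s)).
{ intros t s HOs; eapply cderiv_eq.
  - apply cderiv_mult; [|apply cderiv_affine].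
    apply (cderiv_comp (fun z => A + RtoC t * (P + z * (Q - P))) h).
    + apply cderiv_plus; [apply cderiv_const|].
      apply cderiv_mult; [apply cderiv_const|apply cderiv_affine].
    + apply Hh, HOs.
  - unfold F', p; cbv beta; ring. }
assert (HF's : forall t s, O (A + RtoC t * p s) -> pcont (F' t) s).
{ intros t s HOs.
  assert (Hz : ccont (fun z => A + RtoC t * (P + z * (Q - P))) (RtoC s)).
  { ccont_arith. }
  apply (ccont_pcont (fun z => h' (A + RtoC t * (P + z * (Q - P)))
    * (P + z * (Q - P)) * (RtoC t * (Q - P))
    + h (A + RtoC t * (P + z * (Q - P))) * (Q - P))).
  apply ccont_plus; apply ccont_mult; try apply ccont_const.
  - apply ccont_mult; [|ccont_arith].
    apply (ccont_comp _ h'); [exact Hz|apply Hh, HOs].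
  - apply (ccont_comp _ h); [exact Hz|eapply cderiv_ccont, Hh, HOs]. }
set (J := fun t : R => Cint (F t) 0 1).
set (J' := fun t : R => h (A + RtoC t * Q) * Q - h (A + RtoC t * P) * P).
assert (HJ' : forall t, (0 < t < t1)%R -> Cint (F' t) 0 1 = J' t).
{ intros t Ht.
  rewrite (Cint_derive (fun s => h (A + RtoC t * p s) * p s)).
  - unfold J', p.
    replace (P + RtoC 1 * (Q - P)) with Q by ring.
    replace (P + RtoC 0 * (Q - P)) with P by ring; reflexivity.
  - lra.
  - intros s Hs; apply HF's, Hin; auto.
  - intros s Hs; apply (cderiv_real
      (fun z => h (A + RtoC t * (P + z * (Q - P))) * (P + z * (Q - P)))).
    apply HDs, Hin; auto. }
assert (HJ : forall t, (0 < t < t1)%R ->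
  is_derive (fun u => fst (J u)) t (fst (J' t)) /\
  is_derive (fun u => snd (J u)) t (snd (J' t))).
{ intros t Ht; rewrite <- HJ' by exact Ht.
  assert (Hd : (0 < Rmin t (t1 - t))%R) by (apply Rmin_pos; lra).
  assert (Hu : forall u, (Rabs (u - t) < Rmin t (t1 - t))%R -> (0 < u < t1)%R).
  { intros u Hu; pose proof (Rmin_l t (t1 - t)); pose proof (Rmin_r t (t1 - t)).
    apply Rabs_def2 in Hu; lra. }
  apply (is_derive_Cint_param F F' t _ Hd).
  - intros u s Hus Hs.
    apply (ccont_pcont
      (fun z => h (A + RtoC u * (P + z * (Q - P))) * (RtoC u * (Q - P)))).
    apply ccont_mult; [|apply ccont_const].
    apply (ccont_comp (fun z => A + RtoC u * (P + z * (Q - P))) h).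
    + ccont_arith.
    + eapply cderiv_ccont, Hh, Hin; auto.
  - intros s Hs.
    destruct (HO (A + RtoC t * p s)) as (d & Hd0 & Hdd); [now apply Hin|].
    destruct (cont2_near _ t s d (Hpath t s) Hd0) as (d' & Hd' & H').
    exists d'; split; [exact Hd'|]; intros u v Hut Hvs.
    apply (cderiv_real (fun z => h (A + z * p v) * (z * (Q - P)))).
    apply HDt, Hdd, H'; assumption.
  - intros u v Hut Hv.
    apply (cderiv_real (fun z => h (A + z * p v) * (z * (Q - P)))).
    apply HDt, Hin; auto.
  - intros s Hs.
    assert (HOs : O (A + RtoC t * p s)) by now apply Hin.
    assert (Hp : cont2 (fun _ v => p v) t s).
    { apply cont2_plus; [apply cont2_const|].
      apply cont2_mult; [apply cont2_right|apply cont2_const]. }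
    apply cont2_plus; apply cont2_mult; try apply cont2_const.
    + apply cont2_mult; [|exact Hp].
      apply (cont2_comp _ h'); [apply Hpath|apply Hh, HOs].
    + apply cont2_mult; [apply cont2_left|apply cont2_const].
    + apply (cont2_comp _ h); [apply Hpath|eapply cderiv_ccont, Hh, HOs]. }
assert (Hend : forall (Z : C) s, (0 <= s <= 1)%R -> Z = p s ->
  forall t, (tau <= t <= 1)%R -> pcont (fun t => h (A + RtoC t * Z) * Z) t).
{ intros Z s Hs -> t Ht.
  apply (ccont_pcont (fun z => h (A + z * p s) * p s)).
  apply ccont_mult; [|apply ccont_const].
  apply (ccont_comp (fun z => A + z * p s) h).
  - ccont_arith.
  - eapply cderiv_ccont, Hh, Hin; auto; lra. }
assert (HQ := Hend Q 1%R ltac:(lra) ltac:(unfold p; ring)).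
assert (HP := Hend P 0%R ltac:(lra) ltac:(unfold p; ring)).
assert (E : Cint J' tau 1 = J 1%R - J tau).
{ apply Cint_derive; [lra| |intros t Ht; apply HJ; lra].
  intros t Ht; specialize (HQ t Ht); specialize (HP t Ht).
  destruct HQ, HP; split; simpl;
    now apply (continuous_minus (V := R_NormedModule)). }
transitivity (J 1%R - J tau).
- assert (E1 : forall t, seg h (A + RtoC t * P) (A + RtoC t * Q) = J t).
  { intros t; apply Cint_ext; [lra|]; intros s _; unfold F, p.
    replace (A + RtoC t * P + RtoC s * (A + RtoC t * Q - (A + RtoC t * P)))
      with (A + RtoC t * (P + RtoC s * (Q - P))) by ring.
    ring. }
  rewrite <- !E1; f_equal; f_equal; ring.
- rewrite <- E; unfold J'; apply Cint_minus; try lra; assumption.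
Qed.

Lemma Cmod_small_eq (a b : C) (K : R) :
  (forall e, (0 < e)%R -> (Cmod (a - b) <= K * e)%R) -> a = b.
Proof.
intros H; apply Ceq_minus, Cmod_eq_0.
pose proof (Cmod_ge_0 (a - b)) as H0.
destruct (Rle_lt_or_eq_dec _ _ H0) as [Hp|E]; [exfalso|now symmetry].
assert (HK : (0 < Rabs K + 1)%R) by (pose proof (Rabs_pos K); lra).
assert (He : (0 < Cmod (a - b) / (2 * (Rabs K + 1)))%R)
  by (apply Rdiv_lt_0_compat; lra).
specialize (H _ He).
assert (E : (Cmod (a - b) = Cmod (a - b) / (2 * (Rabs K + 1)) * (2 * (Rabs K + 1)))%R)
  by (field; lra).
set (x := (Cmod (a - b) / (2 * (Rabs K + 1)))%R) in *.
pose proof (Rle_abs K); nra.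
Qed.

(** * The logarithm on the right half-plane *)

(** The principal logarithm where the real part is positive
    ([Clog_right_half]); the arctangent is smooth there, whereas the arccosine in
    [Carg] is not differentiable on the positive real axis. *)
Definition log_right (w : C) : C :=
  ((ln (fst w ^ 2 + snd w ^ 2) / 2)%R, atan (snd w / fst w)).

(** The four sides of a quadrilateral around 0 are brought to the right half-plane
    by the rotations i, 1, -i, -1. At each vertex two determinations meet, and
    they differ by i pi / 2; the four vertices together give 2 pi i. *)
Lemma log_right_quarter_turn (w : C) :
  (0 < fst w)%R -> (snd w < 0)%R -> log_right (Ci * w) - log_right w = (0%R, (PI / 2)%R).
Proof.
destruct w as [x y]; simpl; intros Hx Hy.
unfold log_right, Cminus, Cplus, Copp, Cmult, Ci; cbn [fst snd]; f_equal.
- replace ((0 * x - 1 * y) ^ 2 + (0 * y + 1 * x) ^ 2)%R with (x ^ 2 + y ^ 2)%R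
    by ring; ring.
- replace ((0 * y + 1 * x) / (0 * x - 1 * y))%R with (/ (- y / x))%R
    by (field; lra).
  rewrite atan_inv by (apply Rdiv_lt_0_compat; lra).
  replace (y / x)%R with (- (- y / x))%R by (field; lra).
  rewrite atan_opp; ring.
Qed.

Lemma Cinv_fst_snd (w : C) :
  / w = ((fst w / (fst w ^ 2 + snd w ^ 2))%R,
         (- snd w / (fst w ^ 2 + snd w ^ 2))%R).
Proof. reflexivity. Qed.

(** Rotating the segment into the right half-plane by the factor [c] keeps it off
    the cut of the logarithm, whatever its position around 0. *)
Lemma Cint_inv_segment (c P Q : C) :
  (0 < fst (c * P)%C)%R -> (0 < fst (c * Q)%C)%R ->
  Cint (fun s => (Q - P) * / (P + RtoC s * (Q - P))) 0 1
  = log_right (c * Q) - log_right (c * P).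
Proof.
intros HP HQ.
assert (Hc : c <> 0).
{ intros ->; rewrite Cmult_0_l in HP; simpl in HP; lra. }
set (P' := c * P) in *; set (Q' := c * Q) in *.
assert (Hre : forall s, (0 <= s <= 1)%R ->
  (0 < fst P' + s * (fst Q' - fst P'))%R) by (intros; nra).
assert (Hc' : forall s, c * (P + RtoC s * (Q - P)) = P' + RtoC s * (Q' - P')).
{ intros s; unfold P', Q'; ring. }
assert (Hnz : forall s, (0 <= s <= 1)%R -> P + RtoC s * (Q - P) <> 0).
{ intros s Hs E; specialize (Hc' s); rewrite E in Hc'.
  apply (f_equal fst) in Hc'; specialize (Hre s Hs); simpl in Hc', Hre; lra. }
assert (Hnz' : forall s, (0 <= s <= 1)%R -> P' + RtoC s * (Q' - P') <> 0).
{ intros s Hs; rewrite <- Hc'; apply Cmult_neq_0; auto. }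
rewrite (Cint_ext _ (fun s => (Q' - P') * / (P' + RtoC s * (Q' - P')))); [|lra|].
2:{ intros s Hs; rewrite <- Hc'; unfold P', Q'; field; auto. }
assert (E0 : P' + RtoC 0 * (Q' - P') = P') by ring.
assert (E1 : P' + RtoC 1 * (Q' - P') = Q') by ring.
rewrite (Cint_derive (fun s => log_right (P' + RtoC s * (Q' - P')))); [now rewrite E0, E1|lra| |].
- intros s Hs; apply (ccont_pcont (fun z => (Q' - P') * / (P' + z * (Q' - P')))).
  apply ccont_mult; [apply ccont_const|].
  apply ccont_inv; [ccont_arith|auto].
- intros s Hs; specialize (Hre s Hs); clear - Hre.
  rewrite Cinv_fst_snd.
  destruct P' as [x y], Q' as [x' y']; simpl in Hre.
  unfold log_right, Cminus, Cplus, Copp, Cmult, RtoC; cbn [fst snd].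
  assert (0 < x + (s * (x' + - x) - 0 * (y' + - y)))%R by lra.
  unfold Rminus in *.
  split; auto_derive;
    set (a := (x' + - x)%R) in *; set (b := (y' + - y)%R) in *;
    set (X := (x + (s * a + - (0 * b)))%R) in *;
    set (Y := (y + (s * b + 0 * a))%R) in *; clearbody a b X Y;
    try nra; field; repeat split; nra.
Qed.

(** Dilating the segment towards the simple pole [A], only the polar part
    rho / v survives, and the integral of dv / v is invariant under dilation. *)
Lemma side_limit (O : C -> Prop) (h : C -> C) (A rho c P Q : C) (t1 : R) :
  (forall w, O w -> ccont h w) -> (1 < t1)%R ->
  (forall t s, (0 < t < t1)%R -> (0 <= s <= 1)%R ->
     O (A + RtoC t * (P + RtoC s * (Q - P)))) ->
  (forall e, (0 < e)%R -> exists d, (0 < d)%R /\ forall v : C, v <> 0 ->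
     (Cmod v < d)%R -> (Cmod (v * h (A + v)%C - rho) <= e)%R) ->
  (0 < fst (c * P)%C)%R -> (0 < fst (c * Q)%C)%R ->
  forall e, (0 < e)%R -> exists d, (0 < d)%R /\ forall tau, (0 < tau < d)%R ->
  (Cmod (seg h (A + RtoC tau * P) (A + RtoC tau * Q)
         - rho * (log_right (c * Q) - log_right (c * P))) <= e)%R.
Proof.
intros Hh Ht1 Hin Hlim HP HQ e He.
assert (Hc : c <> 0).
{ intros ->; rewrite Cmult_0_l in HP; simpl in HP; lra. }
apply Cmod_gt_0 in Hc.
set (p := fun s : R => P + RtoC s * (Q - P)).
set (m := (Rmin (fst (c * P)%C) (fst (c * Q)%C) / Cmod c)%R).
assert (Hm : (0 < m)%R) by (apply Rdiv_lt_0_compat; [now apply Rmin_pos|lra]).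
assert (Hpm : forall s, (0 <= s <= 1)%R -> (m <= Cmod (p s))%R).
{ intros s Hs; apply Rle_div_l; [lra|].
  rewrite Rmult_comm, <- Cmod_mult.
  eapply Rle_trans; [|apply abs_fst_le]; eapply Rle_trans; [|apply Rle_abs].
  replace (c * p s) with (c * P + RtoC s * (c * Q - c * P)) by (unfold p; ring).
  replace (fst (c * P + RtoC s * (c * Q - c * P)))
    with (fst (c * P)%C + s * (fst (c * Q)%C - fst (c * P)%C))%R
    by (simpl; ring).
  pose proof (Rmin_l (fst (c * P)%C) (fst (c * Q)%C)).
  pose proof (Rmin_r (fst (c * P)%C) (fst (c * Q)%C)).
  set (r := Rmin _ _) in *; nra. }
assert (Hp0 : forall s, (0 <= s <= 1)%R -> p s <> 0).
{ intros s Hs; apply Cmod_neq_0; specialize (Hpm s Hs); lra. }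
set (B := (Cmod P + Cmod (Q - P) + 1)%R).
assert (HB : (1 <= B)%R).
{ unfold B; pose proof (Cmod_ge_0 P); pose proof (Cmod_ge_0 (Q - P)); lra. }
assert (HpB : forall s, (0 <= s <= 1)%R -> (Cmod (p s) <= B)%R).
{ intros s Hs; unfold p, B; eapply Rle_trans; [apply Cmod_triangle|].
  rewrite Cmod_mult, Cmod_R, Rabs_pos_eq by lra.
  pose proof (Cmod_ge_0 (Q - P)); nra. }
destruct (Hlim (e * m / (2 * B))%R) as (d & Hd & H).
{ apply Rdiv_lt_0_compat; [nra|lra]. }
exists (Rmin (d / B) 1); split.
{ apply Rmin_pos; [apply Rdiv_lt_0_compat; lra|lra]. }
intros tau Htau.
assert (HtB : (tau * B < d)%R).
{ apply Rlt_div_r; [lra|]; apply Rlt_le_trans with (1 := proj2 Htau), Rmin_l. }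
assert (Ht1' : (tau < 1)%R).
{ apply Rlt_le_trans with (1 := proj2 Htau), Rmin_r. }
assert (Hci : forall s, (0 <= s <= 1)%R ->
  pcont (fun s => (Q - P) * / p s) s).
{ intros s Hs; apply (ccont_pcont (fun z => (Q - P) * / (P + z * (Q - P)))).
  apply ccont_mult; [apply ccont_const|].
  apply ccont_inv; [ccont_arith|now apply Hp0]. }
set (g := fun s : R => (RtoC tau * p s * h (A + RtoC tau * p s) - rho)
                       * ((Q - P) * / p s)).
assert (Hg : forall s, (0 <= s <= 1)%R -> pcont g s).
{ intros s Hs.
  apply (ccont_pcont (fun z => (RtoC tau * (P + z * (Q - P))
    * h (A + RtoC tau * (P + z * (Q - P))) + - rho)
    * ((Q - P) * / (P + z * (Q - P))))).
  assert (Ha : ccont (fun z => P + z * (Q - P)) (RtoC s))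
    by (ccont_arith).
  apply ccont_mult.
  - apply ccont_plus; [|apply ccont_const]; apply ccont_mult.
    + apply ccont_mult; [apply ccont_const|exact Ha].
    + apply (ccont_comp (fun z => A + RtoC tau * (P + z * (Q - P))) h).
      * apply ccont_plus; [apply ccont_const|]; apply ccont_mult;
          [apply ccont_const|exact Ha].
      * apply Hh, Hin; lra.
  - apply ccont_mult; [apply ccont_const|].
    apply ccont_inv; [exact Ha|now apply Hp0]. }
assert (Hg' : forall s, (0 <= s <= 1)%R -> pcont (fun s => rho * ((Q - P) * / p s)) s).
{ intros s Hs; apply (ccont_pcont (fun z => rho * ((Q - P) * / (P + z * (Q - P))))).
  apply ccont_mult; [apply ccont_const|]; apply ccont_mult; [apply ccont_const|].
  apply ccont_inv; [ccont_arith|now apply Hp0]. }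
replace (seg h (A + RtoC tau * P) (A + RtoC tau * Q)
         - rho * (log_right (c * Q) - log_right (c * P))) with (Cint g 0 1).
- eapply Rle_trans; [apply (Cint_bound g 0 1 (e * m / (2 * B) * (B / m))%R)|].
  + lra.
  + exact Hg.
  + intros s Hs; unfold g; rewrite Cmod_mult.
    apply Rmult_le_compat; try apply Cmod_ge_0.
    * apply H.
      -- apply Cmult_neq_0; [|now apply Hp0].
         intros E; apply RtoC_inj in E; lra.
      -- rewrite Cmod_mult, Cmod_R, Rabs_pos_eq by lra.
         specialize (HpB s Hs); nra.
    * rewrite Cmod_mult, Cmod_inv by now apply Hp0.
      apply Rmult_le_compat; try apply Cmod_ge_0.
      -- apply Rlt_le, Rinv_0_lt_compat; specialize (Hpm s Hs); lra.
      -- unfold B; pose proof (Cmod_ge_0 P); lra.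
      -- apply Rinv_le_contravar; auto.
  + apply Req_le; field; lra.
- rewrite <- Cint_inv_segment by assumption.
  rewrite <- Cint_scal by (try lra; exact Hci).
  assert (E : seg h (A + RtoC tau * P) (A + RtoC tau * Q)
    = Cint (fun s => g s + rho * ((Q - P) * / p s)) 0 1).
  { apply Cint_ext; [lra|]; intros s Hs; unfold g.
    replace (A + RtoC tau * P + RtoC s * (A + RtoC tau * Q - (A + RtoC tau * P)))
      with (A + RtoC tau * p s) by (unfold p; ring).
    field; now apply Hp0. }
  rewrite E, Cint_plus by (try lra; assumption).
  unfold p; ring.
Qed.

(** The sides are L'L, LU, U'U and L'U', each with its own orientation; the signs
    in the conclusion make up the positively oriented boundary. In the sum of the
    four cones with apex [A] the radial integrals cancel, so the boundary integral
    does not change when the quadrilateral shrinks to [A], where [side_limit]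
    evaluates it. *)
Lemma quadrilateral_residue (O : C -> Prop) (h : C -> C)
    (A rho L' L U U' : C) (t1 : R) :
  Copen O -> holo O h -> (1 < t1)%R ->
  (forall e, (0 < e)%R -> exists d, (0 < d)%R /\ forall v : C, v <> 0 ->
     (Cmod v < d)%R -> (Cmod (v * h (A + v)%C - rho) <= e)%R) ->
  (fst L' < 0)%R -> (snd L' < 0)%R -> (0 < fst L)%R -> (snd L < 0)%R ->
  (0 < fst U)%R -> (0 < snd U)%R -> (fst U' < 0)%R -> (0 < snd U')%R ->
  (forall P Q, In (P, Q) [(L', L); (L, U); (U', U); (L', U')] ->
   forall t s, (0 < t < t1)%R -> (0 <= s <= 1)%R ->
     O (A + RtoC t * (P + RtoC s * (Q - P)))) ->
  seg h (A + L') (A + L) + seg h (A + L) (A + U)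
  - seg h (A + U') (A + U) - seg h (A + L') (A + U') = twopii * rho.
Proof.
intros HO Hh Ht1 Hlim L'1 L'2 L1 L2 U1 U2 U'1 U'2 Hin.
assert (Hc : forall w, O w -> ccont h w).
{ destruct Hh as (h' & Hh'); intros w Hw; eapply cderiv_ccont, Hh', Hw. }
assert (Hq : log_right (Ci * L) - log_right (Ci * L') + (log_right (1 * U) - log_right (1 * L))
  - (log_right (- Ci * U) - log_right (- Ci * U')) - (log_right (- (1) * U') - log_right (- (1) * L'))
  = twopii).
{ pose proof (log_right_quarter_turn L L1 L2) as E1.
  pose proof (log_right_quarter_turn (- Ci * U)) as E2.
  pose proof (log_right_quarter_turn (- (1) * U')) as E3.
  pose proof (log_right_quarter_turn (Ci * L')) as E4.
  assert (Ci2 : Ci * Ci = - (1)) by (unfold Ci, Cmult, Copp; simpl; f_equal; ring).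
  replace (Ci * (- Ci * U)) with (1 * U) in E2
    by (transitivity (- (Ci * Ci) * U); [rewrite Ci2|]; ring).
  replace (Ci * (- (1) * U')) with (- Ci * U') in E3 by ring.
  replace (Ci * (Ci * L')) with (- (1) * L') in E4 by (rewrite <- Ci2; ring).
  simpl in E2, E3, E4.
  specialize (E2 ltac:(lra) ltac:(lra)); specialize (E3 ltac:(lra) ltac:(lra)).
  specialize (E4 ltac:(lra) ltac:(lra)).
  replace (1 * L) with L by ring.
  transitivity ((log_right (Ci * L) - log_right L) + (log_right (1 * U) - log_right (- Ci * U))
    + (log_right (- Ci * U') - log_right (- (1) * U')) + (log_right (- (1) * L') - log_right (Ci * L')));
    [ring|].
  rewrite E1, E2, E3, E4.
  unfold twopii, Ci, Cmult, Cplus, RtoC; simpl; f_equal; field. }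
set (rad := fun tau Z => Cint (fun t => h (A + RtoC t * Z) * Z) tau 1).
set (err := fun tau c P Q => seg h (A + P) (A + Q) - (rad tau Q - rad tau P)
  - rho * (log_right (c * Q) - log_right (c * P))).
assert (side : forall c P Q, In (P, Q) [(L', L); (L, U); (U', U); (L', U')] ->
  (0 < fst (c * P)%C)%R -> (0 < fst (c * Q)%C)%R ->
  forall e, (0 < e)%R -> exists d, (0 < d)%R /\ forall tau,
  (0 < tau < d)%R -> (tau <= 1)%R -> (Cmod (err tau c P Q) <= e)%R).
{ intros c P Q HPQ HP HQ e He.
  destruct (side_limit O h A rho c P Q t1 Hc Ht1 (Hin P Q HPQ) Hlim HP HQ e He)
    as (d & Hd & K).
  exists d; split; [exact Hd|]; intros tau Htau Htau1; specialize (K tau Htau).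
  unfold err, rad; rewrite <- (cauchy_cone O h A P Q tau t1) by (auto; lra).
  match goal with |- (Cmod (?x - (?x - ?y) - ?z) <= _)%R =>
    replace (x - (x - y) - z) with (y - z) by ring end.
  exact K. }
apply (Cmod_small_eq _ _ 4); intros e He.
destruct (side Ci L' L ltac:(simpl; auto) ltac:(simpl; lra) ltac:(simpl; lra) e He)
  as (d1 & Hd1 & S1).
destruct (side 1 L U ltac:(simpl; auto) ltac:(simpl; lra) ltac:(simpl; lra) e He)
  as (d2 & Hd2 & S2).
destruct (side (- Ci) U' U ltac:(simpl; auto) ltac:(simpl; lra) ltac:(simpl; lra) e He)
  as (d3 & Hd3 & S3).
destruct (side (- (1)) L' U' ltac:(simpl; auto) ltac:(simpl; lra) ltac:(simpl; lra) e He)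
  as (d4 & Hd4 & S4).
assert (Htau : exists tau, (0 < tau <= 1 /\ tau < d1 /\ tau < d2 /\ tau < d3 /\ tau < d4)%R).
{ set (d := Rmin (Rmin d1 d2) (Rmin (Rmin d3 d4) 1)).
  assert (Hd : (0 < d)%R) by (unfold d; repeat apply Rmin_pos; lra).
  assert (d <= Rmin d1 d2 /\ d <= Rmin (Rmin d3 d4) 1)%R
    by (split; [apply Rmin_l|apply Rmin_r]).
  pose proof (Rmin_l d1 d2); pose proof (Rmin_r d1 d2).
  pose proof (Rmin_l (Rmin d3 d4) 1); pose proof (Rmin_r (Rmin d3 d4) 1).
  pose proof (Rmin_l d3 d4); pose proof (Rmin_r d3 d4).
  exists (d / 2)%R; lra. }
destruct Htau as (tau & H0 & T1 & T2 & T3 & T4).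
specialize (S1 tau ltac:(lra) ltac:(lra)); specialize (S2 tau ltac:(lra) ltac:(lra)).
specialize (S3 tau ltac:(lra) ltac:(lra)); specialize (S4 tau ltac:(lra) ltac:(lra)).
rewrite <- Hq.
match goal with |- (Cmod ?a <= _)%R =>
  replace a with ((err tau Ci L' L + err tau 1 L U)
    + (- err tau (- Ci) U' U + - err tau (- (1)) L' U')) by (unfold err; ring) end.
eapply Rle_trans; [apply Cmod_triangle|].
pose proof (Cmod_triangle (err tau Ci L' L) (err tau 1 L U)).
pose proof (Cmod_triangle (- err tau (- Ci) U' U) (- err tau (- (1)) L' U')).
rewrite !Cmod_opp in *; lra.
Qed.

(** * Rays from the origin *)

Definition rayint (h : C -> C) (L : C) (X : R) : C :=
  Cint (fun x => h (RtoC x * L) * L) 0 X.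

Lemma seg_collinear (h : C -> C) (L : C) (x y : R) :
  (x < y)%R -> (forall t, (x <= t <= y)%R -> ccont h (RtoC t * L)) ->
  seg h (RtoC x * L) (RtoC y * L) = Cint (fun t => h (RtoC t * L) * L) x y.
Proof.
intros Hxy H.
pose proof (Cint_comp_lin (fun t => h (RtoC t * L) * L) (y - x) x 0 1) as E.
replace ((y - x) * 0 + x)%R with x in E by ring.
replace ((y - x) * 1 + x)%R with y in E by ring.
rewrite <- E; [|lra|lra|].
- apply Cint_ext; [lra|]; intros s _.
  rewrite RtoC_plus, RtoC_mult, RtoC_minus.
  replace (RtoC x * L + RtoC s * (RtoC y * L - RtoC x * L))
    with (((RtoC y - RtoC x) * RtoC s + RtoC x) * L) by ring.
  ring.
- intros t Ht; apply (ccont_pcont (fun z => h (z * L) * L)).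
  apply ccont_mult; [|apply ccont_const].
  apply (ccont_comp (fun z => z * L) h); [|now apply H].
  ccont_arith.
Qed.

Lemma ray_pcont (h : C -> C) (L : C) (t : R) :
  ccont h (RtoC t * L) -> pcont (fun x => h (RtoC x * L) * L) t.
Proof.
intros H; apply (ccont_pcont (fun z => h (z * L) * L)).
apply ccont_mult; [|apply ccont_const].
apply (ccont_comp (fun z => z * L) h); [|exact H].
ccont_arith.
Qed.

Lemma rayint_step (h : C -> C) (L : C) (x y : R) :
  (0 <= x)%R -> (x < y)%R -> (forall t, (0 <= t)%R -> ccont h (RtoC t * L)) ->
  rayint h L y - rayint h L x = seg h (RtoC x * L) (RtoC y * L).
Proof.
intros Hx Hxy H; rewrite seg_collinear by (auto; intros; apply H; lra).
unfold rayint; rewrite <- (Cint_Chasles _ 0 x y); [ring|lra|lra|].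
intros t Ht; apply ray_pcont, H; lra.
Qed.

(** At the apex 0 the function is only assumed continuous, hence bounded: the part
    of the triangle below height [x] contributes at most a multiple of [x]. *)
Lemma triangle_at_origin (O : C -> Prop) (h : C -> C) (P Q : C) (t1 X : R) :
  Copen O -> holo O h -> ccont h 0 -> (1 < t1)%R -> (0 < X)%R ->
  (forall t s, (0 < t < t1 * X)%R -> (0 <= s <= 1)%R ->
     O (RtoC t * (P + RtoC s * (Q - P)))) ->
  rayint h P X + seg h (RtoC X * P) (RtoC X * Q) - rayint h Q X = 0.
Proof.
intros HO Hh H0 Ht1 HX Hin.
assert (Hc : forall w, O w -> ccont h w).
{ destruct Hh as (h' & Hh'); intros w Hw; eapply cderiv_ccont, Hh', Hw. }
assert (HcPQ : forall s Z, (0 <= s <= 1)%R -> P + RtoC s * (Q - P) = Z ->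
  forall t, (0 <= t <= X)%R -> ccont h (RtoC t * Z)).
{ intros s Z Hs <- t Ht; destruct (Req_dec t 0) as [->|Hn].
  - now rewrite Cmult_0_l.
  - apply Hc, Hin; nra. }
assert (HcP := HcPQ 0%R P ltac:(lra) ltac:(ring)).
assert (HcQ := HcPQ 1%R Q ltac:(lra) ltac:(ring)).
destruct (H0 1%R Rlt_0_1) as (d & Hd & Hb).
set (M := (Cmod (h 0) + 1)%R).
assert (HM : forall v, (Cmod v < d)%R -> (Cmod (h v) <= M)%R).
{ intros v Hv; replace v with (v - 0) in Hv by ring; specialize (Hb v Hv).
  pose proof (Cmod_triangle (h v - h 0) (h 0)) as T.
  replace (h v - h 0 + h 0) with (h v) in T by ring; unfold M; lra. }
set (B := (Cmod P + Cmod (Q - P) + Cmod Q + 1)%R).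
assert (HB : (1 <= B)%R).
{ unfold B; pose proof (Cmod_ge_0 P); pose proof (Cmod_ge_0 (Q - P));
  pose proof (Cmod_ge_0 Q); lra. }
assert (HpB : forall s, (0 <= s <= 1)%R -> (Cmod (P + RtoC s * (Q - P)) <= B)%R).
{ intros s Hs; unfold B; eapply Rle_trans; [apply Cmod_triangle|].
  rewrite Cmod_mult, Cmod_R, Rabs_pos_eq by lra.
  pose proof (Cmod_ge_0 (Q - P)); pose proof (Cmod_ge_0 Q); nra. }
apply (Cmod_small_eq _ _ (6 * (M * B))); intros e He.
set (x := Rmin (Rmin e X) (d / (2 * B))).
assert (Hx : (0 < x)%R).
{ unfold x; repeat apply Rmin_pos; try lra; apply Rdiv_lt_0_compat; lra. }
assert (Hxe : (x <= e /\ x <= X /\ x * B < d)%R).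
{ assert (x <= Rmin e X)%R by apply Rmin_l.
  assert (x <= d / (2 * B))%R by apply Rmin_r.
  pose proof (Rmin_l e X); pose proof (Rmin_r e X).
  repeat split; try lra.
  assert (x * (2 * B) <= d)%R by (apply Rle_div_r; lra); nra. }
assert (HxX : (0 < x / X <= 1)%R).
{ split; [apply Rdiv_lt_0_compat; lra|apply Rle_div_l; lra]. }
assert (K' := cauchy_cone O h 0 (RtoC X * P) (RtoC X * Q) (x / X) t1 HO Hh HxX Ht1).
match type of K' with ?H -> _ => assert (Hin' : H) end.
{ intros t s Ht Hs.
  replace (0 + RtoC t * (RtoC X * P + RtoC s * (RtoC X * Q - RtoC X * P)))
    with (RtoC (t * X) * (P + RtoC s * (Q - P))) by (rewrite RtoC_mult; ring).
  apply Hin; [split; nra|exact Hs]. }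
specialize (K' Hin').
assert (ER : forall Z : C, (forall t, (0 <= t <= X)%R -> ccont h (RtoC t * Z)) ->
  Cint (fun t => h (0 + RtoC t * (RtoC X * Z)) * (RtoC X * Z)) (x / X) 1
  = rayint h Z X - rayint h Z x).
{ intros Z HZ.
  pose proof (Cint_comp_lin (fun t => h (RtoC t * Z) * Z) X 0 (x / X) 1) as E.
  replace (X * (x / X) + 0)%R with x in E by (field; lra).
  replace (X * 1 + 0)%R with X in E by ring.
  transitivity (Cint (fun t => h (RtoC t * Z) * Z) x X).
  - rewrite <- E; [|lra|lra|].
    + apply Cint_ext; [lra|]; intros t _.
      rewrite Rplus_0_r, RtoC_mult.
      replace (0 + RtoC t * (RtoC X * Z)) with (RtoC X * RtoC t * Z) by ring.
      ring.
    + intros t Ht; apply ray_pcont, HZ; lra.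
  - unfold rayint; rewrite <- (Cint_Chasles _ 0 x X); [ring|lra|lra|].
    intros t Ht; apply ray_pcont, HZ; lra. }
rewrite (ER P HcP), (ER Q HcQ) in K'.
replace (0 + RtoC X * P) with (RtoC X * P) in K' by ring.
replace (0 + RtoC X * Q) with (RtoC X * Q) in K' by ring.
assert (Ex : forall Z, 0 + RtoC (x / X) * (RtoC X * Z) = RtoC x * Z).
{ intros Z; rewrite RtoC_div by lra; field; intros E; apply RtoC_inj in E; lra. }
rewrite !Ex in K'.
replace (rayint h P X + seg h (RtoC X * P) (RtoC X * Q) - rayint h Q X - 0)
  with (rayint h P x + seg h (RtoC x * P) (RtoC x * Q) + - rayint h Q x).
2:{ replace (seg h (RtoC X * P) (RtoC X * Q)) with
     (seg h (RtoC X * P) (RtoC X * Q) - seg h (RtoC x * P) (RtoC x * Q)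
      + seg h (RtoC x * P) (RtoC x * Q)) by ring.
    rewrite K'; ring. }
assert (HM0 : (0 <= M)%R) by (unfold M; pose proof (Cmod_ge_0 (h 0)); lra).
assert (B1 : forall Z, (Cmod Z <= B)%R ->
  (forall t, (0 <= t <= X)%R -> ccont h (RtoC t * Z)) ->
  (Cmod (rayint h Z x) <= 2 * (M * B * (x - 0)))%R).
{ intros Z HZ HcZ; apply Cint_bound; [lra| |].
  - intros t Ht; apply ray_pcont, HcZ; lra.
  - intros t Ht; rewrite Cmod_mult; apply Rmult_le_compat;
      try apply Cmod_ge_0; [|exact HZ].
    apply HM; rewrite Cmod_mult, Cmod_R, Rabs_pos_eq by lra.
    pose proof (Cmod_ge_0 Z); nra. }
assert (B2 : (Cmod (seg h (RtoC x * P) (RtoC x * Q)) <= 2 * (M * (x * B) * (1 - 0)))%R).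
{ apply Cint_bound; [lra| |].
  - intros s Hs.
    apply (ccont_pcont (fun z => h (RtoC x * P + z * (RtoC x * Q - RtoC x * P))
      * (RtoC x * Q - RtoC x * P))).
    apply ccont_mult; [|apply ccont_const].
    apply (ccont_comp (fun z => RtoC x * P + z * (RtoC x * Q - RtoC x * P)) h).
    + ccont_arith.
    + replace (RtoC x * P + RtoC s * (RtoC x * Q - RtoC x * P))
        with (RtoC x * (P + RtoC s * (Q - P))) by ring.
      apply Hc, Hin; nra.
  - intros s Hs; rewrite Cmod_mult; apply Rmult_le_compat; try apply Cmod_ge_0.
    + apply HM.
      replace (RtoC x * P + RtoC s * (RtoC x * Q - RtoC x * P))
        with (RtoC x * (P + RtoC s * (Q - P))) by ring.
      rewrite Cmod_mult, Cmod_R, Rabs_pos_eq by lra; specialize (HpB s Hs); nra.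
    + replace (RtoC x * Q - RtoC x * P) with (RtoC x * (Q - P)) by ring.
      rewrite Cmod_mult, Cmod_R, Rabs_pos_eq by lra.
      apply Rmult_le_compat_l; [lra|]; unfold B.
      pose proof (Cmod_ge_0 P); pose proof (Cmod_ge_0 Q); lra. }
pose proof (B1 P ltac:(unfold B; pose proof (Cmod_ge_0 (Q - P));
  pose proof (Cmod_ge_0 Q); lra) HcP) as BP.
pose proof (B1 Q ltac:(unfold B; pose proof (Cmod_ge_0 (Q - P));
  pose proof (Cmod_ge_0 P); lra) HcQ) as BQ.
pose proof (Cmod_triangle (rayint h P x + seg h (RtoC x * P) (RtoC x * Q))
  (- rayint h Q x)) as T1.
pose proof (Cmod_triangle (rayint h P x) (seg h (RtoC x * P) (RtoC x * Q))) as T2.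
rewrite Cmod_opp in T1.
assert (M * B * x <= M * B * e)%R by (apply Rmult_le_compat_l; nra).
nra.
Qed.

(** * The exponential function *)

Lemma exp_le_mono (x y : R) : (x <= y)%R -> (exp x <= exp y)%R.
Proof.
intros [H| ->]; [now apply Rlt_le, exp_increasing|apply Rle_refl].
Qed.

Lemma Cexp_plus (a b : C) : Cexp (a + b) = Cexp a * Cexp b.
Proof.
unfold Cexp, Cmult, Cplus; cbn [fst snd].
rewrite exp_plus, cos_plus, sin_plus; f_equal; ring.
Qed.

Lemma Cexp_0 : Cexp 0 = 1.
Proof. unfold Cexp, RtoC; simpl; rewrite exp_0, cos_0, sin_0; f_equal; ring. Qed.

Lemma Cmod_Cexp (w : C) : Cmod (Cexp w) = exp (fst w).
Proof.
unfold Cmod, Cexp; cbn [fst snd].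
replace ((exp (fst w) * cos (snd w)) ^ 2 + (exp (fst w) * sin (snd w)) ^ 2)%R
  with (exp (fst w) ^ 2 * (Rsqr (sin (snd w)) + Rsqr (cos (snd w))))%R
  by (unfold Rsqr; ring).
rewrite sin2_cos2, Rmult_1_r, <- Rsqr_pow2, sqrt_Rsqr; [reflexivity|].
apply Rlt_le, exp_pos.
Qed.

Lemma Cexp_neq_0 (w : C) : Cexp w <> 0.
Proof. apply Cmod_neq_0; rewrite Cmod_Cexp; apply exp_pos. Qed.

Lemma Cexp_opp (w : C) : Cexp (- w) = / Cexp w.
Proof.
assert (H : Cexp (- w) * Cexp w = 1).
{ rewrite <- Cexp_plus, <- Cexp_0; f_equal; ring. }
rewrite <- (Cmult_1_l (/ Cexp w)), <- H; field; apply Cexp_neq_0.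
Qed.

Lemma Cexp_nat (w : C) (n : nat) : Cexp (RtoC (INR n) * w) = Cpow (Cexp w) n.
Proof.
induction n as [|n IH].
- simpl; rewrite <- Cexp_0; f_equal; ring.
- rewrite S_INR, RtoC_plus, Cpow_S, <- IH, <- Cexp_plus; f_equal; ring.
Qed.

Lemma derive_eps_0 (f : R -> R) (l : R) :
  is_derive f 0%R l -> forall e, (0 < e)%R -> exists d, (0 < d)%R /\
  forall x, (Rabs x < d)%R -> (Rabs (f x - f 0%R - l * x) <= e * Rabs x)%R.
Proof.
intros H e He; apply is_derive_Reals in H; destruct (H e He) as (d & Hd).
exists d; split; [apply cond_pos|]; intros x Hx.
destruct (Req_dec x 0) as [->|Hn].
- replace (f 0 - f 0 - l * 0)%R with 0%R by ring; rewrite Rabs_R0; lra.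
- specialize (Hd x Hn Hx); rewrite Rplus_0_l in Hd.
  replace (f x - f 0 - l * x)%R with (((f x - f 0) / x - l) * x)%R by (now field).
  rewrite Rabs_mult; apply Rmult_le_compat_r; [apply Rabs_pos|lra].
Qed.

Lemma cderiv_Cexp_0 : cderiv Cexp 0 1.
Proof.
apply cderiv_eps; intros e He.
assert (He' : (0 < Rmin (e / 10) 1)%R) by (apply Rmin_pos; lra).
assert (Hee : (Rmin (e / 10) 1 <= e / 10)%R) by apply Rmin_l.
assert (He1 : (Rmin (e / 10) 1 <= 1)%R) by apply Rmin_r.
set (e' := Rmin (e / 10) 1) in *.
destruct (derive_eps_0 exp 1%R) with (e := e') as (d1 & Hd1 & H1);
  [auto_derive; [exact I|rewrite exp_0; ring]|exact He'|].
destruct (derive_eps_0 cos 0%R) with (e := e') as (d2 & Hd2 & H2);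
  [auto_derive; [exact I|rewrite sin_0; ring]|exact He'|].
destruct (derive_eps_0 sin 1%R) with (e := e') as (d3 & Hd3 & H3);
  [auto_derive; [exact I|rewrite cos_0; ring]|exact He'|].
set (d := Rmin (Rmin d1 d2) (Rmin d3 e')).
assert (Hdd : (d <= d1 /\ d <= d2 /\ d <= d3 /\ d <= e')%R).
{ pose proof (Rmin_l (Rmin d1 d2) (Rmin d3 e')).
  pose proof (Rmin_r (Rmin d1 d2) (Rmin d3 e')).
  pose proof (Rmin_l d1 d2). pose proof (Rmin_r d1 d2).
  pose proof (Rmin_l d3 e'). pose proof (Rmin_r d3 e'). unfold d; lra. }
exists d; split; [unfold d; repeat apply Rmin_pos; lra|].
intros v; replace (v - 0) with v by ring; rewrite Cexp_0.
intros Hv; pose proof (abs_fst_le v) as Hx; pose proof (abs_snd_le v) as Hy.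
destruct v as [x y]; cbn [fst snd] in Hx, Hy.
eapply Rle_trans; [apply Cmod_le_abs|].
specialize (H1 x ltac:(lra)); specialize (H2 y ltac:(lra));
  specialize (H3 y ltac:(lra)).
rewrite exp_0 in H1; rewrite cos_0 in H2; rewrite sin_0 in H3.
set (m := Cmod (x, y)) in *.
unfold Cexp, Cminus, Cplus, Copp, Cmult, RtoC; cbn [fst snd].
replace (exp x * cos y + - (1) + - (1 * x - 0 * y))%R
  with ((exp x - 1 - 1 * x) + exp x * (cos y - 1 - 0 * y))%R by ring.
replace (exp x * sin y + - 0 + - (1 * y + 0 * x))%R
  with (exp x * (sin y - 0 - 1 * y) + (exp x - 1) * y)%R by ring.
assert (Ex : (Rabs (exp x - 1) <= 2 * Rabs x)%R).
{ replace (exp x - 1)%R with ((exp x - 1 - 1 * x) + x)%R by ring.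
  eapply Rle_trans; [apply Rabs_triang|]; pose proof (Rabs_pos x); nra. }
assert (E3 : (Rabs (exp x) <= 3)%R).
{ replace (exp x) with ((exp x - 1) + 1)%R by ring.
  eapply Rle_trans; [apply Rabs_triang|]; rewrite Rabs_R1; lra. }
pose proof (Rabs_pos x); pose proof (Rabs_pos y); pose proof (Rabs_pos (exp x)).
assert (A1 : (Rabs (exp x - 1 - 1 * x + exp x * (cos y - 1 - 0 * y))
  <= e' * m + 3 * (e' * m))%R).
{ eapply Rle_trans; [apply Rabs_triang|]; apply Rplus_le_compat; [nra|].
  rewrite Rabs_mult; apply Rmult_le_compat; try apply Rabs_pos; [lra|nra]. }
assert (A2 : (Rabs (exp x * (sin y - 0 - 1 * y) + (exp x - 1) * y)
  <= 3 * (e' * m) + 2 * (e' * m))%R).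
{ eapply Rle_trans; [apply Rabs_triang|]; apply Rplus_le_compat;
    rewrite Rabs_mult.
  - apply Rmult_le_compat; try apply Rabs_pos; [lra|nra].
  - replace (2 * (e' * m))%R with ((2 * e') * m)%R by ring.
    apply Rmult_le_compat; try apply Rabs_pos; lra. }
assert (0 <= m)%R by (unfold m; apply Cmod_ge_0).
assert (10 * (e' * m) <= e * m)%R by nra.
nra.
Qed.

Lemma cderiv_Cexp (w : C) : cderiv Cexp w (Cexp w).
Proof.
apply cderiv_ext_loc with (fun v => Cexp w * Cexp (v + - w)).
- exists 1%R; split; [lra|]; intros v _; rewrite <- Cexp_plus; f_equal; ring.
- eapply cderiv_eq.
  + apply cderiv_mult; [apply cderiv_const|].
    apply (cderiv_comp (fun v => v + - w) Cexp).
    * apply cderiv_plus; [apply cderiv_id|apply cderiv_const].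
    * replace (w + - w) with (RtoC 0) by ring; apply cderiv_Cexp_0.
  + cbv beta; ring.
Qed.

Lemma cderiv_Cexp_lin (c w : C) :
  cderiv (fun w => Cexp (c * w)) w (c * Cexp (c * w)).
Proof.
eapply cderiv_eq.
- apply (cderiv_comp (fun w => c * w) Cexp); [|apply cderiv_Cexp].
  apply cderiv_mult; [apply cderiv_const|apply cderiv_id].
- cbv beta; ring.
Qed.

Lemma holo_ccont (O : C -> Prop) (h : C -> C) (w : C) :
  holo O h -> O w -> ccont h w.
Proof. intros (h' & H) Hw; eapply cderiv_ccont, H, Hw. Qed.

Lemma holo_const (O : C -> Prop) (c : C) : holo O (fun _ => c).
Proof.
exists (fun _ => 0); intros w _; split; [apply cderiv_const|apply ccont_const].
Qed.

Lemma holo_id (O : C -> Prop) : holo O (fun w => w).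
Proof.
exists (fun _ => 1); intros w _; split; [apply cderiv_id|apply ccont_const].
Qed.

Lemma holo_plus (O : C -> Prop) (f g : C -> C) :
  holo O f -> holo O g -> holo O (fun w => f w + g w).
Proof.
intros (f' & Hf) (g' & Hg); exists (fun w => f' w + g' w); intros w Hw.
split; [now apply cderiv_plus; [apply Hf|apply Hg]|].
now apply ccont_plus; [apply Hf|apply Hg].
Qed.

Lemma holo_mult (O : C -> Prop) (f g : C -> C) :
  holo O f -> holo O g -> holo O (fun w => f w * g w).
Proof.
intros (f' & Hf) (g' & Hg); exists (fun w => f' w * g w + f w * g' w).
intros w Hw; destruct (Hf w Hw), (Hg w Hw).
split; [now apply cderiv_mult|].
apply ccont_plus; apply ccont_mult; try assumption; eapply cderiv_ccont; eassumption.
Qed.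

Lemma holo_inv (O : C -> Prop) (f : C -> C) :
  holo O f -> (forall w, O w -> f w <> 0) -> holo O (fun w => / f w).
Proof.
intros (f' & Hf) Hn; exists (fun w => - (1) * f' w * / (f w * f w)).
intros w Hw; destruct (Hf w Hw) as (H1 & H2); specialize (Hn w Hw); split.
- eapply cderiv_eq; [apply cderiv_inv; eassumption|ring].
- apply ccont_mult; [apply ccont_mult; [apply ccont_const|exact H2]|].
  apply ccont_inv; [|now apply Cmult_neq_0].
  apply ccont_mult; eapply cderiv_ccont; eassumption.
Qed.

Lemma holo_Cexp (O : C -> Prop) (c : C) : holo O (fun w => Cexp (c * w)).
Proof.
exists (fun w => c * Cexp (c * w)); intros w _; split; [apply cderiv_Cexp_lin|].
apply ccont_mult; [apply ccont_const|eapply cderiv_ccont, cderiv_Cexp_lin].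
Qed.

Lemma holo_ext (O : C -> Prop) (f g : C -> C) :
  Copen O -> (forall w, O w -> f w = g w) -> holo O f -> holo O g.
Proof.
intros HO E (f' & Hf); exists f'; intros w Hw; destruct (Hf w Hw) as (H1 & H2).
split; [|exact H2]; apply cderiv_ext_loc with f; [|exact H1].
destruct (HO w Hw) as (d & Hd & H); exists d; split; [exact Hd|]; auto.
Qed.

(** * The zeros of the sine *)

(** 2 i sin (pi w), the denominator of the Borel transform. *)
Definition Dsin (w : C) : C :=
  Cexp (RtoC PI * Ci * w) - Cexp (- (RtoC PI * Ci) * w).

Definition nonpole (w : C) : Prop := Dsin w <> 0.

Lemma cderiv_Dsin (w : C) :
  cderiv Dsin w (RtoC PI * Ci
    * (Cexp (RtoC PI * Ci * w) + Cexp (- (RtoC PI * Ci) * w))).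
Proof.
apply cderiv_ext_loc with (fun w => Cexp (RtoC PI * Ci * w)
  + - (1) * Cexp (- (RtoC PI * Ci) * w)).
- exists 1%R; split; [lra|]; intros; unfold Dsin; ring.
- eapply cderiv_eq.
  + apply cderiv_plus; [apply cderiv_Cexp_lin|].
    apply cderiv_mult; [apply cderiv_const|apply cderiv_Cexp_lin].
  + cbv beta; ring.
Qed.

Lemma holo_Dsin (O : C -> Prop) : holo O Dsin.
Proof.
eexists; intros w _; split; [apply cderiv_Dsin|].
assert (H : forall c, ccont (fun w => Cexp (c * w)) w)
  by (intros; eapply cderiv_ccont, cderiv_Cexp_lin).
apply ccont_mult; [apply ccont_const|now apply ccont_plus].
Qed.

Lemma Dsin_ccont (w : C) : ccont Dsin w.
Proof. eapply cderiv_ccont, cderiv_Dsin. Qed.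

Lemma Copen_nonpole : Copen nonpole.
Proof.
intros w Hw; destruct (ccont_bounded_below Dsin w (Dsin_ccont w) Hw) as (d & Hd & H).
exists d; split; [exact Hd|]; intros v Hv; apply Cmod_neq_0.
specialize (H v Hv); pose proof (Cmod_ge_0 (Dsin w)); lra.
Qed.

Lemma Copen_nonpole_scal (m : C) : Copen (fun w => nonpole (m * w)).
Proof.
intros w Hw; destruct (Copen_nonpole (m * w) Hw) as (r & Hr & H).
assert (Hm : (0 < Cmod m + 1)%R) by (pose proof (Cmod_ge_0 m); lra).
exists (r / (Cmod m + 1))%R; split; [apply Rdiv_lt_0_compat; lra|].
intros v Hv; apply H; replace (m * v - m * w) with (m * (v - w)) by ring.
rewrite Cmod_mult; apply (Rlt_div_r _ _ (Cmod m + 1)) in Hv; [|lra].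
pose proof (Cmod_ge_0 (v - w)); nra.
Qed.

Lemma Dsin_xy (w : C) :
  Dsin w = ((- (cos (PI * fst w) * (exp (PI * snd w) - exp (- (PI * snd w)))))%R,
            (sin (PI * fst w) * (exp (PI * snd w) + exp (- (PI * snd w))))%R).
Proof.
destruct w as [x y].
assert (E1 : RtoC PI * Ci * (x, y) = ((- (PI * y))%R, (PI * x)%R)).
{ unfold Cmult, RtoC, Ci; simpl; f_equal; ring. }
assert (E2 : - (RtoC PI * Ci) * (x, y) = ((PI * y)%R, (- (PI * x))%R)).
{ unfold Cmult, RtoC, Ci, Copp; simpl; f_equal; ring. }
unfold Dsin; rewrite E1, E2; unfold Cexp, Cminus, Cplus, Copp; cbn [fst snd].
rewrite cos_neg, sin_neg; f_equal; ring.
Qed.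

Lemma sinh_ge (t : R) : (0 <= t)%R -> (2 * t <= exp t - exp (- t))%R.
Proof.
intros Ht.
set (f := fun t : R => (exp t - exp (- t) - 2 * t)%R).
set (f' := fun t : R => (exp t + exp (- t) - 2)%R).
destruct (Req_dec t 0) as [->|Hn]; [rewrite Ropp_0; lra|].
destruct (MVT_gen f 0 t f') as (c & Hc & E).
- intros s _; unfold f, f'; auto_derive; [exact I|ring].
- intros s _; apply derivable_continuous_pt.
  exists (f' s); apply is_derive_Reals; unfold f, f'; auto_derive; [exact I|ring].
- assert (0 <= f' c)%R.
  { unfold f'; pose proof (exp_pos c); pose proof (exp_pos (- c)).
    assert (exp c * exp (- c) = 1)%R by (rewrite <- exp_plus, <- exp_0; f_equal; ring).
    assert (0 <= exp (- c) * (exp c - 1) ^ 2)%R by (apply Rmult_le_pos; [lra|apply pow2_ge_0]).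
    replace (exp (- c) * (exp c - 1) ^ 2)%R with
      (exp c * (exp c * exp (- c)) - 2 * (exp c * exp (- c)) + exp (- c))%R
      in * by ring.
    nra. }
  assert (f 0%R = 0%R) by (unfold f; rewrite Ropp_0, exp_0; ring).
  assert (0 <= f t)%R by nra.
  unfold f in *; lra.
Qed.

(** The modulus of sin (pi (x + i y)) is at least sinh (pi |y|). *)
Lemma Cmod_Dsin_ge (w : C) : (Rabs (snd w) <= Cmod (Dsin w))%R.
Proof.
rewrite Dsin_xy; destruct w as [x y]; cbn [fst snd].
set (A := exp (PI * y)); set (B := exp (- (PI * y))).
assert (HA : (0 < A)%R) by apply exp_pos.
assert (HB : (0 < B)%R) by apply exp_pos.
assert (Hs : (Rabs y <= Rabs (A - B))%R).
{ pose proof PI_RGT_0 as Hpi; pose proof PI2_1 as Hpi2.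
  destruct (Rle_dec 0 y) as [H|H].
  - rewrite (Rabs_pos_eq y) by exact H.
    pose proof (sinh_ge (PI * y) ltac:(nra)) as K; fold A B in K.
    assert (y <= PI * y)%R by nra.
    rewrite Rabs_pos_eq; lra.
  - rewrite (Rabs_left y) by lra.
    pose proof (sinh_ge (- (PI * y)) ltac:(nra)) as K.
    rewrite Ropp_involutive in K; fold A B in K.
    assert (- y <= PI * - y)%R by nra.
    rewrite Rabs_left1; lra. }
apply Rle_trans with (1 := Hs).
unfold Cmod; cbn [fst snd].
apply Rsqr_incr_0_var; [|apply sqrt_pos].
rewrite Rsqr_sqrt by (apply Rplus_le_le_0_compat; apply pow2_ge_0); rewrite <- Rsqr_abs.
pose proof (sin2_cos2 (PI * x)) as E; unfold Rsqr in *.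
set (c := cos (PI * x)) in *; set (s := sin (PI * x)) in *.
assert ((A - B) * (A - B) = (s * s + c * c) * ((A - B) * (A - B)))%R
  by (rewrite E; ring).
assert (0 <= s * s)%R by nra.
nra.
Qed.

Lemma nonpole_im (w : C) : snd w <> 0%R -> nonpole w.
Proof.
intros H; apply Cmod_neq_0; pose proof (Cmod_Dsin_ge w).
apply Rabs_pos_lt in H; lra.
Qed.

Lemma Cmod_Dsin_ge_sin (w : C) :
  (2 * Rabs (sin (PI * fst w)) <= Cmod (Dsin w))%R.
Proof.
apply Rle_trans with (2 := abs_snd_le _); rewrite Dsin_xy; cbn [snd].
rewrite Rabs_mult, Rmult_comm; apply Rmult_le_compat_l; [apply Rabs_pos|].
set (t := (PI * snd w)%R).
pose proof (exp_pos t); pose proof (exp_pos (- t)).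
assert (exp t * exp (- t) = 1)%R by (rewrite <- exp_plus, <- exp_0; f_equal; ring).
assert (0 <= exp (- t) * (exp t - 1) ^ 2)%R by (apply Rmult_le_pos; [lra|apply pow2_ge_0]).
replace (exp (- t) * (exp t - 1) ^ 2)%R with
  (exp t * (exp t * exp (- t)) - 2 * (exp t * exp (- t)) + exp (- t))%R
  in * by ring.
rewrite Rabs_pos_eq by lra; nra.
Qed.

Lemma sin_cos_shift (n : nat) (x : R) :
  sin (x + INR n * PI) = ((-1) ^ n * sin x)%R /\
  cos (x + INR n * PI) = ((-1) ^ n * cos x)%R.
Proof.
induction n as [|n (IH1 & IH2)].
- simpl; rewrite Rmult_0_l, Rplus_0_r; split; ring.
- rewrite S_INR; replace (x + (INR n + 1) * PI)%R with (x + INR n * PI + PI)%R by ring.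
  rewrite neg_sin, neg_cos, IH1, IH2; simpl; split; ring.
Qed.

Lemma pow_m1_neq_0 (n : nat) : ((-1) ^ n)%R <> 0%R.
Proof. apply pow_nonzero; lra. Qed.

Lemma nonpole_between (n : nat) (w : C) :
  (INR n < fst w < INR n + 1)%R -> nonpole w.
Proof.
intros H; apply Cmod_neq_0.
apply Rlt_le_trans with (2 := Cmod_Dsin_ge_sin w).
apply Rmult_lt_0_compat; [lra|]; apply Rabs_pos_lt.
replace (PI * fst w)%R with (PI * (fst w - INR n) + INR n * PI)%R by ring.
rewrite (proj1 (sin_cos_shift n _)); apply Rmult_integral_contrapositive; split.
- apply pow_m1_neq_0.
- pose proof PI_RGT_0; apply Rgt_not_eq, sin_gt_0; nra.
Qed.

(** On the lines halfway between consecutive zeros the sine stays away from 0;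
    these are the lines along which the sector is cut. *)
Lemma Cmod_Dsin_half (n : nat) (w : C) :
  fst w = (INR n + 1 / 2)%R -> (2 <= Cmod (Dsin w))%R.
Proof.
intros H; apply Rle_trans with (2 := Cmod_Dsin_ge_sin w).
replace (PI * fst w)%R with (PI / 2 + INR n * PI)%R by (rewrite H; field).
rewrite (proj1 (sin_cos_shift n _)), sin_PI2, Rmult_1_r, pow_1_abs; lra.
Qed.

Lemma nonpole_neq_0 (w : C) : nonpole w -> w <> 0.
Proof.
intros H ->; apply H; unfold Dsin; rewrite !Cmult_0_r, Cexp_0; ring.
Qed.

Lemma Dsin_nat (n : nat) :
  Dsin (RtoC (INR n)) = 0 /\
  cderiv Dsin (RtoC (INR n)) (twopii * RtoC ((-1) ^ n)).
Proof.
assert (E1 : Cexp (RtoC PI * Ci * RtoC (INR n)) = RtoC ((-1) ^ n)).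
{ replace (RtoC PI * Ci * RtoC (INR n)) with (RtoC 0 + RtoC (INR n * PI) * Ci)
    by (rewrite RtoC_mult; ring).
  unfold Cexp, Cplus, Cmult, RtoC, Ci; cbn [fst snd].
  pose proof (sin_cos_shift n 0) as (Es & Ec); rewrite Rplus_0_l in Es, Ec.
  replace (0 + (INR n * PI * 0 - 0 * 1))%R with 0%R by ring.
  replace (0 + (INR n * PI * 1 + 0 * 0))%R with (INR n * PI)%R by ring.
  rewrite Es, Ec, exp_0, sin_0, cos_0; f_equal; ring. }
assert (E2 : Cexp (- (RtoC PI * Ci) * RtoC (INR n)) = RtoC ((-1) ^ n)).
{ replace (- (RtoC PI * Ci) * RtoC (INR n)) with (- (RtoC PI * Ci * RtoC (INR n)))
    by ring.
  rewrite Cexp_opp, E1, <- RtoC_inv by apply pow_m1_neq_0; f_equal.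
  rewrite <- pow_inv; f_equal; field. }
split; [unfold Dsin; rewrite E1, E2; ring|].
eapply cderiv_eq; [apply cderiv_Dsin|].
rewrite E1, E2; unfold twopii; rewrite RtoC_mult; ring.
Qed.

Lemma twopii_neq_0 : twopii <> 0.
Proof.
unfold twopii; apply Cmult_neq_0; [|exact Ci_nz].
intros E; apply RtoC_inj in E; pose proof PI_RGT_0; lra.
Qed.

Lemma Cmod_twopii : Cmod twopii = (2 * PI)%R.
Proof.
unfold twopii; rewrite Cmod_mult, Cmod_Ci, Cmod_R, Rabs_pos_eq; [ring|].
pose proof PI_RGT_0; lra.
Qed.

(** * The Borel transform in closed form *)

(** Here w = xi / z; the value at w = 0 is supplied in [borel]. *)
Definition borel_form (th w : C) : C :=
  / (twopii * (w * w))
  * (1 + th * w - Cexp (th * w) * (twopii * w) * / Dsin w).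

Lemma Dsin_opp (w : C) : Dsin (- w) = - Dsin w.
Proof.
unfold Dsin.
replace (RtoC PI * Ci * - w) with (- (RtoC PI * Ci) * w) by ring.
replace (- (RtoC PI * Ci) * - w) with (RtoC PI * Ci * w) by ring.
ring.
Qed.

(** This exchanges the rays through z and -z. *)
Lemma borel_form_sym (th w : C) : nonpole w -> borel_form (- th) (- w) = borel_form th w.
Proof.
intros Hw; pose proof (nonpole_neq_0 w Hw).
unfold borel_form; rewrite Dsin_opp.
replace (- th * - w) with (th * w) by ring.
field; repeat split; auto using twopii_neq_0.
Qed.

Lemma holo_borel_form (th : C) : holo nonpole (borel_form th).
Proof.
assert (H : holo nonpole (fun w => / (twopii * (w * w))
  * ((1 + th * w) + - (1) * (Cexp (th * w) * (twopii * w) * / Dsin w)))).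
{ apply holo_mult.
  - apply holo_inv.
    + apply holo_mult; [apply holo_const|]; apply holo_mult; apply holo_id.
    + intros w Hw; pose proof (nonpole_neq_0 w Hw).
      apply Cmult_neq_0; [apply twopii_neq_0|now apply Cmult_neq_0].
  - apply holo_plus.
    + apply holo_plus; [apply holo_const|].
      apply holo_mult; [apply holo_const|apply holo_id].
    + apply holo_mult; [apply holo_const|].
      apply holo_mult; [|apply holo_inv; [apply holo_Dsin|auto]].
      apply holo_mult; [apply holo_Cexp|].
      apply holo_mult; [apply holo_const|apply holo_id]. }
revert H; apply holo_ext; [apply Copen_nonpole|].
intros w _; unfold borel_form; ring.
Qed.

Lemma borel_form_bound (th w : C) (w0 c : R) :
  (0 < w0)%R -> (0 < c)%R -> (w0 <= Cmod w)%R -> (c <= Cmod (Dsin w))%R ->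
  (Cmod (borel_form th w) <= / (2 * PI * (w0 * w0))
     * (1 + Cmod th + 2 * PI / c) * exp ((Cmod th + 1) * Cmod w))%R.
Proof.
intros Hw0 Hc Hw HD; pose proof PI_RGT_0 as Hpi.
assert (Hwn : w <> 0) by (apply Cmod_neq_0; lra).
assert (HDn : Dsin w <> 0) by (apply Cmod_neq_0; lra).
set (t := Cmod w) in *; set (a := Cmod th).
assert (Ha : (0 <= a)%R) by apply Cmod_ge_0.
assert (E1 : (1 <= exp (a * t))%R).
{ rewrite <- exp_0; apply exp_le_mono; nra. }
assert (E2 : (1 <= exp t /\ t <= exp t)%R).
{ pose proof (exp_ineq1_le t); split; lra. }
assert (Ee : exp ((a + 1) * t) = (exp (a * t) * exp t)%R).
{ rewrite <- exp_plus; f_equal; ring. }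
assert (Et : (t <= exp ((a + 1) * t) /\ 1 <= exp ((a + 1) * t))%R).
{ rewrite Ee; split; nra. }
unfold borel_form; rewrite Cmod_mult, Cmod_inv.
2:{ apply Cmult_neq_0; [apply twopii_neq_0|now apply Cmult_neq_0]. }
rewrite !Cmod_mult, Cmod_twopii; fold t.
rewrite (Rmult_assoc (/ (2 * PI * (w0 * w0)))); apply Rmult_le_compat.
- apply Rlt_le, Rinv_0_lt_compat, Rmult_lt_0_compat; nra.
- apply Cmod_ge_0.
- apply Rinv_le_contravar; [apply Rmult_lt_0_compat; nra|].
  apply Rmult_le_compat_l; nra.
- unfold Cminus; eapply Rle_trans; [apply Cmod_triangle|].
  rewrite Cmod_opp, !Cmod_mult, Cmod_twopii, Cmod_Cexp, Cmod_inv by exact HDn.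
  fold t.
  assert (B1 : (Cmod (1 + th * w) <= (1 + a) * exp ((a + 1) * t))%R).
  { eapply Rle_trans; [apply Cmod_triangle|]; rewrite Cmod_1, Cmod_mult; fold a t.
    nra. }
  assert (B2 : (exp (fst (th * w)%C) <= exp (a * t))%R).
  { apply exp_le_mono; eapply Rle_trans; [apply Rle_abs|].
    eapply Rle_trans; [apply abs_fst_le|]; rewrite Cmod_mult; apply Rle_refl. }
  assert (B3 : (/ Cmod (Dsin w) <= / c)%R) by (apply Rinv_le_contravar; lra).
  assert (B4 : (exp (fst (th * w)%C) * (2 * PI * t) <= exp ((a + 1) * t) * (2 * PI))%R).
  { rewrite Ee.
    assert (exp (fst (th * w)%C) * t <= exp (a * t) * exp t)%R.
    { apply Rmult_le_compat; try lra; apply Rlt_le, exp_pos. }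
    nra. }
  assert (B5 : (exp (fst (th * w)%C) * (2 * PI * t) * / Cmod (Dsin w)
     <= exp ((a + 1) * t) * (2 * PI) * / c)%R).
  { apply Rmult_le_compat; auto.
    - apply Rmult_le_pos; [apply Rlt_le, exp_pos|nra].
    - apply Rlt_le, Rinv_0_lt_compat; lra. }
  replace ((1 + a + 2 * PI / c) * exp ((a + 1) * t))%R
    with ((1 + a) * exp ((a + 1) * t) + exp ((a + 1) * t) * (2 * PI) * / c)%R
    by (field; lra).
  now apply Rplus_le_compat.
Qed.

(** If Dsin w = q(w) (w - n) is Caratheodory's factorisation at the integer [n], the
    product of [v = w - n] with the integrand is an expression in q(w) that is
    continuous at [n]; its value there is the residue, with
    q(n) = 2 pi i (-1)^n. *)
Lemma borel_form_residue (th l : C) (n : nat) : (1 <= n)%nat ->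
  forall e, (0 < e)%R -> exists d, (0 < d)%R /\ forall v : C, v <> 0 ->
  (Cmod v < d)%R ->
  (Cmod (v * (Cexp (- l * (RtoC (INR n) + v)) * borel_form th (RtoC (INR n) + v))
     - - (RtoC ((-1) ^ n) * Cpow (Cexp (th - l)) n / (twopii * RtoC (INR n)))) <= e)%R.
Proof.
intros Hn; destruct (Dsin_nat n) as (E0 & q & Hq & Hqn & Eq).
set (N := RtoC (INR n)) in *.
assert (HN : N <> 0).
{ intros E; apply RtoC_inj in E; revert E; apply not_0_INR; lia. }
assert (Hs : RtoC ((-1) ^ n) <> 0).
{ intros E; apply RtoC_inj in E; revert E; apply pow_m1_neq_0. }
assert (Hq0 : q N <> 0).
{ rewrite Hqn; apply Cmult_neq_0; [apply twopii_neq_0|exact Hs]. }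
set (Phi := fun w => Cexp (- l * w) * / (twopii * (w * w))
  * ((w + - N) * (1 + th * w) + - (1) * (Cexp (th * w) * (twopii * w) * / q w))).
assert (HPhi : ccont Phi N).
{ assert (HE : forall c, ccont (fun w => Cexp (c * w)) N).
  { intros c; apply (holo_ccont (fun _ => True)); [apply holo_Cexp|exact I]. }
  apply ccont_mult.
  - apply ccont_mult; [apply HE|].
    apply ccont_inv.
    + apply ccont_mult; [apply ccont_const|]; apply ccont_mult; apply ccont_id.
    + apply Cmult_neq_0; [apply twopii_neq_0|now apply Cmult_neq_0].
  - apply ccont_plus.
    + apply ccont_mult; apply ccont_plus; try apply ccont_const; try apply ccont_id.
      ccont_arith.
    + apply ccont_mult; [apply ccont_const|].
      apply ccont_mult; [|now apply ccont_inv].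
      apply ccont_mult; [apply HE|].
      ccont_arith. }
assert (EN : Phi N = - (RtoC ((-1) ^ n) * Cpow (Cexp (th - l)) n / (twopii * N))).
{ unfold Phi; rewrite Hqn.
  assert (E : Cpow (Cexp (th - l)) n = Cexp (- l * N) * Cexp (th * N)).
  { rewrite <- Cexp_nat, <- Cexp_plus; f_equal; unfold N; ring. }
  assert (E1 : RtoC ((-1) ^ n) * RtoC ((-1) ^ n) = 1).
  { rewrite <- RtoC_mult, <- Rpow_mult_distr.
    replace (-1 * -1)%R with 1%R by ring; now rewrite pow1. }
  rewrite E; replace (N + - N) with (RtoC 0) by ring.
  set (s := RtoC ((-1) ^ n)) in *.
  replace (s * (Cexp (- l * N) * Cexp (th * N)) / (twopii * N))
    with ((s * s) * (Cexp (- l * N) * Cexp (th * N)) / (s * twopii * N)).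
  2:{ field; repeat split; auto using twopii_neq_0. }
  rewrite E1; field; repeat split; auto using twopii_neq_0. }
intros e He; destruct (HPhi e He) as (d & Hd & H).
destruct (ccont_bounded_below q N Hq Hq0) as (d1 & Hd1 & H1).
assert (HNm : (0 < Cmod N)%R) by now apply Cmod_gt_0.
exists (Rmin d (Rmin d1 (Cmod N))); split; [repeat apply Rmin_pos; assumption|].
intros v Hv Hvd.
assert (Hvv : (Cmod v < d /\ Cmod v < d1 /\ Cmod v < Cmod N)%R).
{ pose proof (Rmin_l d (Rmin d1 (Cmod N))).
  pose proof (Rmin_r d (Rmin d1 (Cmod N))).
  pose proof (Rmin_l d1 (Cmod N)); pose proof (Rmin_r d1 (Cmod N)); lra. }
rewrite <- EN.
replace (v * (Cexp (- l * (N + v)) * borel_form th (N + v))) with (Phi (N + v)).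
- apply Rlt_le, H; replace (N + v - N) with v by ring; apply Hvv.
- assert (Hqv : q (N + v) <> 0).
  { apply Cmod_neq_0; specialize (H1 (N + v)).
    replace (N + v - N) with v in H1 by ring; specialize (H1 ltac:(apply Hvv)).
    apply Cmod_gt_0 in Hq0; lra. }
  assert (HNv : N + v <> 0).
  { apply Cmod_neq_0; pose proof (Cmod_ge_sub N v); lra. }
  assert (ED : Dsin (N + v) = q (N + v) * v).
  { replace v with (N + v - N) at 3 by ring; rewrite <- Eq, E0; ring. }
  unfold borel_form, Phi; rewrite ED; field; repeat split; auto using twopii_neq_0.
Qed.

(** * Residues between two rays *)

(** Induction on the number of poles. The sector up to Re w = 1/2 is a triangle
    without poles, and the slice between Re w = n - 1/2 and Re w = n + 1/2 is a
    quadrilateral around [n], on which the dilations by t < 2 from [n] meet no other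
    integer. *)
Lemma sector_residues (O : C -> Prop) (h : C -> C) (rho : nat -> C) (a b : R) :
  Copen O -> holo O h -> ccont h 0 ->
  (forall w, snd w <> 0%R -> O w) ->
  (forall (n : nat) w, (INR n < fst w < INR n + 1)%R -> O w) ->
  (forall n, (1 <= n)%nat -> forall e, (0 < e)%R -> exists d, (0 < d)%R /\
     forall v : C, v <> 0 -> (Cmod v < d)%R ->
     (Cmod (v * h (RtoC (INR n) + v)%C - rho n) <= e)%R) ->
  (0 < a)%R -> (0 < b)%R ->
  forall N : nat,
  let X := (INR N + 1 / 2)%R in let L := (1%R, (- a)%R) : C in
  let U := (1%R, b) : C in
  rayint h L X + seg h (RtoC X * L) (RtoC X * U) - rayint h U X
  = sum_n_m (fun n => twopii * rho n) 1 N.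
Proof.
intros HO Hh H0 Him Hbet Hres Ha Hb N X L U; subst X.
assert (Hc : forall y t, y <> 0%R -> (0 <= t)%R -> ccont h (RtoC t * (1%R, y))).
{ intros y t Hy Ht; destruct (Req_dec t 0) as [->|Hn].
  - now rewrite Cmult_0_l.
  - apply (holo_ccont O); [exact Hh|]; apply Him; simpl.
    rewrite Rmult_0_l, Rplus_0_r; now apply Rmult_integral_contrapositive. }
assert (HcL := fun t => Hc (- a)%R t ltac:(lra)).
assert (HcU := fun t => Hc b t ltac:(lra)).
induction N as [|N IH].
- rewrite sum_n_m_zero by lia; simpl INR.
  apply (triangle_at_origin O h L U 2); try assumption; try lra.
  intros t s Ht Hs; apply (Hbet 0%nat); unfold L, U; simpl; lra.
- rewrite sum_n_Sm by lia; rewrite <- IH; clear IH.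
  pose proof (pos_INR N) as HN.
  set (X := (INR N + 1 / 2)%R) in *.
  replace (INR (S N) + 1 / 2)%R with (X + 1)%R by (rewrite S_INR; unfold X; ring).
  set (n := RtoC (INR (S N))).
  assert (Hn : INR (S N) = (X + 1 / 2)%R) by (rewrite S_INR; unfold X; lra).
  assert (HX : (1 / 2 <= X)%R) by (unfold X; lra).
  pose proof (quadrilateral_residue O h n (rho (S N))
    (RtoC X * L - n) (RtoC (X + 1) * L - n) (RtoC (X + 1) * U - n) (RtoC X * U - n)
    2 HO Hh ltac:(lra) (Hres (S N) ltac:(lia))) as K.
  assert (Ef : forall x (V : C), fst V = 1%R ->
    fst (RtoC x * V - n) = (x - INR (S N))%R).
  { intros x V HV; unfold n, Cminus, Cplus, Copp, Cmult, RtoC; cbn [fst snd].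
    rewrite HV; ring. }
  assert (Es : forall x V, snd (RtoC x * V - n) = (x * snd V)%R).
  { intros x V; unfold n, Cminus, Cplus, Copp, Cmult, RtoC; cbn [fst snd]; ring. }
  rewrite !Ef, !Es in K by reflexivity; rewrite Hn in K.
  unfold L, U in K; cbn [fst snd] in K; fold L U in K.
  specialize (K ltac:(lra) ltac:(nra) ltac:(lra) ltac:(nra) ltac:(lra) ltac:(nra)
    ltac:(lra) ltac:(nra)).
  replace (n + (RtoC X * L - n)) with (RtoC X * L) in K by ring.
  replace (n + (RtoC X * U - n)) with (RtoC X * U) in K by ring.
  replace (n + (RtoC (X + 1) * L - n)) with (RtoC (X + 1) * L) in K by ring.
  replace (n + (RtoC (X + 1) * U - n)) with (RtoC (X + 1) * U) in K by ring.
  rewrite <- (rayint_step h L X (X + 1)) in K by (try lra; exact HcL).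
  rewrite <- (rayint_step h U X (X + 1)) in K by (try lra; exact HcU).
  change (plus ?x ?y) with (Cplus x y).
  rewrite <- K; [ring|].
  assert (Epath : forall t s (P Q : C),
    fst (n + RtoC t * (P + RtoC s * (Q - P)))
      = (X + 1 / 2 + t * ((1 - s) * fst P + s * fst Q))%R /\
    snd (n + RtoC t * (P + RtoC s * (Q - P)))
      = (t * ((1 - s) * snd P + s * snd Q))%R).
  { intros t s P Q; rewrite <- Hn.
    unfold n, Cminus, Cplus, Copp, Cmult, RtoC; cbn [fst snd]; split; ring. }
  intros P Q HPQ t s Ht Hs; destruct (Epath t s P Q) as (E1 & E2).
  destruct HPQ as [E|[E|[E|[E|[]]]]]; injection E as <- <-.
  + apply Him; rewrite E2, !Es; unfold L; cbn [snd].
    apply Rlt_not_eq.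
    replace (t * ((1 - s) * (X * - a) + s * ((X + 1) * - a)))%R
      with (- (t * a * (X + s)))%R by ring.
    assert (0 < t * a)%R by nra; nra.
  + apply (Hbet (S N)); rewrite E1, !Ef by reflexivity; rewrite Hn.
    split; nra.
  + apply Him; rewrite E2, !Es; unfold U; cbn [snd].
    apply Rgt_not_eq.
    replace (t * ((1 - s) * (X * b) + s * ((X + 1) * b)))%R
      with (t * b * (X + s))%R by ring.
    assert (0 < t * b)%R by nra; nra.
  + apply (Hbet N); rewrite E1, !Ef by reflexivity; rewrite Hn.
    unfold X; split; nra.
Qed.

(** * The logarithm series *)

Lemma Clog_right_half (w : C) : (0 < fst w)%R -> Clog w = log_right w.
Proof.
destruct w as [x y]; cbn [fst]; intros Hx.
assert (Hm : (0 < Cmod (x, y))%R).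
{ apply Cmod_gt_0; intros E; apply (f_equal fst) in E; simpl in E; lra. }
assert (Hm2 : (Cmod (x, y) ^ 2 = x ^ 2 + y ^ 2)%R).
{ unfold Cmod; cbn [fst snd]; rewrite pow2_sqrt; [reflexivity|nra]. }
unfold Clog, log_right; cbn [fst snd]; f_equal.
- rewrite <- Hm2; replace (Cmod (x, y) ^ 2)%R with (Cmod (x, y) * Cmod (x, y))%R by ring.
  rewrite ln_mult by assumption; field.
- unfold Carg; cbn [fst snd].
  assert (Hq : (0 < x / Cmod (x, y))%R) by (apply Rdiv_lt_0_compat; lra).
  rewrite acos_atan by exact Hq.
  assert (Es : (sqrt (1 - Rsqr (x / Cmod (x, y))) = Rabs y / Cmod (x, y))%R).
  { replace (1 - Rsqr (x / Cmod (x, y)))%R with (Rsqr (y / Cmod (x, y)))%R.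
    - rewrite sqrt_Rsqr_abs, Rabs_div, (Rabs_pos_eq (Cmod _)) by lra; reflexivity.
    - unfold Rsqr.
      replace (y / Cmod (x, y) * (y / Cmod (x, y)))%R with (y ^ 2 / Cmod (x, y) ^ 2)%R
        by (field; lra).
      replace (x / Cmod (x, y) * (x / Cmod (x, y)))%R with (x ^ 2 / Cmod (x, y) ^ 2)%R
        by (field; lra).
      rewrite Hm2; field; nra. }
  rewrite Es.
  replace (Rabs y / Cmod (x, y) / (x / Cmod (x, y)))%R with (Rabs y / x)%R
    by (field; lra).
  destruct (Rle_dec 0 y) as [H|H].
  + now rewrite Rabs_pos_eq.
  + rewrite Rabs_left by lra; rewrite <- atan_opp; f_equal; field; lra.
Qed.

Lemma Cint_pow (c : C) (n : nat) :
  Cint (fun t => c * Cpow (RtoC t) n) 0 1 = c / RtoC (INR (S n)).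
Proof.
assert (Hn : RtoC (INR (S n)) <> 0).
{ apply RtoC_neq_0, not_0_INR; lia. }
rewrite (Cint_derive (fun t => c / RtoC (INR (S n)) * Cpow (RtoC t) (S n))).
- rewrite !Cpow_S, Cpow_1_l; ring.
- lra.
- intros t _; apply (ccont_pcont (fun z => c * Cpow z n)), ccont_monomial.
- intros t _; apply (cderiv_real (fun z => c / RtoC (INR (S n)) * Cpow z (S n))).
  eapply cderiv_eq; [apply cderiv_mult; [apply cderiv_const|apply cderiv_monomial]|].
  cbv beta; field; exact Hn.
Qed.

(** The integral of x / (1 + t x) over 0 <= t <= 1 is log (1 + x); expanding
    the integrand as a finite geometric sum gives the remainder exactly. *)
Lemma log_partial_sum (x : C) (N : nat) : (Cmod x < 1)%R ->
  Clog (1 + x) = sum_n_m (fun n => - (Cpow (- x) n / RtoC (INR n))) 1 N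
    + Cint (fun t => Cpow (- x) N * Cpow (RtoC t) N * (x * / (1 + RtoC t * x))) 0 1.
Proof.
intros Hx.
assert (Hre : forall t, (0 <= t <= 1)%R -> (0 < 1 + t * fst x)%R).
{ intros t Ht; pose proof (abs_fst_le x) as H; apply Rabs_le_between in H; nra. }
assert (Hnz : forall t, (0 <= t <= 1)%R -> 1 + RtoC t * x <> 0).
{ intros t Ht E; apply (f_equal fst) in E; specialize (Hre t Ht); simpl in E; lra. }
assert (Hct : forall k t, (0 <= t <= 1)%R -> pcont (fun t =>
  Cpow (- x) k * Cpow (RtoC t) k * (x * / (1 + RtoC t * x))) t).
{ intros k t Ht; apply (ccont_pcont (fun z =>
    Cpow (- x) k * Cpow z k * (x * / (1 + z * x)))).
  apply ccont_mult; [apply ccont_monomial|].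
  apply ccont_mult; [apply ccont_const|].
  apply ccont_inv; [ccont_arith|auto]. }
induction N as [|N IH].
- rewrite sum_n_m_zero by lia; change (@zero _) with (RtoC 0); rewrite Cplus_0_l.
  assert (H1 : (0 < fst (1 + x)%C)%R).
  { specialize (Hre 1%R ltac:(lra)); simpl; lra. }
  rewrite Clog_right_half by exact H1.
  pose proof (Cint_inv_segment 1 1 (1 + x)) as E.
  replace (1 * (1 + x)) with (1 + x) in E by ring.
  replace (RtoC 1 * RtoC 1) with (RtoC 1) in E by ring.
  specialize (E ltac:(simpl; lra) H1).
  assert (E1 : log_right 1 = 0).
  { unfold log_right, RtoC; cbn [fst snd].
    replace (1 ^ 2 + 0 ^ 2)%R with 1%R by ring; rewrite ln_1.
    replace (0 / 1)%R with 0%R by field; rewrite atan_0; f_equal; field. }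
  rewrite E1 in E; replace (log_right (1 + x)) with (log_right (1 + x) - 0) by ring.
  rewrite <- E; apply Cint_ext; [lra|]; intros t _; simpl.
  replace (1 + x - 1) with x by ring; ring.
- rewrite sum_n_Sm by lia; rewrite IH; clear IH.
  rewrite (Cint_ext _ (fun t => Cpow (- x) N * x * Cpow (RtoC t) N
    + Cpow (- x) (S N) * Cpow (RtoC t) (S N) * (x * / (1 + RtoC t * x)))).
  + rewrite Cint_plus, Cint_pow by
      (try lra; auto; intros t _;
       apply (ccont_pcont (fun z => Cpow (- x) N * x * Cpow z N)), ccont_monomial).
    change (plus ?x ?y) with (Cplus x y).
    rewrite Cpow_S; unfold Cdiv; ring.
  + lra.
  + intros t Ht; rewrite !Cpow_S; field; auto.
Qed.

Lemma log_series (x : C) : (Cmod x < 1)%R ->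
  forall e, (0 < e)%R -> exists N0 : nat, forall N, (N0 <= N)%nat ->
  (Cmod (sum_n_m (fun n => - (Cpow (- x) n / RtoC (INR n)))%C 1 N - Clog (1 + x))
    <= e)%R.
Proof.
intros Hx e He.
set (q := Cmod x) in *; assert (Hq : (0 <= q)%R) by apply Cmod_ge_0.
destruct (pow_lt_1_zero q) with (y := (e * (1 - q) / 2)%R) as (N0 & HN0).
{ rewrite Rabs_pos_eq; assumption. }
{ apply Rmult_lt_0_compat; nra. }
exists N0; intros N HN; rewrite (log_partial_sum x N Hx).
match goal with |- (Cmod (?a - (?a + ?b)) <= _)%R =>
  replace (a - (a + b)) with (- b) by ring end.
rewrite Cmod_opp.
assert (Hden : forall t, (0 <= t <= 1)%R -> (1 - q <= Cmod (1 + RtoC t * x))%R).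
{ intros t Ht; pose proof (Cmod_ge_sub 1 (RtoC t * x)) as K.
  rewrite Cmod_1, Cmod_mult, Cmod_R, Rabs_pos_eq in K by lra; fold q in K; nra. }
assert (Hnz : forall t, (0 <= t <= 1)%R -> 1 + RtoC t * x <> 0).
{ intros t Ht; apply Cmod_neq_0; specialize (Hden t Ht); lra. }
eapply Rle_trans; [apply (Cint_bound _ 0 1 (q ^ N / (1 - q))%R)|].
- lra.
- intros t Ht; apply (ccont_pcont (fun z =>
    Cpow (- x) N * Cpow z N * (x * / (1 + z * x)))).
  apply ccont_mult; [apply ccont_monomial|].
  apply ccont_mult; [apply ccont_const|].
  apply ccont_inv; [ccont_arith|auto].
- intros t Ht; rewrite !Cmod_mult, !Cmod_pow, Cmod_opp, Cmod_inv, Cmod_R by auto.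
  fold q; rewrite (Rabs_pos_eq t) by lra; specialize (Hden t Ht).
  assert (0 <= q ^ N)%R by (apply pow_le; lra).
  assert (0 <= t ^ N <= 1)%R.
  { split; [apply pow_le; lra|]; rewrite <- (pow1 N); apply pow_incr; lra. }
  assert (0 < / Cmod (1 + RtoC t * x) <= / (1 - q))%R.
  { split; [apply Rinv_0_lt_compat; lra|apply Rinv_le_contravar; lra]. }
  unfold Rdiv.
  replace (q ^ N * t ^ N * (q * / Cmod (1 + RtoC t * x)))%R
    with (q ^ N * (t ^ N * q * / Cmod (1 + RtoC t * x)))%R by ring.
  apply Rmult_le_compat_l; [assumption|].
  assert (0 <= t ^ N * q <= 1)%R by nra.
  nra.
- specialize (HN0 N HN); rewrite Rabs_pos_eq in HN0 by (apply pow_le; lra).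
  replace (2 * (q ^ N / (1 - q) * (1 - 0)))%R with ((2 * q ^ N) / (1 - q))%R
    by (field; lra).
  apply Rle_div_l; lra.
Qed.

(** * Improper integrals *)

Lemma RInt_exp_tail (f : R -> R) (M a b : R) :
  (a <= b)%R -> (0 <= M)%R ->
  (forall t, (a <= t <= b)%R -> continuous f t) ->
  (forall t, (a <= t <= b)%R -> (Rabs (f t) <= M * exp (- t))%R) ->
  (Rabs (RInt f a b) <= M * exp (- a))%R.
Proof.
intros Hab HM Hc Hb.
assert (Hf : ex_RInt f a b).
{ apply (ex_RInt_continuous (V := R_CompleteNormedModule)).
  rewrite Rmin_left, Rmax_right by lra; exact Hc. }
apply Rle_trans with (M * exp (- a) - M * exp (- b))%R.
2:{ pose proof (exp_pos (- b)); nra. }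
apply (norm_RInt_le f (fun t => (M * exp (- t))%R) a b).
- exact Hab.
- exact Hb.
- now apply (RInt_correct (V := R_CompleteNormedModule)).
- replace (M * exp (- a) - M * exp (- b))%R
    with (minus (- M * exp (- b)) (- M * exp (- a)))%R
    by (unfold minus, plus, opp; simpl;
        match goal with |- ?x = ?y => change (@eq R x y) end; ring).
  apply (is_RInt_derive (V := R_CompleteNormedModule) (fun t => (- M * exp (- t))%R)).
  + intros t _; auto_derive; [exact I|].
    match goal with |- ?x = ?y => change (@eq R x y) end; ring.
  + intros t _; apply (ex_derive_continuous (V := R_NormedModule)); auto_derive; exact I.
Qed.

(** Domination from 1 on suffices, because only the tail decides convergence. *)
Lemma improper_real (f : R -> R) (M : R) :
  (0 <= M)%R -> (forall t, (0 <= t)%R -> continuous f t) ->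
  (forall t, (1 <= t)%R -> (Rabs (f t) <= M * exp (- t))%R) ->
  exists V : R, forall e, (0 < e)%R -> exists T0, (1 <= T0)%R /\
  forall T, (T0 <= T)%R -> (Rabs (RInt f 0 T - V) < e)%R.
Proof.
intros HM Hc Hb.
assert (Hex : forall a b, (0 <= a)%R -> (a <= b)%R -> ex_RInt f a b).
{ intros a b Ha Hab; apply (ex_RInt_continuous (V := R_CompleteNormedModule)).
  rewrite Rmin_left, Rmax_right by lra; intros; apply Hc; lra. }
assert (Htail : forall a b, (1 <= a)%R -> (a <= b)%R ->
  (Rabs (RInt f 0 b - RInt f 0 a) <= M * exp (- a))%R).
{ intros a b Ha Hab.
  rewrite <- (RInt_Chasles (V := R_CompleteNormedModule) f 0 a b)
    by (apply Hex; lra).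
  assert (E : forall u v : R, (plus u v - u)%R = v) by (intros; unfold plus; simpl; ring).
  rewrite E.
  apply RInt_exp_tail; try assumption; intros; [apply Hc|apply Hb]; lra. }
assert (Hsmall : forall e, (0 < e)%R -> exists T0, (1 <= T0)%R /\
  (M * exp (- T0) < e)%R).
{ intros e He; exists (M / e + 1)%R.
  assert (0 <= M / e)%R by (apply Rdiv_le_0_compat; lra).
  split; [lra|].
  rewrite exp_Ropp; apply Rmult_lt_reg_r with (exp (M / e + 1)); [apply exp_pos|].
  rewrite Rmult_assoc, Rinv_l, Rmult_1_r by (apply Rgt_not_eq, exp_pos).
  pose proof (exp_ineq1_le (M / e + 1)) as K.
  assert (e * (M / e) = M)%R by (field; lra); nra. }
destruct (proj1 (filterlim_locally_cauchy (U := R_CompleteSpace)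
  (F := Rbar_locally p_infty) (fun T => RInt f 0 T))) as (V & HV).
- intros e; destruct (Hsmall (e / 2)%R) as (T0 & HT1 & HT0).
  { apply Rdiv_lt_0_compat; [apply cond_pos|lra]. }
  exists (fun T => (T0 < T)%R); split; [now exists T0|].
  intros u v Hu Hv.
  apply Rle_lt_trans with (Rabs (RInt f 0 v - RInt f 0 T0)
    + Rabs (RInt f 0 u - RInt f 0 T0))%R.
  + unfold ball; simpl; unfold AbsRing_ball, abs, minus, plus, opp; simpl.
    replace (RInt f 0 v + - RInt f 0 u)%R with
      ((RInt f 0 v - RInt f 0 T0) + - (RInt f 0 u - RInt f 0 T0))%R by ring.
    eapply Rle_trans; [apply Rabs_triang|]; rewrite Rabs_Ropp; apply Rle_refl.
  + pose proof (Htail T0 u HT1 ltac:(lra)); pose proof (Htail T0 v HT1 ltac:(lra)).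
    lra.
- exists V; intros e He.
  destruct (HV _ (locally_ball V (mkposreal e He))) as (T1 & HT1).
  exists (Rmax 1 (T1 + 1)); split; [apply Rmax_l|].
  intros T HT; pose proof (Rmax_r 1 (T1 + 1)).
  apply (HT1 T); lra.
Qed.

Lemma improper (f : R -> C) (M : R) :
  (forall t, (0 <= t)%R -> pcont f t) ->
  (forall t, (1 <= t)%R -> (Cmod (f t) <= M * exp (- t))%R) ->
  exists V : C,
  is_RInt_gen (V := C_R_NormedModule) f (at_point 0%R) (Rbar_locally p_infty) V /\
  forall e, (0 < e)%R -> exists T0, forall T, (T0 <= T)%R ->
  (Cmod (Cint f 0 T - V) <= e)%R.
Proof.
intros Hc Hb.
assert (HM : (0 <= M)%R).
{ specialize (Hb 1%R ltac:(lra)); pose proof (Cmod_ge_0 (f 1%R)).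
  pose proof (exp_pos (- (1))); nra. }
destruct (improper_real (fun t => fst (f t)) M HM) as (V1 & H1).
{ intros t Ht; now apply Hc. }
{ intros t Ht; apply Rle_trans with (2 := Hb t Ht), abs_fst_le. }
destruct (improper_real (fun t => snd (f t)) M HM) as (V2 & H2).
{ intros t Ht; now apply Hc. }
{ intros t Ht; apply Rle_trans with (2 := Hb t Ht), abs_snd_le. }
assert (K : forall e, (0 < e)%R -> exists T0, (1 <= T0)%R /\ forall T, (T0 <= T)%R ->
  (Cmod (Cint f 0 T - (V1, V2)) < e)%R).
{ intros e He.
  destruct (H1 (e / 2)%R) as (T1 & HT1 & K1); [lra|].
  destruct (H2 (e / 2)%R) as (T2 & HT2 & K2); [lra|].
  exists (Rmax T1 T2); split; [apply Rle_trans with (2 := Rmax_l _ _); lra|].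
  intros T HT; eapply Rle_lt_trans; [apply Cmod_le_abs|].
  pose proof (Rmax_l T1 T2); pose proof (Rmax_r T1 T2).
  specialize (K1 T ltac:(lra)); specialize (K2 T ltac:(lra)).
  unfold Cint, Cminus, Cplus, Copp; cbn [fst snd]; unfold Rminus in *; lra. }
exists (V1, V2); split.
- intros P HP; apply locally_Cmod in HP; destruct HP as (d & Hd & HP).
  destruct (K d Hd) as (T0 & HT0 & KT).
  apply Filter_prod with (fun a => a = 0%R) (fun b => (T0 < b)%R).
  + reflexivity.
  + now exists T0.
  + intros a b -> Hbt; exists (Cint f 0 b); split.
    * apply Cint_is_RInt; [simpl; lra|]; intros t Ht; apply Hc, Ht.
    * apply HP, KT; lra.
- intros e He; destruct (K e He) as (T0 & _ & KT); exists T0.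
  intros T HT; apply Rlt_le, KT, HT.
Qed.

Lemma rayint_scale (h : C -> C) (L : C) (r X : R) :
  (0 < r)%R -> (0 <= X)%R -> (forall t, (0 <= t)%R -> ccont h (RtoC t * L)) ->
  rayint h (RtoC r * L) X = rayint h L (r * X).
Proof.
intros Hr HX Hc; unfold rayint.
pose proof (Cint_comp_lin (fun x => h (RtoC x * L) * L) r 0 0 X Hr HX) as E.
rewrite Rmult_0_r, Rplus_0_r, Rplus_0_r in E; rewrite <- E.
- apply Cint_ext; [lra|]; intros t _; rewrite Rplus_0_r, RtoC_mult.
  replace (RtoC t * (RtoC r * L)) with (RtoC r * RtoC t * L) by ring; ring.
- intros t Ht; apply ray_pcont, Hc; lra.
Qed.

Lemma rot_eq (t : R) : rot t = (cos t, sin t).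
Proof.
unfold rot, Cexp, Cmult, RtoC, Ci; cbn [fst snd].
replace (t * 0 - 0 * 1)%R with 0%R by ring.
replace (t * 1 + 0 * 0)%R with t by ring; rewrite exp_0; f_equal; ring.
Qed.

(** The ray of angle [t] is traversed twice: with unit speed for the Laplace
    integral, and with unit horizontal speed, so that truncation happens on the
    vertical lines of [sector_residues]. *)
Lemma ray_limit (h : C -> C) (t M : R) :
  (0 < cos t)%R ->
  (forall s, (0 <= s)%R -> ccont h (RtoC s * rot t)) ->
  (forall s, (1 <= s)%R -> (Cmod (h (RtoC s * rot t)%C) <= M * exp (- s))%R) ->
  exists V : C,
  is_RInt_gen (V := C_R_NormedModule) (fun s => h (RtoC s * rot t) * rot t)
    (at_point 0%R) (Rbar_locally p_infty) V /\
  forall e, (0 < e)%R -> exists X0, forall X, (X0 <= X)%R ->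
  (Cmod (rayint h (1%R, tan t) X - V) <= e)%R.
Proof.
intros Ht Hc Hb.
assert (Er : rot t = RtoC (cos t) * (1%R, tan t)).
{ rewrite rot_eq; unfold Cmult, RtoC, tan; cbn [fst snd]; f_equal; field; lra. }
assert (Hm : Cmod (rot t) = 1%R).
{ unfold rot; rewrite Cmod_Cexp.
  replace (fst (RtoC t * Ci)) with 0%R by (simpl; ring); apply exp_0. }
destruct (improper (fun s => h (RtoC s * rot t) * rot t) M) as (V & HV & Hlim).
- intros s Hs; apply ray_pcont, Hc, Hs.
- intros s Hs; rewrite Cmod_mult, Hm, Rmult_1_r; auto.
- exists V; split; [exact HV|]; intros e He.
  destruct (Hlim e He) as (T0 & HT).
  exists (Rmax 0 (T0 * cos t)); intros X HX.
  pose proof (Rmax_l 0 (T0 * cos t)); pose proof (Rmax_r 0 (T0 * cos t)).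
  specialize (HT (X / cos t)%R).
  change (Cint (fun s => h (RtoC s * rot t) * rot t) 0 (X / cos t))
    with (rayint h (rot t) (X / cos t)) in HT.
  rewrite Er, rayint_scale in HT.
  + replace (cos t * (X / cos t))%R with X in HT by (field; lra).
    apply HT, Rle_div_r; lra.
  + exact Ht.
  + apply Rdiv_le_0_compat; lra.
  + intros s Hs.
    replace (RtoC s * (1%R, tan t)) with (RtoC (s / cos t) * rot t).
    * apply Hc, Rdiv_le_0_compat; lra.
    * rewrite Er, RtoC_div by lra; field; intros E; apply RtoC_inj in E; lra.
Qed.

Lemma jump_of_limits (h : C -> C) (a b : R) (Vm Vp S : C) (Sn : nat -> C) (M : R) :
  let L := (1%R, a) : C in let U := (1%R, b) : C in
  (forall e, (0 < e)%R -> exists X0, forall X, (X0 <= X)%R ->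
     (Cmod (rayint h L X - Vm) <= e)%R) ->
  (forall e, (0 < e)%R -> exists X0, forall X, (X0 <= X)%R ->
     (Cmod (rayint h U X - Vp) <= e)%R) ->
  (forall (N : nat) s, let X := (INR N + 1 / 2)%R in (0 <= s <= 1)%R ->
     ccont h (RtoC X * (L + RtoC s * (U - L))) /\
     (Cmod (h (RtoC X * (L + RtoC s * (U - L)))%C) <= M * exp (- (2 * X)))%R) ->
  (forall N : nat, let X := (INR N + 1 / 2)%R in
     rayint h L X + seg h (RtoC X * L) (RtoC X * U) - rayint h U X = Sn N) ->
  (forall e, (0 < e)%R -> exists N0, forall N, (N0 <= N)%nat ->
     (Cmod (Sn N - S) <= e)%R) ->
  Vm - Vp = S.
Proof.
intros L U Hm Hp Hseg HS HSl.
apply (Cmod_small_eq _ _ 4); intros e He.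
destruct (Hm e He) as (X1 & K1), (Hp e He) as (X2 & K2), (HSl e He) as (N3 & K3).
assert (HM : (0 <= M)%R).
{ destruct (Hseg 0%nat 0%R) as (_ & K); [lra|].
  match type of K with (?x <= _)%R => assert (0 <= x)%R by apply Cmod_ge_0 end.
  pose proof (exp_pos (- (2 * (INR 0 + 1 / 2)))); nra. }
set (c := (2 * M * Cmod (U - L) / e)%R).
assert (Hc : (0 <= c)%R).
{ apply Rdiv_le_0_compat; [|lra]; pose proof (Cmod_ge_0 (U - L)); nra. }
set (Z := (Rmax (Rmax X1 X2) c)).
destruct (INR_unbounded Z) as (N4 & HN4).
set (N := Nat.max N3 N4); set (X := (INR N + 1 / 2)%R).
assert (HN : (INR N4 <= INR N)%R) by (apply le_INR; unfold N; lia).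
assert (HX : (X1 <= X /\ X2 <= X /\ c <= X)%R).
{ assert (Rmax X1 X2 <= Z)%R by apply Rmax_l.
  assert (c <= Z)%R by apply Rmax_r.
  pose proof (Rmax_l X1 X2); pose proof (Rmax_r X1 X2).
  unfold X; lra. }
specialize (K1 X ltac:(lra)); specialize (K2 X ltac:(lra)).
specialize (K3 N ltac:(unfold N; lia)).
specialize (HS N); specialize (Hseg N); cbv zeta in HS, Hseg; fold X in HS, Hseg.
assert (HX0 : (0 <= X)%R) by (unfold X; pose proof (pos_INR N); lra).
assert (Es : forall s, RtoC X * L + RtoC s * (RtoC X * U - RtoC X * L)
  = RtoC X * (L + RtoC s * (U - L))) by (intros; ring).
assert (Bs : (Cmod (seg h (RtoC X * L) (RtoC X * U)) <= e)%R).
{ eapply Rle_trans; [apply (Cint_bound _ 0 1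
    (M * exp (- (2 * X)) * (X * Cmod (U - L)))%R)|].
  - lra.
  - intros s Hs.
    apply (ccont_pcont (fun z => h (RtoC X * L + z * (RtoC X * U - RtoC X * L))
      * (RtoC X * U - RtoC X * L))).
    apply ccont_mult; [|apply ccont_const].
    apply (ccont_comp (fun z => RtoC X * L + z * (RtoC X * U - RtoC X * L)) h).
    + ccont_arith.
    + rewrite Es; now apply Hseg.
  - intros s Hs; rewrite Cmod_mult, Es; apply Rmult_le_compat; try apply Cmod_ge_0.
    + now apply Hseg.
    + replace (RtoC X * U - RtoC X * L) with (RtoC X * (U - L)) by ring.
      rewrite Cmod_mult, Cmod_R, Rabs_pos_eq by exact HX0; apply Rle_refl.
  - (* The length of the segment grows like X, but X e^(-2X) <= 1 / X, and c <= X. *)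
    pose proof (exp_ineq1_le X) as E1.
    assert (E2 : (exp (- (2 * X)) * exp X * exp X = 1)%R).
    { rewrite <- !exp_plus, <- exp_0; f_equal; ring. }
    assert (E3 : (exp (- (2 * X)) * X * X <= 1)%R).
    { rewrite <- E2; pose proof (exp_pos (- (2 * X))).
      repeat apply Rmult_le_compat; try lra; try nra. }
    assert (Ec : (c * e = 2 * M * Cmod (U - L))%R) by (unfold c; field; lra).
    replace (2 * (M * exp (- (2 * X)) * (X * Cmod (U - L)) * (1 - 0)))%R
      with (exp (- (2 * X)) * X * (2 * M * Cmod (U - L)))%R by ring.
    rewrite <- Ec.
    assert (exp (- (2 * X)) * X * c <= 1)%R.
    { apply Rle_trans with (2 := E3); apply Rmult_le_compat_l; [|lra].
      apply Rmult_le_pos; [apply Rlt_le, exp_pos|exact HX0]. }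
    nra. }
set (RL := rayint h L X) in *; set (RU := rayint h U X) in *.
set (G := seg h (RtoC X * L) (RtoC X * U)) in *.
replace (Vm - Vp - S) with ((- (RL - Vm) + (RU - Vp)) + ((Sn N - S) + - G)).
2:{ rewrite <- HS; ring. }
pose proof (Cmod_triangle (- (RL - Vm) + (RU - Vp)) ((Sn N - S) + - G)).
pose proof (Cmod_triangle (- (RL - Vm)) (RU - Vp)).
pose proof (Cmod_triangle (Sn N - S) (- G)).
rewrite !Cmod_opp in *; lra.
Qed.

(** * Series of complex numbers *)

(** Sums of complex numbers are formed in the additive monoid of C; this restates
    an equation between such sums as an equation in the field C. *)
Ltac in_C := match goal with |- ?x = ?y => change (@eq C x y) end.

Definition has_sum (a : nat -> C) (l : C) : Prop :=
  forall e, (0 < e)%R -> exists N0 : nat, forall N, (N0 <= N)%nat ->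
  (Cmod (sum_n a N - l) < e)%R.

Lemma sum_n_S (a : nat -> C) (n : nat) : sum_n a (S n) = sum_n a n + a (S n).
Proof. rewrite sum_Sn; reflexivity. Qed.

Lemma Cmult_sum_n (c : C) (a : nat -> C) (n : nat) :
  c * sum_n a n = sum_n (fun k => c * a k) n.
Proof.
induction n as [|n IH]; [now rewrite !sum_O|].
rewrite !sum_n_S, <- IH; ring.
Qed.

Lemma sum_n_fst_snd (a : nat -> C) (n : nat) :
  sum_n a n = (sum_n (fun k => fst (a k)) n, sum_n (fun k => snd (a k)) n).
Proof.
induction n as [|n IH]; [rewrite !sum_O; apply surjective_pairing|].
rewrite sum_n_S, IH, !sum_Sn; reflexivity.
Qed.

Lemma is_series_eps (a : nat -> R) (l : R) :
  is_series a l <-> forall e, (0 < e)%R -> exists N0 : nat, forall N, (N0 <= N)%nat ->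
  (Rabs (sum_n a N - l) < e)%R.
Proof.
split.
- intros H e He.
  destruct (H _ (locally_ball (l : R_UniformSpace) (mkposreal e He))) as (N0 & HN).
  exists N0; intros N HNN; exact (HN N HNN).
- intros H P (e & HP); destruct (H e (cond_pos e)) as (N0 & HN).
  exists N0; intros N HNN; apply HP; exact (HN N HNN).
Qed.

Lemma has_sum_components (a : nat -> C) (l : C) :
  has_sum a l <->
  is_series (fun n => fst (a n)) (fst l) /\ is_series (fun n => snd (a n)) (snd l).
Proof.
split.
- intros H; split; apply is_series_eps; intros e He; destruct (H e He) as (N0 & HN);
    exists N0; intros N HNN; specialize (HN N HNN); rewrite sum_n_fst_snd in HN.
  + eapply Rle_lt_trans; [|exact HN]; eapply Rle_trans; [|apply abs_fst_le].
    apply Req_le; reflexivity.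
  + eapply Rle_lt_trans; [|exact HN]; eapply Rle_trans; [|apply abs_snd_le].
    apply Req_le; reflexivity.
- intros (H1 & H2) e He.
  destruct (proj1 (is_series_eps _ _) H1 (e / 2)%R) as (N1 & K1); [lra|].
  destruct (proj1 (is_series_eps _ _) H2 (e / 2)%R) as (N2 & K2); [lra|].
  exists (Nat.max N1 N2); intros N HN.
  eapply Rle_lt_trans; [apply Cmod_le_abs|].
  specialize (K1 N ltac:(lia)); specialize (K2 N ltac:(lia)).
  rewrite sum_n_fst_snd; unfold Cminus, Cplus, Copp; cbn [fst snd].
  unfold Rminus in *; lra.
Qed.

Lemma has_sum_is_series (a : nat -> C) (l : C) :
  has_sum a l -> is_series (K := C_AbsRing) (V := C_NormedModule) a l.
Proof.
intros H P HP; apply locally_Cmod in HP; destruct HP as (d & Hd & HP).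
destruct (H d Hd) as (N0 & HN); exists N0; intros N HNN; apply HP, HN, HNN.
Qed.

Lemma has_sum_unique (a : nat -> C) (l m : C) : has_sum a l -> has_sum a m -> l = m.
Proof.
intros Hl Hm; apply (Cmod_small_eq _ _ 2); intros e He.
destruct (Hl e He) as (N1 & K1), (Hm e He) as (N2 & K2).
specialize (K1 (Nat.max N1 N2) ltac:(lia)); specialize (K2 (Nat.max N1 N2) ltac:(lia)).
set (s := sum_n a (Nat.max N1 N2)) in *.
replace (l - m) with (- (s - l) + (s - m)) by ring.
pose proof (Cmod_triangle (- (s - l)) (s - m)) as T; rewrite Cmod_opp in T; lra.
Qed.

Lemma has_sum_ext (a b : nat -> C) (l : C) :
  (forall n, a n = b n) -> has_sum a l -> has_sum b l.
Proof. intros E; replace b with a; [auto|]; now apply functional_extensionality. Qed.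

Lemma ex_series_components (a : nat -> C) :
  ex_series (fun n => Cmod (a n)) ->
  ex_series (fun n => Rabs (fst (a n))) /\ ex_series (fun n => Rabs (snd (a n))).
Proof.
intros H; split; apply (ex_series_le (V := R_CompleteNormedModule))
  with (b := fun n => Cmod (a n)); try exact H; intros n;
  unfold norm; simpl; unfold abs; simpl; rewrite Rabs_Rabsolu;
  [apply abs_fst_le|apply abs_snd_le].
Qed.

Lemma has_sum_ex (a : nat -> C) :
  ex_series (fun n => Cmod (a n)) -> exists l, has_sum a l.
Proof.
intros H; destruct (ex_series_components a H) as (H1 & H2).
apply ex_series_Rabs in H1; apply ex_series_Rabs in H2.
destruct H1 as (l1 & H1), H2 as (l2 & H2).
exists (l1, l2); now apply has_sum_components.
Qed.

(** Cauchy products: expand real and imaginary parts and use the real theorem four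
    times. *)
Lemma has_sum_mult (a b : nat -> C) (la lb : C) :
  has_sum a la -> has_sum b lb ->
  ex_series (fun n => Cmod (a n)) -> ex_series (fun n => Cmod (b n)) ->
  has_sum (fun n => sum_n (fun k => a k * b (n - k)%nat) n) (la * lb).
Proof.
intros Ha Hb Aa Ab.
apply has_sum_components in Ha; destruct Ha as (Ha1 & Ha2).
apply has_sum_components in Hb; destruct Hb as (Hb1 & Hb2).
destruct (ex_series_components a Aa) as (Aa1 & Aa2).
destruct (ex_series_components b Ab) as (Ab1 & Ab2).
assert (K := fun x y lx ly Hx Hy Ax Ay => is_series_mult x y lx ly Hx Hy Ax Ay).
assert (S : forall f n, sum_n f n = sum_f_R0 f n) by (intros; apply sum_n_Reals).
apply has_sum_components; split; unfold Cmult; cbn [fst snd].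
- eapply is_series_ext; [|apply (is_series_minus (V := R_NormedModule) _ _ _ _
    (K _ _ _ _ Ha1 Hb1 Aa1 Ab1) (K _ _ _ _ Ha2 Hb2 Aa2 Ab2))].
  intros n; rewrite sum_n_fst_snd; cbn [fst snd]; rewrite S.
  unfold minus, plus, opp; simpl.
  match goal with |- ?x = ?y => change (@eq R x y) end.
  rewrite minus_sum; reflexivity.
- eapply is_series_ext; [|apply (is_series_plus (V := R_NormedModule) _ _ _ _
    (K _ _ _ _ Ha1 Hb2 Aa1 Ab2) (K _ _ _ _ Ha2 Hb1 Aa2 Ab1))].
  intros n; rewrite sum_n_fst_snd; cbn [fst snd]; rewrite S.
  unfold plus; simpl.
  match goal with |- ?x = ?y => change (@eq R x y) end.
  rewrite plus_sum; reflexivity.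
Qed.

Lemma has_sum_shift (a : nat -> C) (l : C) :
  has_sum a l -> has_sum (fun n => a (S n)) (l - a O).
Proof.
intros H e He; destruct (H e He) as (N0 & HN); exists N0; intros N HNN.
specialize (HN (S N) ltac:(lia)).
replace (sum_n (fun n => a (S n)) N - (l - a O)) with (sum_n a (S N) - l); [exact HN|].
replace (sum_n a (S N)) with (a O + sum_n (fun n => a (S n)) N); [ring|].
clear; induction N as [|N IH]; [rewrite sum_n_S, !sum_O; reflexivity|].
rewrite (sum_n_S a), <- IH, sum_n_S; ring.
Qed.

Lemma has_sum_scal (c : C) (a : nat -> C) (l : C) :
  has_sum a l -> has_sum (fun n => c * a n) (c * l).
Proof.
intros H e He.
assert (Hc : (0 < Cmod c + 1)%R) by (pose proof (Cmod_ge_0 c); lra).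
destruct (H (e / (Cmod c + 1))%R) as (N0 & HN); [apply Rdiv_lt_0_compat; lra|].
exists N0; intros N HNN; specialize (HN N HNN).
rewrite <- Cmult_sum_n.
replace (c * sum_n a N - c * l) with (c * (sum_n a N - l)) by ring.
rewrite Cmod_mult; apply (Rlt_div_r _ _ (Cmod c + 1)) in HN; [|lra].
pose proof (Cmod_ge_0 (sum_n a N - l)); nra.
Qed.

(** With ratio at most 1/2 the partial sums satisfy |s_n| <= 2 M - M q^n. *)
Lemma has_sum_bound (a : nat -> C) (l : C) (M q : R) :
  (0 <= M)%R -> (0 <= q <= 1 / 2)%R -> (forall n, (Cmod (a n) <= M * q ^ n)%R) ->
  has_sum a l -> (Cmod l <= 2 * M)%R.
Proof.
intros HM Hq Hb H.
assert (Hs : forall n, (Cmod (sum_n a n) <= 2 * M - M * q ^ n)%R).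
{ induction n as [|n IH].
  - rewrite sum_O; specialize (Hb O); simpl in *; lra.
  - rewrite sum_n_S; eapply Rle_trans; [apply Cmod_triangle|].
    specialize (Hb (S n)); simpl in *.
    assert (0 <= q ^ n)%R by (apply pow_le; lra).
    assert (0 <= M * q ^ n)%R by nra.
    assert (M * (q * q ^ n) <= M * q ^ n / 2)%R by nra.
    lra. }
apply le_epsilon; intros e He; destruct (H e He) as (N0 & HN).
specialize (HN N0 (Nat.le_refl _)); specialize (Hs N0).
assert (0 <= M * q ^ N0)%R by (apply Rmult_le_pos; [lra|apply pow_le; lra]).
replace l with (sum_n a N0 + - (sum_n a N0 - l)) by ring.
eapply Rle_trans; [apply Cmod_triangle|]; rewrite Cmod_opp; lra.
Qed.

(** * The exponential series *)

Lemma RtoC_fact_neq_0 (n : nat) : RtoC (INR (fact n)) <> 0.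
Proof. apply RtoC_neq_0, INR_fact_neq_0. Qed.

Lemma RtoC_S_neq_0 (n : nat) : RtoC (INR (S n)) <> 0.
Proof. apply RtoC_neq_0, not_0_INR; lia. Qed.

Lemma RtoC_fact_S (n : nat) :
  RtoC (INR (fact (S n))) = RtoC (INR (S n)) * RtoC (INR (fact n)).
Proof. now rewrite fact_simpl, mult_INR, RtoC_mult. Qed.

Definition exp_sum (N : nat) (w : C) : C :=
  sum_n (fun n => Cpow w n / RtoC (INR (fact n))) N.

Lemma cderiv_exp_sum (N : nat) (w : C) :
  cderiv (exp_sum N) w (exp_sum N w - Cpow w N / RtoC (INR (fact N))).
Proof.
induction N as [|N IH].
- apply cderiv_ext_loc with (fun _ => 1).
  + exists 1%R; split; [lra|]; intros; unfold exp_sum; rewrite sum_O; simpl; field.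
  + eapply cderiv_eq; [apply cderiv_const|].
    unfold exp_sum; rewrite sum_O; simpl; field.
- apply cderiv_ext_loc with (fun v => exp_sum N v
    + / RtoC (INR (fact (S N))) * Cpow v (S N)).
  + exists 1%R; split; [lra|]; intros; unfold exp_sum; rewrite sum_n_S.
    unfold Cdiv; ring.
  + eapply cderiv_eq.
    * apply cderiv_plus; [exact IH|].
      apply cderiv_mult; [apply cderiv_const|apply cderiv_monomial].
    * unfold exp_sum; rewrite sum_n_S, RtoC_fact_S; cbv beta.
      field; split; [apply RtoC_fact_neq_0|apply RtoC_S_neq_0].
Qed.

Lemma ex_series_exp (x : R) : ex_series (fun n => (x ^ n / INR (fact n))%R).
Proof.
exists (exp x); apply is_series_ext with (2 := is_exp_Reals x); intros n.
rewrite pow_n_pow; unfold scal; simpl; unfold mult; simpl; reflexivity.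
Qed.

Lemma exp_terms_to_0 (x : R) : forall e, (0 < e)%R -> exists N0 : nat,
  forall N, (N0 <= N)%nat -> (Rabs (x ^ N / INR (fact N)) < e)%R.
Proof.
intros e He; pose proof (ex_series_lim_0 _ (ex_series_exp x)) as H.
apply is_lim_seq_spec in H; destruct (H (mkposreal e He)) as (N0 & HN).
exists N0; intros N HNN; specialize (HN N HNN); simpl in HN.
now rewrite Rminus_0_r in HN.
Qed.

(** Let T be the Taylor polynomial of order [N]. All terms but one cancel in the
    derivative of t -> e^(-t w) T(t w), namely
    - w (t w)^N / N! e^(-t w) is left. Integrating from 0 to 1 shows that e^(-w) T(w)
    tends to 1. *)
Lemma Cexp_series (w : C) : has_sum (fun n => Cpow w n / RtoC (INR (fact n))) (Cexp w).
Proof.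
intros e He; set (a := Cmod w).
assert (Ha : (0 <= a)%R) by apply Cmod_ge_0.
set (A := (exp a * (2 * (exp a * a)))%R).
assert (HA : (0 <= A)%R).
{ pose proof (exp_pos a); unfold A; apply Rmult_le_pos; nra. }
destruct (exp_terms_to_0 a (e / (A + 1))%R) as (N0 & HN0);
  [apply Rdiv_lt_0_compat; lra|].
exists N0; intros N HN; specialize (HN0 N HN).
change (Cmod (exp_sum N w - Cexp w) < e)%R.
set (c := - w * Cpow w N / RtoC (INR (fact N))).
assert (Hd : forall t : R, cderiv (fun z => Cexp (z * - w) * exp_sum N (z * w)) (RtoC t)
  (Cexp (RtoC t * - w) * (c * Cpow (RtoC t) N))).
{ intros t; eapply cderiv_eq.
  - apply cderiv_mult.
    + apply (cderiv_comp (fun z => z * - w) Cexp); [|apply cderiv_Cexp].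
      apply cderiv_mult; [apply cderiv_id|apply cderiv_const].
    + apply (cderiv_comp (fun z => z * w) (exp_sum N)); [|apply cderiv_exp_sum].
      apply cderiv_mult; [apply cderiv_id|apply cderiv_const].
  - cbv beta; unfold c; rewrite Cpow_mult_l; field; apply RtoC_fact_neq_0. }
assert (Hpc : forall t : R, pcont (fun t => Cexp (RtoC t * - w) * (c * Cpow (RtoC t) N)) t).
{ intros t; apply (ccont_pcont (fun z => Cexp (z * - w) * (c * Cpow z N))).
  apply ccont_mult; [|apply ccont_monomial].
  apply (ccont_comp (fun z => z * - w) Cexp); [|eapply cderiv_ccont, cderiv_Cexp].
  ccont_arith. }
assert (E : Cint (fun t => Cexp (RtoC t * - w) * (c * Cpow (RtoC t) N)) 0 1
  = Cexp (- w) * exp_sum N w - 1).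
{ rewrite (Cint_derive (fun t => Cexp (RtoC t * - w) * exp_sum N (RtoC t * w))).
  - rewrite !Cmult_1_l, !Cmult_0_l, Cexp_0, Cmult_1_l; f_equal; f_equal.
    unfold exp_sum; clear; induction N as [|N IH]; [rewrite sum_O; simpl; field|].
    rewrite sum_n_S, IH, Cpow_S; field; apply RtoC_fact_neq_0.
  - lra.
  - intros; apply Hpc.
  - intros t _; apply (cderiv_real (fun z => Cexp (z * - w) * exp_sum N (z * w))), Hd. }
replace (exp_sum N w - Cexp w) with (Cexp w * (Cexp (- w) * exp_sum N w - 1)).
2:{ rewrite Cexp_opp; field; apply Cexp_neq_0. }
rewrite <- E, Cmod_mult, Cmod_Cexp.
assert (Hf : (0 < INR (fact N))%R) by (apply lt_0_INR, lt_O_fact).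
set (x := (a ^ N / INR (fact N))%R) in *.
assert (Hx : (0 <= x)%R) by (apply Rdiv_le_0_compat; [now apply pow_le|lra]).
assert (B : (Cmod (Cint (fun t => Cexp (RtoC t * - w) * (c * Cpow (RtoC t) N))%C 0 1)
  <= 2 * (exp a * (a * x) * (1 - 0)))%R).
{ apply Cint_bound; [lra|intros; apply Hpc|].
  intros t Ht; rewrite !Cmod_mult, Cmod_Cexp, Cmod_pow, Cmod_R, (Rabs_pos_eq t) by lra.
  assert (E1 : (exp (fst (RtoC t * - w)%C) <= exp a)%R).
  { apply exp_le_mono; eapply Rle_trans; [apply Rle_abs|].
    eapply Rle_trans; [apply abs_fst_le|].
    rewrite Cmod_mult, Cmod_opp, Cmod_R, Rabs_pos_eq by lra; fold a; nra. }
  assert (E2 : (Cmod c = a * x)%R).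
  { unfold c; rewrite Cmod_div, Cmod_mult, Cmod_opp, Cmod_pow, Cmod_R, Rabs_pos_eq
      by (try lra; apply RtoC_fact_neq_0).
    fold a; unfold x; field; lra. }
  assert (E3 : (0 <= t ^ N <= 1)%R).
  { split; [apply pow_le; lra|]; rewrite <- (pow1 N); apply pow_incr; lra. }
  rewrite E2; apply Rmult_le_compat; [apply Rlt_le, exp_pos| |exact E1|].
  - apply Rmult_le_pos; nra.
  - assert (0 <= a * x)%R by nra; nra. }
assert (E1 : (exp (fst w) <= exp a)%R).
{ apply exp_le_mono; eapply Rle_trans; [apply Rle_abs|apply abs_fst_le]. }
rewrite Rabs_pos_eq in HN0 by exact Hx.
apply (Rlt_div_r _ _ (A + 1)) in HN0; [|lra].
eapply Rle_lt_trans; [apply Rmult_le_compat|].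
- apply Rlt_le, exp_pos.
- apply Cmod_ge_0.
- exact E1.
- exact B.
- replace (exp a * (2 * (exp a * (a * x) * (1 - 0))))%R with (A * x)%R
    by (unfold A; ring).
  nra.
Qed.

(** * The generating function of the Bernoulli polynomials *)

(** B_n(u) / n!, the coefficients of the exponential generating function. *)
Definition bern (u : C) (n : nat) : C := bernoulli n u / RtoC (INR (fact n)).

(** The defining recursion of the Bernoulli polynomials, divided by (n+1)!: the
    coefficients of (sum B_n t^n / n!) (e^t - 1) / t = e^(u t). *)
Lemma bern_convolution (u : C) (n : nat) :
  sum_n (fun j => bern u j * / RtoC (INR (fact (S (n - j))))) n
  = Cpow u n / RtoC (INR (fact n)).
Proof.
pose proof (bernoulli_rec u n) as H.
transitivity (/ RtoC (INR (fact (S n)))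
  * sum_n (fun j => RtoC (Binomial.C (S n) j) * bernoulli j u) n).
- rewrite Cmult_sum_n; apply sum_n_ext_loc; intros j Hj.
  unfold bern, Binomial.C; rewrite RtoC_div, RtoC_mult.
  2:{ apply Rmult_integral_contrapositive; split; apply INR_fact_neq_0. }
  replace (S n - j)%nat with (S (n - j)) by lia.
  in_C; field; repeat split; apply RtoC_fact_neq_0.
- rewrite H, RtoC_fact_S; in_C; field; split; [apply RtoC_fact_neq_0|apply RtoC_S_neq_0].
Qed.

Lemma Cmod_sum_n_le (a : nat -> C) (b : nat -> R) (n : nat) :
  (forall k, (k <= n)%nat -> (Cmod (a k) <= b k)%R) ->
  (Cmod (sum_n a n) <= sum_n b n)%R.
Proof.
induction n as [|n IH]; intros H; [rewrite !sum_O; apply H; lia|].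
rewrite sum_n_S, sum_Sn; eapply Rle_trans; [apply Cmod_triangle|].
apply Rplus_le_compat; [apply IH; intros; apply H; lia|apply H; lia].
Qed.

(** A geometric bound is all that convergence near 0 needs. In the recursion
    for n >= 1 the factorials in the convolution are at least 2 and K >= 2, so the lower terms
    contribute at most K^n / 2; the right-hand side contributes at most
    |u|^n <= K^n / 2. *)
Lemma bern_bound (u : C) (n : nat) : (Cmod (bern u n) <= (2 * Cmod u + 2) ^ n)%R.
Proof.
set (K := (2 * Cmod u + 2)%R).
pose proof (Cmod_ge_0 u) as Hu.
assert (HK : (2 <= K)%R) by (unfold K; lra).
induction n as [n IH] using (well_founded_induction lt_wf).
pose proof (bern_convolution u n) as E.
destruct n as [|m].
- rewrite sum_O in E; simpl in E.
  replace (bern u 0) with (bern u 0 * / RtoC 1) by field; rewrite E.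
  unfold Cdiv; rewrite Cmult_1_l, <- RtoC_inv, Cmod_R by lra.
  rewrite Rinv_1, Rabs_R1; simpl; lra.
- rewrite sum_n_S in E; replace (S m - S m)%nat with O in E by lia.
  set (s := sum_n _ m) in E.
  assert (Eb : bern u (S m) = Cpow u (S m) / RtoC (INR (fact (S m))) + - s).
  { rewrite <- E; simpl fact; simpl INR; field. }
  rewrite Eb; eapply Rle_trans; [apply Cmod_triangle|]; rewrite Cmod_opp.
  assert (Hf : forall k, (1 <= INR (fact k))%R).
  { intros k; change 1%R with (INR 1); apply le_INR; pose proof (lt_O_fact k); lia. }
  assert (Hp : (0 < K ^ m)%R) by (apply pow_lt; lra).
  assert (B1 : (Cmod (Cpow u (S m) / RtoC (INR (fact (S m)))) <= K ^ S m / 2)%R).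
  { rewrite Cmod_div, Cmod_pow, Cmod_R, Rabs_pos_eq
      by (try apply RtoC_fact_neq_0; specialize (Hf (S m)); lra).
    specialize (Hf (S m)); apply Rle_div_l; [lra|].
    assert (Cmod u ^ m <= K ^ m)%R by (apply pow_incr; unfold K; lra).
    assert (0 <= Cmod u ^ m)%R by (now apply pow_le).
    assert (Cmod u ^ S m <= K ^ S m / 2)%R.
    { simpl; assert (Cmod u * Cmod u ^ m <= (K / 2) * K ^ m)%R; [|lra].
      apply Rmult_le_compat; try lra; unfold K; lra. }
    assert (0 <= K ^ S m / 2)%R by (simpl; nra).
    nra. }
  assert (B2 : (Cmod s <= K ^ S m / 2)%R).
  { eapply Rle_trans; [apply (Cmod_sum_n_le _ (fun j => (K ^ j / 2)%R))|].
    - intros k Hk; rewrite Cmod_mult, Cmod_inv by apply RtoC_fact_neq_0.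
      rewrite Cmod_R, Rabs_pos_eq by (specialize (Hf (S (S m - k))); lra).
      apply Rmult_le_compat; [apply Cmod_ge_0| | |].
      + apply Rlt_le, Rinv_0_lt_compat; specialize (Hf (S (S m - k))); lra.
      + apply IH; lia.
      + apply Rinv_le_contravar; [lra|].
        change 2%R with (INR 2); apply le_INR.
        replace (S (S m - k)) with (S (S (m - k))) by lia.
        rewrite fact_simpl; pose proof (lt_O_fact (S (m - k))); nia.
    - clear - HK; induction m as [|m IH]; [rewrite sum_O; simpl; lra|].
      rewrite sum_Sn; unfold plus; simpl; simpl in IH.
      assert (0 < K ^ m)%R by (apply pow_lt; lra).
      assert (0 < K * K ^ m)%R by nra.
      assert (K * K ^ m * 2 <= K * (K * K ^ m))%R by nra.
      lra. }
  lra.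
Qed.

Lemma bern_0_1 (u : C) : bern u 0 = 1 /\ bern u 1 = u - / 2.
Proof.
assert (E0 := bern_convolution u 0); assert (E1 := bern_convolution u 1).
rewrite sum_n_S, sum_O in E1; rewrite sum_O in E0; simpl in E0, E1.
assert (B0 : bern u 0 = 1).
{ replace (bern u 0) with (bern u 0 * / 1) by field; rewrite E0; field. }
split; [exact B0|]; rewrite B0 in E1.
replace (bern u 1) with
  (1 * / RtoC (1 + 1) + bern u 1 * / 1 - 1 * / RtoC (1 + 1)) by
  (field; apply RtoC_neq_0; lra).
rewrite E1; replace (1 + 1)%R with 2%R by ring; field.
Qed.

Lemma ex_series_geom_bound (a : nat -> C) (M q : R) :
  (0 <= q < 1)%R -> (forall n, (Cmod (a n) <= M * q ^ n)%R) ->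
  ex_series (fun n => Cmod (a n)).
Proof.
intros Hq H; apply (ex_series_le (V := R_CompleteNormedModule))
  with (b := fun n => (M * q ^ n)%R).
- intros n; unfold norm; simpl; unfold abs; simpl.
  rewrite Rabs_pos_eq by apply Cmod_ge_0; apply H.
- apply (ex_series_scal (V := R_NormedModule) M (fun n => (q ^ n)%R)), ex_series_geom.
  rewrite Rabs_pos_eq; lra.
Qed.

Lemma bernoulli_generating (u s h : C) :
  s <> 0 -> ((2 * Cmod u + 2) * Cmod s < 1)%R ->
  has_sum (fun n => bern u n * Cpow s n) h ->
  h * (Cexp s - 1) = s * Cexp (u * s).
Proof.
intros Hs0 Hs Hh.
set (K := (2 * Cmod u + 2)%R) in *.
pose proof (Cmod_ge_0 u) as Hu; pose proof (Cmod_ge_0 s) as Hs1.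
assert (HE : has_sum (fun n => Cpow s n / RtoC (INR (fact (S n)))) ((Cexp s - 1) / s)).
{ pose proof (has_sum_scal (/ s) _ _ (has_sum_shift _ _ (Cexp_series s))) as H.
  replace ((Cexp s - 1) / s)
    with (/ s * (Cexp s - Cpow s 0 / RtoC (INR (fact 0)))) by (simpl; field; exact Hs0).
  revert H; apply has_sum_ext; intros n; rewrite Cpow_S; field.
  split; [apply RtoC_fact_neq_0|exact Hs0]. }
assert (P : has_sum (fun n => Cpow (u * s) n / RtoC (INR (fact n)))
  (h * ((Cexp s - 1) / s))).
{ eapply has_sum_ext; [|apply (has_sum_mult _ _ _ _ Hh HE)].
  - intros n; rewrite Cpow_mult_l.
    transitivity (Cpow s n * (Cpow u n / RtoC (INR (fact n)))).
    2:{ field; apply RtoC_fact_neq_0. }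
    rewrite <- bern_convolution.
    rewrite Cmult_sum_n; apply sum_n_ext_loc; intros j Hj.
    replace (Cpow s n) with (Cpow s j * Cpow s (n - j)).
    2:{ rewrite <- Cpow_add_r; f_equal; lia. }
    in_C; field; apply RtoC_fact_neq_0.
  - apply (ex_series_geom_bound _ 1 (K * Cmod s)%R).
    { split; [apply Rmult_le_pos; unfold K; lra|exact Hs]. }
    intros n; rewrite Cmod_mult, Cmod_pow, Rpow_mult_distr, Rmult_1_l.
    apply Rmult_le_compat_r; [now apply pow_le|apply bern_bound].
  - apply (ex_series_le (V := R_CompleteNormedModule))
      with (b := fun n => (Cmod s ^ n / INR (fact n))%R); [|apply ex_series_exp].
    intros n; unfold norm; simpl; unfold abs; simpl.
    rewrite Rabs_pos_eq by apply Cmod_ge_0.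
    change (fact n + n * fact n)%nat with (fact (S n)).
    assert (Hf : (0 < INR (fact n))%R) by (apply lt_0_INR, lt_O_fact).
    assert (Hf' : (INR (fact n) <= INR (fact (S n)))%R).
    { apply le_INR; rewrite fact_simpl; nia. }
    rewrite Cmod_div, Cmod_pow, Cmod_R, Rabs_pos_eq
      by (try apply RtoC_fact_neq_0; lra).
    apply Rmult_le_compat_l; [now apply pow_le|apply Rinv_le_contravar; lra]. }
pose proof (has_sum_unique _ _ _ P (Cexp_series (u * s))) as E.
rewrite <- E; field; exact Hs0.
Qed.

(** * Derivatives of the Bernoulli polynomials *)

Lemma cderiv_sum_n (f : nat -> C -> C) (df : nat -> C) (w : C) (n : nat) :
  (forall k, (k <= n)%nat -> cderiv (f k) w (df k)) ->
  cderiv (fun v => sum_n (fun k => f k v) n) w (sum_n df n).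
Proof.
induction n as [|n IH]; intros H.
- rewrite sum_O; apply cderiv_ext_loc with (f O); [|apply H; lia].
  exists 1%R; split; [lra|]; intros; now rewrite sum_O.
- rewrite sum_n_S; apply cderiv_ext_loc with (fun v => sum_n (fun k => f k v) n + f (S n) v).
  + exists 1%R; split; [lra|]; intros; now rewrite sum_n_S.
  + apply cderiv_plus; [apply IH; intros|]; apply H; lia.
Qed.

Lemma sum_n_head (a : nat -> C) (n : nat) :
  sum_n a (S n) = a O + sum_n (fun k => a (S k)) n.
Proof.
induction n as [|n IH]; [rewrite sum_n_S, !sum_O; reflexivity|].
rewrite sum_n_S, IH, sum_n_S; in_C; ring.
Qed.

(** B_n' = n B_(n-1), by strong induction: the derivative of the recursion at
    n + 1 is the recursion at n. *)
Lemma cderiv_bern (u : C) (n : nat) :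
  cderiv (fun v => bern v n) u (match n with O => 0 | S m => bern u m end).
Proof.
induction n as [n IH] using (well_founded_induction lt_wf).
destruct n as [|m].
- apply cderiv_ext_loc with (fun _ => 1); [|apply cderiv_const].
  exists 1%R; split; [lra|]; intros v _; now rewrite (proj1 (bern_0_1 v)).
- set (dbeta := fun j => match j return C with O => 0 | S i => bern u i end).
  apply cderiv_ext_loc with (fun v => / RtoC (INR (fact (S m))) * Cpow v (S m)
    + - (1) * sum_n (fun j => bern v j * / RtoC (INR (fact (S (S m - j))))) m).
  + exists 1%R; split; [lra|]; intros v _.
    pose proof (bern_convolution v (S m)) as E; rewrite sum_n_S in E.
    replace (S m - S m)%nat with O in E by lia.
    transitivity (Cpow v (S m) / RtoC (INR (fact (S m)))
      - sum_n (fun j => bern v j * / RtoC (INR (fact (S (S m - j))))) m);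
      [field; apply RtoC_fact_neq_0|].
    rewrite <- E; change (INR (fact 1)) with 1%R; field.
  + eapply cderiv_eq.
    * apply cderiv_plus; apply cderiv_mult; try apply cderiv_const.
      -- apply cderiv_monomial.
      -- apply (cderiv_sum_n (fun j v => bern v j * / RtoC (INR (fact (S (S m - j)))))
           (fun j => dbeta j * / RtoC (INR (fact (S (S m - j)))))).
         intros j Hj; eapply cderiv_eq.
         ++ apply cderiv_mult; [apply IH; lia|apply cderiv_const].
         ++ unfold dbeta; cbv beta; ring.
    * cbv beta.
      assert (E : sum_n (fun j => dbeta j * / RtoC (INR (fact (S (S m - j))))) m
        = Cpow u m / RtoC (INR (fact m)) - bern u m).
      { rewrite <- bern_convolution; destruct m as [|k].
        - rewrite !sum_O; unfold dbeta; simpl; field.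
          apply RtoC_neq_0; lra.
        - rewrite sum_n_head, sum_n_S; unfold dbeta at 1.
          replace (S k - S k)%nat with O by lia.
          rewrite (sum_n_ext (fun k0 => dbeta (S k0) * / RtoC (INR (fact (S (S (S k) - S k0)))))
            (fun j => bern u j * / RtoC (INR (fact (S (S k - j)))))) by reflexivity.
          change (INR (fact 1)) with 1%R.
          replace (/ RtoC 1) with (RtoC 1) by field; in_C; ring. }
      rewrite E, RtoC_fact_S; field; split; [apply RtoC_fact_neq_0|apply RtoC_S_neq_0].
Qed.

(** The argument (pi i - theta) / (2 pi i) of the Bernoulli polynomials in gdot. *)
Definition bern_arg (th : C) : C := (RtoC PI * Ci - th) / twopii.

Lemma gdot_coef_S (n : nat) (p : point) :
  gdot_coef (S n) p = Cpow (- (twopii / p cz)) (S n)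
    * (RtoC (INR (fact n)) * bern (bern_arg (p cth)) (S (S n))).
Proof.
unfold gdot_coef, bern, bern_arg.
replace (S n + 1)%nat with (S (S n)) by lia.
rewrite !RtoC_fact_S.
replace (- (twopii / p cz)) with (RtoC (-1) * (twopii / p cz))
  by (change (RtoC (-1)) with (RtoC (- (1))%R); rewrite RtoC_opp; ring).
rewrite Cpow_mult_l; field.
repeat split; auto using RtoC_fact_neq_0, RtoC_S_neq_0.
Qed.

Lemma cderiv_gdot_th (n : nat) (p : point) :
  cderiv (fun w => gdot_coef (S n) (upd p cth w)) (p cth)
    (Cpow (- (twopii / p cz)) (S n)
     * (RtoC (INR (fact n)) * (bern (bern_arg (p cth)) (S n) * - / twopii))).
Proof.
apply cderiv_ext_loc with (fun w => Cpow (- (twopii / p cz)) (S n)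
    * (RtoC (INR (fact n)) * bern (bern_arg w) (S (S n)))).
- exists 1%R; split; [lra|]; intros w _; rewrite gdot_coef_S; reflexivity.
- eapply cderiv_eq.
  + apply cderiv_mult; [apply cderiv_const|]; apply cderiv_mult; [apply cderiv_const|].
    apply (cderiv_comp bern_arg (fun v => bern v (S (S n)))); [|apply cderiv_bern].
    apply cderiv_ext_loc with (fun w => RtoC PI * Ci / twopii + w * - / twopii).
    * exists 1%R; split; [lra|]; intros; unfold bern_arg; field; apply twopii_neq_0.
    * apply cderiv_affine.
  + cbv beta; ring.
Qed.

Lemma cderiv_gdot_z (n : nat) (p : point) : p cz <> 0 ->
  cderiv (fun w => gdot_coef (S n) (upd p cz w)) (p cz)
    (- (RtoC (INR (S n)) / p cz) * Cpow (- (twopii / p cz)) (S n)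
     * (RtoC (INR (fact n)) * bern (bern_arg (p cth)) (S (S n)))).
Proof.
intros Hz.
apply cderiv_ext_loc with (fun w => Cpow (- twopii * / w) (S n)
    * (RtoC (INR (fact n)) * bern (bern_arg (p cth)) (S (S n)))).
- exists 1%R; split; [lra|]; intros w _; rewrite gdot_coef_S; simpl upd.
  f_equal; f_equal; change (upd p cz w cz) with w; unfold Cdiv; ring.
- eapply cderiv_eq.
  + apply cderiv_mult; [|apply cderiv_const].
    apply (cderiv_comp (fun w => - twopii * / w) (fun v => Cpow v (S n)));
      [|apply cderiv_monomial].
    apply cderiv_mult; [apply cderiv_const|].
    apply (cderiv_inv (fun w => w)); [apply cderiv_id|exact Hz].
  + cbv beta.
    replace (- twopii * / p cz) with (- (twopii / p cz)) by (unfold Cdiv; ring).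
    rewrite Cpow_S; field; exact Hz.
Qed.

(** * The formal gauge transformation *)

Lemma partial_const (i : coord) (f : fct) (p : point) :
  (forall w, f (upd p i w) = f (upd p i (p i))) -> partial i f p = 0.
Proof.
intros H; unfold partial; apply cderiv_C_derive.
replace (fun w => f (upd p i w)) with (fun _ : C => f (upd p i (p i)));
  [apply cderiv_const|].
now apply functional_extensionality.
Qed.

Lemma gdot_of_nat (j : nat) : (1 <= j)%nat ->
  gdot (Z.of_nat j) = vscal (gdot_coef j) (dd cthc).
Proof.
intros Hj; unfold gdot; rewrite (proj2 (Z.leb_le _ _)) by lia; now rewrite Nat2Z.id.
Qed.

Lemma vapp_gdot (j : nat) (f : fct) (p : point) : (1 <= j)%nat ->
  vapp (gdot (Z.of_nat j)) f p = gdot_coef j p * partial cthc f p.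
Proof. intros Hj; rewrite gdot_of_nat by exact Hj; unfold vapp, vscal, dd; simpl; ring. Qed.

Lemma partial_gdot_czc (j : nat) (p : point) : partial czc (gdot_coef j) p = 0.
Proof. now apply partial_const. Qed.

Lemma partial_gdot_cthc (j : nat) (p : point) : partial cthc (gdot_coef j) p = 0.
Proof. now apply partial_const. Qed.

Lemma partial_gdot_th_z (n : nat) (p : point) : on_TM p ->
  partial cz (gdot_coef (S n)) p + partial cth (gdot_coef (S (S n))) p = 0.
Proof.
intros Hp; unfold partial.
rewrite (cderiv_C_derive _ _ _ (cderiv_gdot_z n p Hp)).
rewrite (cderiv_C_derive _ _ _ (cderiv_gdot_th (S n) p)).
rewrite RtoC_fact_S, (Cpow_S _ (S n)); field.
split; [apply twopii_neq_0|exact Hp].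
Qed.

Lemma partial_gdot_th_1 (p : point) : on_TM p ->
  partial cth (gdot_coef 1) p = - (p cth / (twopii * p cz)).
Proof.
intros Hp; unfold partial.
rewrite (cderiv_C_derive _ _ _ (cderiv_gdot_th 0 p)).
rewrite (proj2 (bern_0_1 _)); simpl; unfold bern_arg, twopii.
rewrite RtoC_mult; field; repeat split; try exact Hp; try exact Ci_nz.
apply RtoC_neq_0; pose proof PI_RGT_0; lra.
Qed.

Definition cthc_free (f : laurent fct) : Prop :=
  forall n p w, f n (upd p cthc w) = f n p.

Lemma sum_n_m_0 (a : nat -> C) (n m : nat) :
  (forall k, (n <= k <= m)%nat -> a k = 0) -> sum_n_m a n m = RtoC 0.
Proof.
intros H; rewrite (sum_n_m_ext_loc a (fun _ => RtoC 0)) by exact H.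
apply (sum_n_m_const_zero (G := C_AbelianMonoid)).
Qed.

Lemma sum_n_m_S (a : nat -> C) (n m : nat) :
  (n <= S m)%nat -> sum_n_m a n (S m) = sum_n_m a n m + a (S m).
Proof. intros H; rewrite sum_n_Sm by exact H; reflexivity. Qed.

(** In [lbracket] and [lapp] the second argument has only the orders 0 and -1 in
    epsilon, so only j = n and j = n + 1 contribute to the order n. *)
Lemma sum_last_two (a : nat -> C) (n : Z) :
  (forall k, (1 <= k)%nat -> Z.of_nat k <> n -> Z.of_nat k <> (n + 1)%Z -> a k = 0) ->
  sum_n_m a 1 (Z.to_nat (n + 1))
  = (if (1 <=? n)%Z then a (Z.to_nat n) else RtoC 0)
    + (if (0 <=? n)%Z then a (S (Z.to_nat n)) else RtoC 0).
Proof.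
intros H.
destruct (Z.leb_spec 0 n) as [H0|H0].
- replace (Z.to_nat (n + 1)) with (S (Z.to_nat n)) by lia.
  rewrite sum_n_m_S by lia; f_equal.
  destruct (Z.leb_spec 1 n) as [H1|H1].
  + destruct (Z.to_nat n) as [|m] eqn:E; [lia|].
    rewrite sum_n_m_S by lia; rewrite sum_n_m_0; [in_C; ring|].
    intros k Hk; apply H; lia.
  + replace (Z.to_nat n) with O by lia; now rewrite sum_n_m_zero by lia.
- rewrite (proj2 (Z.leb_gt 1 n)) by lia.
  replace (Z.to_nat (n + 1)) with O by lia.
  rewrite sum_n_m_zero by lia; change (@zero C_AbelianMonoid) with (RtoC 0); in_C; ring.
Qed.

Lemma sum_first_two (a : nat -> C) (N : nat) :
  (forall k, a (S (S k)) = 0) -> (N = O -> a 1%nat = 0) ->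
  sum_n a N = a O + a 1%nat.
Proof.
intros H H0; destruct N as [|N]; [rewrite sum_O, H0 by reflexivity; in_C; ring|].
clear H0; induction N as [|N IH]; [rewrite sum_n_S, sum_O; reflexivity|].
rewrite sum_n_S, IH, H; in_C; ring.
Qed.

Lemma lapp_cthc_free (f : laurent fct) (n : Z) (p : point) :
  cthc_free f -> lapp gdot f n p = 0.
Proof.
intros Hf; unfold lapp; apply sum_n_m_0; intros k Hk.
rewrite vapp_gdot by lia; rewrite partial_const; [ring|].
intros w; rewrite !Hf; reflexivity.
Qed.

Lemma iter_lapp_cthc_free (f : laurent fct) (k : nat) (n : Z) (p : point) :
  cthc_free f -> Nat.iter (S k) (lapp gdot) f n p = 0.
Proof.
intros Hf.
assert (A : cthc_free (Nat.iter k (lapp gdot) f)).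
{ induction k as [|k IH]; [exact Hf|]; intros m q w.
  change (lapp gdot (Nat.iter k (lapp gdot) f) m (upd q cthc w)
    = lapp gdot (Nat.iter k (lapp gdot) f) m q).
  now rewrite !lapp_cthc_free. }
change (lapp gdot (Nat.iter k (lapp gdot) f) n p = 0).
now apply lapp_cthc_free.
Qed.

Lemma x1_eq (n : Z) (p : point) : x1 n p = x1st n p.
Proof.
assert (Hf : cthc_free x1st).
{ intros m q w; unfold x1st; destruct (m =? 0)%Z, (m =? -1)%Z; reflexivity. }
unfold x1, exp_app; rewrite sum_first_two.
- rewrite iter_lapp_cthc_free by exact Hf; simpl; field.
- intros k; rewrite iter_lapp_cthc_free by exact Hf; field; apply RtoC_fact_neq_0.
- intros _; rewrite iter_lapp_cthc_free by exact Hf; field; apply RtoC_fact_neq_0.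
Qed.

Lemma lapp_x2st (n : Z) (p : point) : lapp gdot x2st n p = gdot n cthc p.
Proof.
assert (E : forall j, (1 <= j)%nat -> vapp (gdot (Z.of_nat j)) (x2st (n - Z.of_nat j)%Z) p
  = if (Z.of_nat j =? n)%Z then gdot_coef j p else 0).
{ intros j Hj; rewrite vapp_gdot by exact Hj.
  destruct (Z.eqb_spec (Z.of_nat j) n) as [<-|Hne].
  - replace (Z.of_nat j - Z.of_nat j)%Z with 0%Z by lia.
    replace (partial cthc (x2st 0%Z) p) with (RtoC 1); [ring|].
    symmetry; apply cderiv_C_derive, cderiv_id.
  - rewrite partial_const; [ring|]; intros w; unfold x2st.
    rewrite (proj2 (Z.eqb_neq (n - Z.of_nat j) 0)) by lia.
    destruct (n - Z.of_nat j =? -1)%Z; reflexivity. }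
unfold lapp; rewrite sum_last_two; cbv beta.
- unfold gdot at 3; destruct (Z.leb_spec 1 n) as [H1|H1].
  + rewrite (proj2 (Z.leb_le 0 n)), !E by lia.
    rewrite (proj2 (Z.eqb_eq _ _)) by lia.
    rewrite (proj2 (Z.eqb_neq _ _)) by lia; unfold vscal, dd; simpl; ring.
  + destruct (Z.leb_spec 0 n) as [H0|H0]; [|ring].
    rewrite E by lia; rewrite (proj2 (Z.eqb_neq _ _)) by lia; ring.
- intros k Hk Hk1 Hk2; rewrite E by exact Hk; now rewrite (proj2 (Z.eqb_neq _ _)).
Qed.

Lemma gdot_cthc_free (n : Z) (p : point) (w : C) :
  gdot n cthc (upd p cthc w) = gdot n cthc p.
Proof. unfold gdot; destruct (1 <=? n)%Z; reflexivity. Qed.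

Lemma x2_eq (n : Z) (p : point) : x2 n p = x2st n p + gdot n cthc p.
Proof.
assert (Hf : cthc_free (lapp gdot x2st)).
{ intros m q w; rewrite !lapp_x2st; apply gdot_cthc_free. }
assert (Hk : forall k, Nat.iter (S (S k)) (lapp gdot) x2st n p = 0).
{ intros k; rewrite <- (iter_lapp_cthc_free _ k n p Hf).
  now rewrite (Nat.iter_succ_r (S k)). }
unfold x2, exp_app; rewrite sum_first_two.
- change (Nat.iter 0 (lapp gdot) x2st n p) with (x2st n p).
  change (Nat.iter 1 (lapp gdot) x2st n p) with (lapp gdot x2st n p).
  rewrite lapp_x2st; simpl; field.
- intros k; rewrite Hk; field; apply RtoC_fact_neq_0.
- intros HN; change (Nat.iter 1 (lapp gdot) x2st n p) with (lapp gdot x2st n p).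
  rewrite lapp_x2st; unfold gdot; rewrite (proj2 (Z.leb_gt 1 n)) by lia; simpl; field.
Qed.

(** A field that does not involve theta-check is not differentiated by gdot; only
    its action on the coefficient of gdot remains. *)
Lemma bracket_gdot (j : nat) (Y : vfield) (i : coord) (p : point) :
  (1 <= j)%nat -> (forall w, Y i (upd p cthc w) = Y i p) ->
  bracket (gdot (Z.of_nat j)) Y i p
  = if coord_eqb i cthc then - vapp Y (gdot_coef j) p else 0.
Proof.
intros Hj HY; unfold bracket; rewrite vapp_gdot by exact Hj.
rewrite (partial_const cthc (Y i)) by (intros w; now rewrite !HY).
rewrite gdot_of_nat by exact Hj.
destruct (coord_eqb i cthc) eqn:E.
- replace i with cthc by (destruct i; simpl in E; congruence).
  replace (vscal (gdot_coef j) (dd cthc) cthc) with (gdot_coef j); [ring|].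
  apply functional_extensionality; intros q; unfold vscal, dd; simpl; ring.
- assert (Hp : forall c, partial c (vscal (gdot_coef j) (dd cthc) i) p = 0).
  { intros c; apply partial_const; intros w; unfold vscal, dd.
    destruct i; simpl in *; try discriminate; ring. }
  unfold vapp; rewrite !Hp; ring.
Qed.

(** Two vertical fields independent of theta-check commute; this makes the
    exponential series stop after the linear term. *)
Lemma lbracket_vertical (Y : laurent vfield) :
  (forall n i p w, on_TM p -> Y n i (upd p cthc w) = Y n i p) ->
  (forall n i p, on_TM p -> coord_eqb i cthc = false -> Y n i p = 0) ->
  forall n i p, on_TM p -> lbracket gdot Y n i p = 0.
Proof.
intros H1 H2 n i p Hp; unfold lbracket; apply sum_n_m_0; intros j Hj.
rewrite bracket_gdot; [|lia|intros w; now apply H1].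
destruct (coord_eqb i cthc); [|reflexivity].
unfold vapp; rewrite !(H2 _ _ p Hp) by reflexivity; rewrite partial_gdot_cthc; ring.
Qed.

Lemma lbracket_Ast (a b : C * C -> C) (n : Z) (i : coord) (p : point) : on_TM p ->
  lbracket gdot (Ast a b) n i p
  = if (n =? 0)%Z then
      if coord_eqb i cthc then a (proj_M p) * (p cth / (twopii * p cz)) else 0
    else 0.
Proof.
intros Hp.
assert (Hfree : forall m j w, Ast a b m j (upd p cthc w) = Ast a b m j p) by reflexivity.
assert (E : forall j, (1 <= j)%nat ->
  bracket (gdot (Z.of_nat j)) (Ast a b (n - Z.of_nat j)%Z) i p
  = if coord_eqb i cthc then
      - (a (proj_M p) * ((if (n - Z.of_nat j =? 0)%Z then partial cz (gdot_coef j) p else 0)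
         + (if (n - Z.of_nat j =? -1)%Z then partial cth (gdot_coef j) p else 0)))
    else 0).
{ intros j Hj; rewrite bracket_gdot by (auto || (intros; apply Hfree)).
  destruct (coord_eqb i cthc); [|reflexivity]; f_equal.
  unfold vapp; rewrite partial_gdot_czc, partial_gdot_cthc.
  unfold Ast, conn, Ast_z, Ast_zc, ladd, monomial, dd; simpl.
  destruct (n - Z.of_nat j =? 0)%Z, (n - Z.of_nat j =? -1)%Z; ring. }
unfold lbracket; rewrite sum_last_two; cbv beta.
2:{ intros k Hk H1 H2; rewrite E by exact Hk.
    rewrite (proj2 (Z.eqb_neq _ 0)), (proj2 (Z.eqb_neq _ (-1))) by lia.
    destruct (coord_eqb i cthc); [ring|reflexivity]. }
destruct (Z.leb_spec 1 n) as [H1|H1].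
- rewrite (proj2 (Z.leb_le 0 n)) by lia.
  rewrite (proj2 (Z.eqb_neq n 0)) by lia.
  destruct (Z.to_nat n) as [|m] eqn:Em; [lia|].
  rewrite !E by lia; destruct (coord_eqb i cthc); [|ring].
  rewrite (proj2 (Z.eqb_eq (n - Z.of_nat (S m)) 0)) by lia.
  rewrite (proj2 (Z.eqb_neq (n - Z.of_nat (S m)) (-1))) by lia.
  rewrite (proj2 (Z.eqb_neq (n - Z.of_nat (S (S m))) 0)) by lia.
  rewrite (proj2 (Z.eqb_eq (n - Z.of_nat (S (S m))) (-1))) by lia.
  transitivity (- (a (proj_M p) * (partial cz (gdot_coef (S m)) p
    + partial cth (gdot_coef (S (S m))) p))); [ring|].
  rewrite partial_gdot_th_z by exact Hp; ring.
- destruct (Z.leb_spec 0 n) as [H0|H0].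
  + replace n with 0%Z in * by lia; simpl Z.to_nat.
    rewrite E by lia; simpl Z.eqb; cbv iota.
    destruct (coord_eqb i cthc); [|ring].
    rewrite partial_gdot_th_1 by exact Hp; ring.
  + rewrite (proj2 (Z.eqb_neq n 0)) by lia; ring.
Qed.

Lemma exp_Lie_Ast (a b : C * C -> C) (n : Z) (i : coord) (p : point) : on_TM p ->
  exp_Lie gdot (Ast a b) n i p = A1conn a b n i p.
Proof.
intros Hp.
assert (H2 : forall n i p, on_TM p ->
  lbracket gdot (lbracket gdot (Ast a b)) n i p = 0).
{ apply lbracket_vertical.
  - intros m j q w Hq; rewrite !lbracket_Ast by exact Hq; reflexivity.
  - intros m j q Hq Hj; rewrite lbracket_Ast, Hj by exact Hq.
    destruct (m =? 0)%Z; reflexivity. }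
assert (Hk : forall k n i p, on_TM p ->
  Nat.iter (S (S k)) (lbracket gdot) (Ast a b) n i p = 0).
{ induction k as [|k IH]; [exact H2|].
  intros m j q Hq.
  change (lbracket gdot (Nat.iter (S (S k)) (lbracket gdot) (Ast a b)) m j q = 0).
  apply lbracket_vertical; [|intros; now apply IH|exact Hq].
  intros m' j' q' w Hq'; rewrite !IH; auto. }
unfold exp_Lie; rewrite sum_first_two.
- change (Nat.iter 0 (lbracket gdot) (Ast a b) n i p) with (Ast a b n i p).
  change (Nat.iter 1 (lbracket gdot) (Ast a b) n i p)
    with (lbracket gdot (Ast a b) n i p).
  rewrite lbracket_Ast by exact Hp.
  unfold Ast, A1conn, conn, A_z, A_zc, Ast_z, Ast_zc, ladd, monomial, vscal, dd.
  destruct (n =? 0)%Z; destruct i; simpl; field; split; auto using twopii_neq_0.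
- intros k; rewrite Hk by exact Hp; field; apply RtoC_fact_neq_0.
- intros HN; change (Nat.iter 1 (lbracket gdot) (Ast a b) n i p)
    with (lbracket gdot (Ast a b) n i p).
  rewrite lbracket_Ast by exact Hp; rewrite (proj2 (Z.eqb_neq n 0)) by lia.
  simpl; field.
Qed.

(** * The Borel transform as a convergent series *)

Definition borel (th w : C) : C :=
  if Ceq_dec w 0 then - twopii * bern (bern_arg th) 2 else borel_form th w.

(** On this disc (2 |u| + 2) |2 pi w| <= 1/2, so the series of [bern_bound] is
    dominated by a geometric series of ratio 1/2. *)
Definition borel_radius (th : C) : R := (/ (4 * PI * (2 * Cmod (bern_arg th) + 2)))%R.

Lemma borel_radius_pos (th : C) : (0 < borel_radius th)%R.
Proof.
pose proof PI_RGT_0; pose proof (Cmod_ge_0 (bern_arg th)).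
apply Rinv_0_lt_compat, Rmult_lt_0_compat; lra.
Qed.

Lemma borel_radius_spec (th w : C) : (Cmod w < borel_radius th)%R ->
  ((2 * Cmod (bern_arg th) + 2) * Cmod (- twopii * w) <= 1 / 2)%R.
Proof.
intros H; pose proof PI_RGT_0; pose proof (Cmod_ge_0 (bern_arg th)).
rewrite Cmod_mult, Cmod_opp, Cmod_twopii.
set (K := (2 * Cmod (bern_arg th) + 2)%R) in *.
assert (HK : (2 <= K)%R) by (unfold K; lra).
unfold borel_radius in H; fold K in H.
assert (Cmod w * (4 * PI * K) <= 1)%R.
{ apply Rlt_le, (Rmult_lt_reg_r (/ (4 * PI * K))).
  - apply Rinv_0_lt_compat, Rmult_lt_0_compat; lra.
  - rewrite Rmult_assoc, Rinv_r, Rmult_1_l, Rmult_1_r; [exact H|].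
    apply Rgt_not_eq, Rmult_lt_0_compat; lra. }
lra.
Qed.

(** With s = - 2 pi i w, dropping the first two terms of the generating function
    and dividing by s^2 gives the closed form. That sin (pi w) is not 0 is a
    consequence: in h (e^s - 1) = s e^(u s) the right-hand side does not vanish. *)
Lemma borel_series (th w : C) : (Cmod w < borel_radius th)%R ->
  has_sum (fun n => - twopii * (bern (bern_arg th) (S (S n)) * Cpow (- twopii * w) n))
    (borel th w).
Proof.
intros Hw; pose proof (borel_radius_spec th w Hw) as HK.
set (u := bern_arg th) in *; set (s := - twopii * w) in *.
unfold borel; fold u; destruct (Ceq_dec w 0) as [E|Hn].
- intros e He; exists O; intros N _.
  replace (sum_n _ N) with (- twopii * bern u 2).
  + replace (- twopii * bern u 2 - - twopii * bern u 2) with (RtoC 0) by ring.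
    now rewrite Cmod_0.
  + symmetry; unfold s; rewrite E, Cmult_0_r; induction N as [|N IH].
    * rewrite sum_O; simpl; ring.
    * rewrite sum_n_S, IH, Cpow_S; in_C; ring.
- assert (Hs : s <> 0).
  { apply Cmult_neq_0; [|exact Hn].
    intros E; apply twopii_neq_0; replace twopii with (- - twopii) by ring.
    rewrite E; ring. }
  pose proof (Cmod_ge_0 u) as Hu; pose proof (Cmod_ge_0 s) as Hs0.
  destruct (has_sum_ex (fun n => bern u n * Cpow s n)) as (h & Hh).
  { apply (ex_series_geom_bound _ 1 ((2 * Cmod u + 2) * Cmod s)%R).
    - split; [apply Rmult_le_pos; lra|lra].
    - intros n; rewrite Cmod_mult, Cmod_pow, Rpow_mult_distr, Rmult_1_l.
      apply Rmult_le_compat_r; [now apply pow_le|apply bern_bound]. }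
  pose proof (bernoulli_generating u s h Hs ltac:(lra) Hh) as G.
  assert (Es : Cexp s - 1 = - Cexp (- (RtoC PI * Ci) * w) * Dsin w).
  { unfold Dsin; unfold Cminus at 2; rewrite Cmult_plus_distr_l.
    replace (- Cexp (- (RtoC PI * Ci) * w) * Cexp (RtoC PI * Ci * w))
      with (- (Cexp (- (RtoC PI * Ci) * w) * Cexp (RtoC PI * Ci * w))) by ring.
    replace (- Cexp (- (RtoC PI * Ci) * w) * - Cexp (- (RtoC PI * Ci) * w))
      with (Cexp (- (RtoC PI * Ci) * w) * Cexp (- (RtoC PI * Ci) * w)) by ring.
    rewrite <- !Cexp_plus.
    replace (- (RtoC PI * Ci) * w + RtoC PI * Ci * w) with (RtoC 0) by ring.
    replace (- (RtoC PI * Ci) * w + - (RtoC PI * Ci) * w) with s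
      by (unfold s, twopii; rewrite RtoC_mult; ring).
    rewrite Cexp_0; ring. }
  assert (Eus : Cexp (u * s) = Cexp (th * w) * Cexp (- (RtoC PI * Ci) * w)).
  { rewrite <- Cexp_plus; f_equal; unfold s, u, bern_arg; field; apply twopii_neq_0. }
  rewrite Es, Eus in G.
  set (E0 := Cexp (- (RtoC PI * Ci) * w)) in *.
  assert (HE0 : E0 <> 0) by apply Cexp_neq_0.
  assert (HD : Dsin w <> 0).
  { intros E; rewrite E in G.
    assert (Z : s * (Cexp (th * w) * E0) = 0) by (rewrite <- G; ring).
    revert Z; apply Cmult_neq_0; [exact Hs|].
    apply Cmult_neq_0; [apply Cexp_neq_0|exact HE0]. }
  assert (Eh : h = - s * Cexp (th * w) / Dsin w).
  { replace h with (h * (- E0 * Dsin w) / (- E0 * Dsin w)).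
    - rewrite G; field; split; assumption.
    - field; split; assumption. }
  pose proof (has_sum_shift _ _ (has_sum_shift _ _ Hh)) as H2.
  pose proof (has_sum_scal (- twopii / (s * s)) _ _ H2) as H3.
  replace (borel_form th w) with (- twopii / (s * s)
    * (h - bern u 0 * Cpow s 0 - bern u 1 * Cpow s 1)).
  + revert H3; apply has_sum_ext; intros n; rewrite !Cpow_S; field; exact Hs.
  + rewrite (proj1 (bern_0_1 u)), (proj2 (bern_0_1 u)), Eh; simpl.
    unfold borel_form, s, u, bern_arg.
    assert (E2 : RtoC PI * Ci = twopii / 2).
    { unfold twopii; rewrite RtoC_mult; field. }
    rewrite E2; field; repeat split; try assumption; apply twopii_neq_0.
Qed.

(** The series minus its first two terms is bounded by a multiple of |w|^2. *)
Lemma cderiv_borel_0 (th : C) : exists l, cderiv (borel th) 0 l.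
Proof.
set (u := bern_arg th); set (K := (2 * Cmod u + 2)%R).
pose proof (Cmod_ge_0 u) as Hu.
assert (HK : (2 <= K)%R) by (unfold K; lra).
exists (twopii * twopii * bern u 3); apply cderiv_eps; intros e He.
pose proof PI_RGT_0 as Hpi.
set (M := (2 * (2 * PI * K ^ 4 * (2 * PI) ^ 2))%R).
assert (HM : (0 < M)%R).
{ unfold M; pose proof (pow_lt K 4 ltac:(lra)); pose proof (pow_lt (2 * PI) 2 ltac:(lra)).
  apply Rmult_lt_0_compat; [lra|]; apply Rmult_lt_0_compat; [|assumption].
  apply Rmult_lt_0_compat; lra. }
exists (Rmin (borel_radius th) (e / M)); split.
{ apply Rmin_pos; [apply borel_radius_pos|apply Rdiv_lt_0_compat; lra]. }
intros w; replace (w - 0) with w by ring; intros Hw.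
assert (Hw1 := Rlt_le_trans _ _ _ Hw (Rmin_l _ _)).
assert (Hw2 := Rlt_le_trans _ _ _ Hw (Rmin_r _ _)).
pose proof (borel_series th w Hw1) as H; pose proof (borel_radius_spec th w Hw1) as Hs.
fold u K in H, Hs; set (s := - twopii * w) in *.
assert (Hsm : (Cmod s = 2 * PI * Cmod w)%R).
{ unfold s; now rewrite Cmod_mult, Cmod_opp, Cmod_twopii. }
assert (E0 : borel th 0 = - twopii * bern u 2).
{ unfold borel; destruct (Ceq_dec 0 0) as [_|H0]; [reflexivity|now destruct H0]. }
pose proof (has_sum_shift _ _ (has_sum_shift _ _ H)) as H2; simpl in H2.
pose proof (Cmod_ge_0 w) as Hw0; pose proof (Cmod_ge_0 s) as Hs0.
assert (HK4 : (0 < K ^ 4)%R) by (apply pow_lt; lra).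
replace (borel th w - borel th 0 - twopii * twopii * bern u 3 * w)
  with (borel th w - - twopii * (bern u 2 * 1) - - twopii * (bern u 3 * (s * 1)))
  by (rewrite E0; unfold s; ring).
eapply Rle_trans; [apply (has_sum_bound _ _ (2 * PI * K ^ 4 * (Cmod s) ^ 2)%R
  (K * Cmod s)%R) with (4 := H2)|].
- apply Rmult_le_pos; [apply Rmult_le_pos; lra|apply pow2_ge_0].
- split; [apply Rmult_le_pos|]; lra.
- intros n; rewrite !Cmod_mult, Cmod_opp, Cmod_twopii, Cmod_pow.
  pose proof (bern_bound u (S (S (S (S n))))) as Hb; fold K in Hb.
  rewrite Rpow_mult_distr.
  assert (Hp : (0 <= Cmod s ^ n)%R) by now apply pow_le.
  replace (2 * PI * K ^ 4 * Cmod s ^ 2 * (K ^ n * Cmod s ^ n))%R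
    with (2 * PI * (K ^ S (S (S (S n))) * (Cmod s * (Cmod s * Cmod s ^ n))))%R
    by (simpl; ring).
  apply Rmult_le_compat_l; [lra|]; apply Rmult_le_compat_r; [|exact Hb].
  repeat apply Rmult_le_pos; assumption.
- rewrite Hsm.
  replace (2 * (2 * PI * K ^ 4 * (2 * PI * Cmod w) ^ 2))%R
    with (M * Cmod w * Cmod w)%R by (unfold M; ring).
  apply Rmult_le_compat_r; [exact Hw0|].
  apply (Rlt_div_r _ _ M) in Hw2; lra.
Qed.

Lemma holo_borel (th : C) : holo nonpole (borel th).
Proof.
apply (holo_ext nonpole (borel_form th)); [apply Copen_nonpole| |apply holo_borel_form].
intros w Hw; unfold borel; destruct (Ceq_dec w 0) as [E|_]; [|reflexivity].
destruct (nonpole_neq_0 w Hw E).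
Qed.

Lemma cderiv_borel (th w : C) : w = 0 \/ nonpole w -> exists l, cderiv (borel th) w l.
Proof.
intros [->|Hw]; [apply cderiv_borel_0|].
destruct (holo_borel th) as (h' & H); exists (h' w); now apply H.
Qed.

Lemma ccont_borel (th w : C) : w = 0 \/ nonpole w -> ccont (borel th) w.
Proof. intros Hw; destruct (cderiv_borel th w Hw) as (l & H); eapply cderiv_ccont, H. Qed.

(** The zeros of sin are simple, hence isolated. *)
Lemma nonpole_isolated (w : C) : exists d, (0 < d)%R /\
  forall v, v <> w -> (Cmod (v - w) < d)%R -> nonpole v.
Proof.
destruct (Ceq_dec (Dsin w) 0) as [E|Hn].
2:{ destruct (Copen_nonpole w Hn) as (d & Hd & H); exists d; auto. }
assert (D : cderiv Dsin w (twopii * Cexp (RtoC PI * Ci * w))).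
{ eapply cderiv_eq; [apply cderiv_Dsin|].
  unfold Dsin in E; apply Ceq_minus in E; rewrite <- E.
  unfold twopii; rewrite RtoC_mult; ring. }
destruct D as (q & Hq & Hqw & Eq).
destruct (ccont_bounded_below q w Hq) as (d & Hd & Hb).
{ rewrite Hqw; apply Cmult_neq_0; [apply twopii_neq_0|apply Cexp_neq_0]. }
exists d; split; [exact Hd|]; intros v Hv Hvd.
specialize (Eq v); rewrite E in Eq; unfold nonpole.
replace (Dsin v) with (q v * (v - w)) by (rewrite <- Eq; ring).
apply Cmult_neq_0.
- apply Cmod_neq_0; specialize (Hb v Hvd); pose proof (Cmod_ge_0 (q w)); lra.
- intros Z; now apply Hv, Ceq_minus.
Qed.

(** The nonzero integral multiples of [z]. *)
Definition poles (z xi : C) : Prop := xi <> 0 /\ ~ nonpole (xi / z).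

Lemma not_poles (z xi : C) : z <> 0 -> ~ poles z xi -> xi / z = 0 \/ nonpole (xi / z).
Proof.
intros Hz H; destruct (Ceq_dec xi 0) as [->|Hx]; [left; field; exact Hz|right].
destruct (Ceq_dec (Dsin (xi / z)) 0) as [E|Hn]; [|exact Hn].
destruct H; split; [exact Hx|]; intros Hn; now apply Hn.
Qed.

Lemma poles_isolated (z xi : C) : z <> 0 -> exists d, (0 < d)%R /\
  forall v, v <> xi -> (Cmod (v - xi) < d)%R -> ~ poles z v.
Proof.
intros Hz; destruct (nonpole_isolated (xi / z)) as (d & Hd & H).
pose proof (proj1 (Cmod_gt_0 z) Hz) as Hzm.
exists (d * Cmod z)%R; split; [now apply Rmult_lt_0_compat|].
intros v Hv Hvd (_ & Hp); apply Hp, H.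
- intros E; apply Hv.
  replace v with (v / z * z) by (field; exact Hz); rewrite E; field; exact Hz.
- replace (v / z - xi / z) with ((v - xi) / z) by (field; exact Hz).
  rewrite Cmod_div by exact Hz; now apply Rlt_div_l.
Qed.

Lemma closed_discrete_poles (z : C) : z <> 0 -> closed_discrete (poles z).
Proof.
intros Hz; split.
- intros x Hx.
  destruct (Ceq_dec x 0) as [E|Hn]; [|destruct (Ceq_dec (Dsin (x / z)) 0) as [E|Hn']].
  + exfalso; apply Hx; apply locally_Cmod.
    destruct (poles_isolated z x Hz) as (d & Hd & H); exists d; split; [exact Hd|].
    intros v Hv; destruct (Ceq_dec v x) as [->|Hvx]; [|now apply H].
    intros (H0 & _); now apply H0.
  + split; [exact Hn|]; intros Hp; now apply Hp.
  + exfalso; apply Hx; apply locally_Cmod.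
    destruct (poles_isolated z x Hz) as (d & Hd & H); exists d; split; [exact Hd|].
    intros v Hv; destruct (Ceq_dec v x) as [->|Hvx]; [|now apply H].
    intros (_ & Hp); now apply Hp.
- intros s Hs; apply locally_Cmod.
  destruct (poles_isolated z s Hz) as (d & Hd & H); exists d; split; [exact Hd|].
  intros v Hv Hp; destruct (Ceq_dec v s) as [E|Hvx]; [exact E|].
  destruct (H v Hvx Hv Hp).
Qed.

(** * From a global Borel transform to resurgence *)

Lemma constant_continuation (S : C -> Prop) (I : R -> Prop) (gam : R -> C) (b : C -> C) :
  closed S -> (forall w, ~ S w -> exists l, cderiv b w l) ->
  (forall t, I t -> ~ S (gam t)) -> is_continuation I gam b (fun _ => b).
Proof.
intros HS Hb Hg; split; [|split].
- apply filter_forall; reflexivity.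
- intros t Ht.
  assert (L : locally (T := C_UniformSpace) (gam t) (fun w => ~ S w)).
  { destruct (Classical_Prop.classic (locally (T := C_UniformSpace) (gam t) (fun w => ~ S w)))
      as [L|L]; [exact L|]; destruct (Hg t Ht (HS _ L)). }
  revert L; apply filter_imp; intros w Hw; destruct (Hb w Hw) as (l & Hl).
  exists l; now apply cderiv_is_derive.
- intros t _; exists 1%R; split; [lra|]; intros s _ _; apply filter_forall; reflexivity.
Qed.

Lemma resurgent_intro (S : C -> Prop) (f : laurent C) (r : R) (b : C -> C) :
  closed_discrete S -> (forall n, (n <= 0)%Z -> f n = 0) ->
  is_borel_transform f r b -> (forall w, ~ S w -> exists l, cderiv b w l) ->
  resurgent_wrt S f.
Proof.
intros HS Hf Hr Hb; split; [exact HS|split; [exact Hf|]].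
exists r, b; split; [exact Hr|]; intros gam _ Hg _; exists (fun _ => b).
apply constant_continuation with S; [apply HS|exact Hb|exact Hg].
Qed.

Lemma borel_sum_intro (S : C -> Prop) (f : laurent C) (r : R) (b : C -> C) (d eps v : C) :
  closed_discrete S -> (forall n, (n <= 0)%Z -> f n = 0) ->
  is_borel_transform f r b -> (forall w, ~ S w -> exists l, cderiv b w l) ->
  ~ S 0 -> (forall s, (0 < s)%R -> ~ S (RtoC s * d)) ->
  is_RInt_gen (V := C_R_NormedModule)
    (fun s : R => Cexp (- (RtoC s * d / eps)) * b (RtoC s * d) * d)
    (at_point 0%R) (Rbar_locally p_infty) v ->
  is_borel_sum f d eps v.
Proof.
intros HS Hf Hr Hb H0 Hray Hv; split.
- exists S; split; [now apply resurgent_intro with r b|].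
  intros w (s & Hs & ->); now apply Hray.
- exists r, b, (fun _ => b); split; [exact Hr|split; [|exact Hv]].
  apply constant_continuation with S; [apply HS|exact Hb|].
  intros s Hs; destruct (Req_dec s 0) as [->|Hn].
  + now rewrite Cmult_0_l.
  + apply Hray; lra.
Qed.

(** * The zero series *)

Definition zero_series : laurent C := fun _ => 0.

Lemma zero_borel : is_borel_transform zero_series 1 (fun _ => 0).
Proof.
split; [lra|]; intros xi _; apply has_sum_is_series; intros e He; exists O; intros N _.
replace (sum_n _ N) with (RtoC 0).
- replace (0 - 0) with (RtoC 0) by ring; now rewrite Cmod_0.
- symmetry; unfold zero_series; induction N as [|N IH].
  + rewrite sum_O; unfold scal; simpl; unfold mult; simpl; unfold Cdiv; ring.
  + rewrite sum_n_S, IH; unfold scal; simpl; unfold mult; simpl; unfold Cdiv; in_C; ring.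
Qed.

Lemma closed_discrete_empty : closed_discrete (fun _ => False).
Proof.
split; [intros x Hx; apply Hx, filter_forall; auto|intros s []].
Qed.

Lemma zero_cderiv (w : C) : ~ False -> exists l, cderiv (fun _ => 0) w l.
Proof. intros _; exists 0; apply cderiv_const. Qed.

Lemma zero_resurgent : resurgent zero_series.
Proof.
exists (fun _ => False); apply resurgent_intro with 1%R (fun _ => 0);
  auto using closed_discrete_empty, zero_borel.
intros w _; now apply zero_cderiv.
Qed.

Lemma zero_jump (d : C) : stokes_jump zero_series d (fun _ => 0).
Proof.
exists 1%R, 1%R, 1%R; split; [lra|split; [lra|split; [lra|]]].
intros alpha beta phi eps _ _ _ _ _; exists 0, 0.
assert (H : forall d, is_borel_sum zero_series d eps 0).
{ intros d'; apply borel_sum_intro with (fun _ => False) 1%R (fun _ => 0);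
    auto using closed_discrete_empty, zero_borel.
  - intros w _; now apply zero_cderiv.
  - set (g := fun s : R => Cexp (- (RtoC s * d' / eps)) * 0 * d').
    assert (Hg : g = fun _ => 0).
    { apply functional_extensionality; intros s; unfold g; ring. }
    rewrite Hg.
    assert (Hp : forall t, pcont (fun _ => 0) t).
    { intros t; exact (ccont_pcont (fun _ => 0) t (ccont_const 0 t)). }
    intros P HP; apply Filter_prod with (fun a => a = 0%R) (fun b => (0 < b)%R).
    + reflexivity.
    + now exists 0%R.
    + intros a b -> Hb; exists (Cint (fun _ => 0) 0 b); split.
      * apply Cint_is_RInt; [simpl; lra|]; intros; apply Hp.
      * replace (Cint (fun _ => 0) 0 b) with (RtoC 0); [now apply locally_singleton|].
        rewrite (Cint_derive (fun _ => 0)); [ring|lra|intros; apply Hp|].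
        intros t _; exact (cderiv_real (fun _ => 0) t 0 (cderiv_const 0 t)). }
split; [apply H|split; [apply H|ring]].
Qed.

(** * Resurgence of the generator *)

Definition gdot_series (p : point) : laurent C := fun n => gdot n cthc p.

Definition borel_at (p : point) (xi : C) : C := / p cz * borel (p cth) (xi / p cz).

Lemma gdot_borel (p : point) : on_TM p ->
  is_borel_transform (gdot_series p) (borel_radius (p cth) * Cmod (p cz)) (borel_at p).
Proof.
intros Hp; pose proof (proj1 (Cmod_gt_0 _) Hp) as Hz; split.
{ apply Rmult_lt_0_compat; [apply borel_radius_pos|exact Hz]. }
intros xi Hxi; apply has_sum_is_series.
assert (Hw : (Cmod (xi / p cz) < borel_radius (p cth))%R).
{ rewrite Cmod_div by exact Hp; now apply Rlt_div_l. }
pose proof (has_sum_scal (/ p cz) _ _ (borel_series _ _ Hw)) as H.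
revert H; apply has_sum_ext; intros n.
match goal with |- ?l = _ =>
  change (l = Cpow xi n * (gdot_series p (Z.of_nat n + 1)%Z / RtoC (INR (fact n)))) end.
unfold gdot_series.
replace (Z.of_nat n + 1)%Z with (Z.of_nat (S n)) by lia.
rewrite gdot_of_nat by lia; unfold vscal, dd; simpl coord_eqb; cbv iota.
rewrite gdot_coef_S.
replace (- twopii * (xi / p cz)) with (- (twopii / p cz) * xi) by (field; exact Hp).
rewrite Cpow_mult_l, Cpow_S; field; split; [exact Hp|apply RtoC_fact_neq_0].
Qed.

Lemma gdot_series_0 (p : point) (n : Z) : (n <= 0)%Z -> gdot_series p n = 0.
Proof.
intros Hn; unfold gdot_series, gdot; now rewrite (proj2 (Z.leb_gt 1 n)) by lia.
Qed.

Lemma cderiv_borel_at (p : point) (xi : C) : on_TM p -> ~ poles (p cz) xi ->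
  exists l, cderiv (borel_at p) xi l.
Proof.
intros Hp Hx; destruct (cderiv_borel (p cth) (xi / p cz)) as (l & Hl).
{ now apply not_poles. }
eexists; unfold borel_at; apply cderiv_mult; [apply cderiv_const|].
apply (cderiv_comp (fun xi => xi / p cz) (borel (p cth))); [|exact Hl].
unfold Cdiv; apply cderiv_mult; [apply cderiv_id|apply cderiv_const].
Qed.

Lemma gdot_series_resurgent (p : point) : on_TM p -> resurgent (gdot_series p).
Proof.
intros Hp; exists (poles (p cz)).
apply resurgent_intro with (borel_radius (p cth) * Cmod (p cz))%R (borel_at p).
- now apply closed_discrete_poles.
- intros; now apply gdot_series_0.
- now apply gdot_borel.
- intros; now apply cderiv_borel_at.
Qed.

(** * Stokes jumps *)

(** The integrand of the Borel sum in the coordinate w = xi / d, where m = d / z and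
    l = d / epsilon: the direction [d] becomes the positive real axis. *)
Definition laplace (th m l w : C) : C := Cexp (- l * w) * (m * borel th (m * w)).

Lemma holo_laplace (th m l : C) :
  holo (fun w => nonpole (m * w)) (laplace th m l).
Proof.
apply holo_mult; [apply holo_Cexp|]; apply holo_mult; [apply holo_const|].
destruct (holo_borel th) as (b' & Hb); exists (fun w => m * b' (m * w)); intros w Hw.
assert (Hm : cderiv (fun w => m * w) w m).
{ eapply cderiv_eq; [apply cderiv_mult; [apply cderiv_const|apply cderiv_id]|].
  cbv beta; ring. }
destruct (Hb _ Hw) as (H1 & H2); split.
- eapply cderiv_eq; [apply (cderiv_comp (fun w => m * w) (borel th)); eassumption|ring].
- apply ccont_mult; [apply ccont_const|].
  apply (ccont_comp (fun w => m * w) b'); [eapply cderiv_ccont, Hm|exact H2].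
Qed.

Lemma ccont_laplace (th m l w : C) :
  w = 0 \/ nonpole (m * w) -> ccont (laplace th m l) w.
Proof.
intros Hw; apply ccont_mult.
- apply (holo_ccont (fun _ => True)); [apply holo_Cexp|exact I].
- apply ccont_mult; [apply ccont_const|].
  apply (ccont_comp (fun w => m * w) (borel th)).
  + ccont_arith.
  + apply ccont_borel; destruct Hw as [->|Hw]; [left; ring|now right].
Qed.

(** The points x + i x y with |y| <= 1/2 fill a sector around the positive axis. Since
    |w| <= 2 x there, the Borel transform is at most a multiple of
    e^(2 (|theta| + 1) |m| x), which e^(- l w) beats once [l] is large. *)
Lemma laplace_bound (th m : C) (c : R) : m <> 0 -> (0 < c)%R ->
  exists M, (0 <= M)%R /\ forall (l : C) (x y A : R),
  (1 / 4 <= x)%R -> (Rabs y <= 1 / 2)%R ->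
  (c <= Cmod (Dsin (m * (x, x * y)%R)))%R ->
  (A + 2 * (Cmod th + 1) * Cmod m <= fst l - snd l * y)%R ->
  (Cmod (laplace th m l (x, x * y)%R) <= M * exp (- (A * x)))%R.
Proof.
intros Hm Hc; apply Cmod_gt_0 in Hm; pose proof PI_RGT_0 as Hpi.
pose proof (Cmod_ge_0 th) as Hth.
set (w0 := (Cmod m / 4)%R); assert (Hw0 : (0 < w0)%R) by (unfold w0; lra).
set (M := (/ (2 * PI * (w0 * w0)) * (1 + Cmod th + 2 * PI / c))%R).
assert (HM : (0 <= M)%R).
{ apply Rmult_le_pos.
  - apply Rlt_le, Rinv_0_lt_compat, Rmult_lt_0_compat; nra.
  - assert (0 < 2 * PI / c)%R by (apply Rdiv_lt_0_compat; lra); lra. }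
exists (Cmod m * M)%R; split; [nra|]; intros l x y A Hx Hy HD Hl.
set (w := (x, (x * y)%R) : C) in *.
assert (Hx1 : (x <= Cmod w)%R).
{ eapply Rle_trans; [|apply abs_fst_le]; apply Rle_abs. }
assert (Hx2 : (Cmod w <= 2 * x)%R).
{ eapply Rle_trans; [apply Cmod_le_abs|]; unfold w; cbn [fst snd].
  rewrite Rabs_mult, (Rabs_pos_eq x) by lra; nra. }
assert (Hmw : m * w <> 0).
{ apply Cmod_neq_0; rewrite Cmod_mult; nra. }
assert (Eb : borel th (m * w) = borel_form th (m * w)).
{ unfold borel; destruct (Ceq_dec (m * w) 0); [contradiction|reflexivity]. }
pose proof (borel_form_bound th (m * w) w0 c Hw0 Hc
  ltac:(rewrite Cmod_mult; unfold w0; nra) HD) as B; fold M in B.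
unfold laplace; rewrite !Cmod_mult, Cmod_Cexp, Eb.
rewrite Cmod_mult in B.
assert (E1 : fst (- l * w) = (- ((fst l - snd l * y) * x))%R).
{ unfold w, Cmult, Copp; cbn [fst snd]; ring. }
rewrite E1.
assert (E2 : (exp ((Cmod th + 1) * (Cmod m * Cmod w))
  <= exp (2 * (Cmod th + 1) * Cmod m * x))%R).
{ apply exp_le_mono.
  replace (2 * (Cmod th + 1) * Cmod m * x)%R
    with ((Cmod th + 1) * (Cmod m * (2 * x)))%R by ring.
  apply Rmult_le_compat_l; [lra|]; apply Rmult_le_compat_l; lra. }
assert (E3 : (exp (- ((fst l - snd l * y) * x)) * exp (2 * (Cmod th + 1) * Cmod m * x)
  <= exp (- (A * x)))%R).
{ rewrite <- exp_plus; apply exp_le_mono.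
  set (k := (2 * (Cmod th + 1) * Cmod m)%R) in *.
  assert (0 <= (fst l - snd l * y - (A + k)) * x)%R by (apply Rmult_le_pos; lra).
  lra. }
pose proof (exp_pos (- ((fst l - snd l * y) * x))) as P1.
set (e1 := exp (- ((fst l - snd l * y) * x))) in *.
set (e2 := exp (2 * (Cmod th + 1) * Cmod m * x)) in *.
set (e3 := exp (- (A * x))) in *.
assert (B' : (Cmod (borel_form th (m * w)) <= M * e2)%R).
{ eapply Rle_trans; [exact B|]; now apply Rmult_le_compat_l. }
replace (e1 * (Cmod m * Cmod (borel_form th (m * w))))%R
  with (Cmod m * (e1 * Cmod (borel_form th (m * w))))%R by ring.
rewrite Rmult_assoc; apply Rmult_le_compat_l; [lra|].
apply Rle_trans with (e1 * (M * e2))%R; [apply Rmult_le_compat_l; lra|].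
replace (e1 * (M * e2))%R with (M * (e1 * e2))%R by ring.
now apply Rmult_le_compat_l.
Qed.

Lemma small_angle (t : R) : (Rabs t <= 1 / 4)%R ->
  (1 / 2 <= cos t)%R /\ (Rabs (sin t) <= Rabs t)%R /\
  (Rabs (tan t) <= 2 * Rabs t)%R /\ (t <> 0%R -> (0 < t * tan t)%R).
Proof.
intros Ht.
assert (Hc : (1 / 2 <= cos t)%R).
{ replace (cos t) with (cos (Rabs t))
    by (unfold Rabs; destruct (Rcase_abs t); [apply cos_neg|reflexivity]).
  pose proof cos_PI3 as E3; pose proof PI2_1; pose proof (Rabs_pos t).
  rewrite <- E3; apply cos_decr_1; lra. }
assert (Hs : (Rabs (sin t) <= Rabs t)%R).
{ destruct (Rtotal_order t 0) as [H|[->|H]].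
  - rewrite <- (Rabs_Ropp t), <- (Rabs_Ropp (sin t)), <- sin_neg.
    rewrite (Rabs_pos_eq (- t)) by lra.
    rewrite Rabs_left in Ht by exact H.
    rewrite Rabs_pos_eq.
    + apply Rlt_le, sin_lt_x; lra.
    + apply sin_ge_0; pose proof PI2_1; lra.
  - rewrite sin_0; apply Rle_refl.
  - rewrite (Rabs_pos_eq t) in * by lra.
    rewrite Rabs_pos_eq.
    + apply Rlt_le, sin_lt_x; lra.
    + apply sin_ge_0; pose proof PI2_1; lra. }
split; [exact Hc|split; [exact Hs|split]].
- unfold tan; rewrite Rabs_div, (Rabs_pos_eq (cos t)) by lra.
  apply Rle_div_l; [lra|]; pose proof (Rabs_pos t); nra.
- intros Hn; unfold tan; pose proof PI2_1; apply Rabs_le_between in Ht.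
  replace (t * (sin t / cos t))%R with (t * sin t / cos t)%R by (field; lra).
  apply Rdiv_lt_0_compat; [|lra]; destruct (Rdichotomy _ _ Hn) as [Hlt|Hgt].
  + pose proof (sin_gt_0 (- t)) as K; rewrite sin_neg in K.
    specialize (K ltac:(lra) ltac:(lra)); nra.
  + pose proof (sin_gt_0 t Hgt ltac:(lra)); nra.
Qed.

(** The jump across R_(>0) d, given lower bounds for the sine on each ray of slope
    less than [kap] (depending on the slope: the rays may be close to the poles) and
    on the vertical lines (uniform in the line), and given the truncated contour
    integrals. The exponential growth rate is the same for all rays, as it must be:
    the range of epsilon is fixed before the rays are chosen. *)
Lemma stokes_jump_intro (p : point) (d : C) (kap : R) (J : C -> C) :
  on_TM p -> d <> 0 -> (0 < kap <= 1 / 2)%R ->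
  let m := d / p cz in
  (forall x y, (0 < x)%R -> (0 < Rabs y < kap)%R -> nonpole (m * (x, x * y)%R)) ->
  (forall y, (0 < Rabs y < kap)%R -> exists c, (0 < c)%R /\
     forall x, (1 / 4 <= x)%R -> (c <= Cmod (Dsin (m * (x, x * y)%R)))%R) ->
  (exists c, (0 < c)%R /\ forall (N : nat) y, (Rabs y < kap)%R ->
     (c <= Cmod (Dsin (m * (INR N + 1 / 2, (INR N + 1 / 2) * y)%R)))%R) ->
  (forall (eps : C) (a b : R), (0 < a < kap)%R -> (0 < b < kap)%R -> eps <> 0 ->
     (Cmod (p cth) < fst (d / eps)%C)%R -> exists Sn : nat -> C,
     (forall N : nat, let X := (INR N + 1 / 2)%R in
        let L := (1%R, (- a)%R) : C in let U := (1%R, b) : C in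
        let h := laplace (p cth) m (d / eps) in
        rayint h L X + seg h (RtoC X * L) (RtoC X * U) - rayint h U X = Sn N) /\
     (forall e, (0 < e)%R -> exists N0, forall N, (N0 <= N)%nat ->
        (Cmod (Sn N - J eps) <= e)%R)) ->
  stokes_jump (gdot_series p) d J.
Proof.
intros Hp Hd Hkap m H1 H2 (c3 & Hc3 & H3) H4.
assert (Hm : m <> 0).
{ intros E; apply Hd; replace d with (m * p cz) by (unfold m; field; exact Hp).
  rewrite E; ring. }
set (th := p cth) in *.
pose proof (proj1 (Cmod_gt_0 d) Hd) as Hdm.
pose proof (proj1 (Cmod_gt_0 m) Hm) as Hmm.
(* The first summand is the exponent of [laplace_bound]; the second one makes
   |e^(theta - l)| < 1. *)
set (K := (2 * (Cmod th + 1) * Cmod m + Cmod th)%R).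
assert (HK : (0 <= K)%R).
{ unfold K; pose proof (Cmod_ge_0 th); nra. }
(* For |eps| < r and eps close to the direction d, the real part of l w is at least
   (K + 4) x on the whole sector, see Hl. *)
set (r := (Cmod d / (4 * (K + 4)))%R).
exists (kap / 2)%R, (1 / 4)%R, r; split; [lra|split; [lra|]].
split; [apply Rdiv_lt_0_compat; lra|].
intros alpha beta phi eps Ha Hb Hphi (t & Ht & Heps) Hr.
destruct (small_angle phi ltac:(lra)) as (Hphi1 & Hphi2 & _ & _).
assert (Hrot : rot phi <> 0) by apply Cexp_neq_0.
assert (Htz : RtoC t <> 0) by (apply RtoC_neq_0; lra).
assert (Heps0 : eps <> 0).
{ rewrite Heps; apply Cmult_neq_0; [exact Htz|now apply Cmult_neq_0]. }
set (l := d / eps) in *.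
assert (El : l = ((cos phi / t)%R, (- sin phi / t)%R)).
{ unfold l; rewrite Heps.
  replace (d / (RtoC t * (rot phi * d))) with (/ RtoC t * rot (- phi)).
  - rewrite rot_eq, cos_neg, sin_neg, <- RtoC_inv by lra.
    unfold Cmult, RtoC; cbn [fst snd]; f_equal; field; lra.
  - assert (E : rot (- phi) = / rot phi).
    { unfold rot; rewrite RtoC_opp, <- Cexp_opp; f_equal; ring. }
    rewrite E; field; repeat split; assumption. }
assert (Htr : (4 * (K + 4) <= / t)%R).
{ assert (Em : (Cmod eps = t * Cmod d)%R).
  { rewrite Heps, !Cmod_mult, Cmod_R, Rabs_pos_eq by lra.
    unfold rot; rewrite Cmod_Cexp.
    replace (fst (RtoC phi * Ci)) with 0%R by (simpl; ring); rewrite exp_0; ring. }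
  rewrite Em in Hr; unfold r in Hr; apply (Rlt_div_r _ _ (4 * (K + 4))) in Hr; [|lra].
  assert (t * (4 * (K + 4)) <= 1)%R by nra.
  apply (Rmult_le_reg_l t); [exact Ht|]; rewrite Rinv_r by lra; lra. }
assert (Hl : forall y, (Rabs y <= 1 / 2)%R -> (K + 4 <= fst l - snd l * y)%R).
{ intros y Hy; rewrite El; cbn [fst snd].
  replace (cos phi / t - - sin phi / t * y)%R with (/ t * (cos phi + sin phi * y))%R
    by (field; lra).
  assert (Hsy : (Rabs (sin phi * y) <= 1 / 4 * (1 / 2))%R).
  { rewrite Rabs_mult; apply Rmult_le_compat; try apply Rabs_pos; lra. }
  apply Rabs_le_between in Hsy; nra. }
set (h := laplace th m l).
assert (Hray : forall t', (0 < Rabs t' < kap / 2)%R -> exists V : C,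
  is_borel_sum (gdot_series p) (rot t' * d) eps V /\
  forall e, (0 < e)%R -> exists X0, forall X, (X0 <= X)%R ->
  (Cmod (rayint h (1%R, tan t') X - V) <= e)%R).
{ intros t' Ht'; destruct (small_angle t' ltac:(lra)) as (Hc & _ & Htan & Hpos).
  assert (Htan0 : (0 < Rabs (tan t') < kap)%R).
  { split; [|lra]; apply Rabs_pos_lt; intros E; rewrite E, Rmult_0_r in Hpos.
    apply (Rlt_irrefl 0), Hpos; intros Z; rewrite Z, Rabs_R0 in Ht'; lra. }
  assert (Ept : forall s, RtoC s * rot t' = (s * cos t', s * cos t' * tan t')%R).
  { intros s; rewrite rot_eq; unfold Cmult, RtoC, tan; cbn [fst snd].
    f_equal; field; lra. }
  assert (Hnp : forall s, (0 < s)%R -> nonpole (m * (RtoC s * rot t'))).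
  { intros s Hs; rewrite Ept; apply H1; [nra|exact Htan0]. }
  destruct (H2 (tan t') Htan0) as (c & Hc0 & HD).
  destruct (laplace_bound th m c Hm Hc0) as (M & HM & HB).
  destruct (ray_limit h t' M) as (V & HV & Hlim).
  - lra.
  - intros s Hs; apply ccont_laplace; destruct (Req_dec s 0) as [->|Hn];
      [left; ring|right; apply Hnp; lra].
  - intros s Hs; rewrite Ept.
    eapply Rle_trans; [apply (HB l (s * cos t')%R (tan t') 4%R)|].
    + nra.
    + lra.
    + apply HD; nra.
    + specialize (Hl (tan t') ltac:(lra)); unfold K in Hl; pose proof (Cmod_ge_0 th); lra.
    + apply Rmult_le_compat_l; [exact HM|]; apply exp_le_mono; nra.
  - exists V; split; [|exact Hlim].
    apply borel_sum_intro with (poles (p cz)) (borel_radius th * Cmod (p cz))%R (borel_at p).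
    + now apply closed_discrete_poles.
    + intros; now apply gdot_series_0.
    + now apply gdot_borel.
    + intros; now apply cderiv_borel_at.
    + intros (H0 & _); now apply H0.
    + intros s Hs (_ & Hpole); apply Hpole.
      replace (RtoC s * (rot t' * d) / p cz) with (m * (RtoC s * rot t'))
        by (unfold m; field; exact Hp).
      now apply Hnp.
    + replace (fun s : R => Cexp (- (RtoC s * (rot t' * d) / eps))
        * borel_at p (RtoC s * (rot t' * d)) * (rot t' * d))
        with (fun s : R => h (RtoC s * rot t') * rot t'); [exact HV|].
      apply functional_extensionality; intros s; unfold h, laplace, borel_at, l, m.
      fold th.
      replace (- (d / eps) * (RtoC s * rot t')) with (- (RtoC s * (rot t' * d) / eps))
        by (field; exact Heps0).
      replace (d / p cz * (RtoC s * rot t')) with (RtoC s * (rot t' * d) / p cz)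
        by (field; exact Hp).
      field; exact Hp. }
destruct (Hray (- alpha)%R) as (Vm & HVm & Lm).
{ rewrite Rabs_Ropp, Rabs_pos_eq; lra. }
destruct (Hray beta) as (Vp & HVp & Lp').
{ rewrite Rabs_pos_eq; lra. }
exists Vm, Vp; split; [exact HVm|split; [exact HVp|]].
assert (Htan : forall t', (0 < t' < kap / 2)%R -> (0 < tan t' < kap)%R).
{ intros t' Ht'.
  destruct (small_angle t') as (_ & _ & Htan & Hpos); [rewrite Rabs_pos_eq; lra|].
  rewrite (Rabs_pos_eq t') in Htan by lra; apply Rabs_le_between in Htan.
  specialize (Hpos ltac:(lra)); split; [nra|lra]. }
pose proof (Htan alpha Ha) as Ta; pose proof (Htan beta Hb) as Tb.
destruct (laplace_bound th m c3 Hm Hc3) as (M & HM & HB).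
destruct (H4 eps (tan alpha) (tan beta) Ta Tb Heps0) as (Sn & HS & HSl).
{ specialize (Hl 0%R ltac:(rewrite Rabs_R0; lra)); fold l; unfold K in Hl.
  pose proof (Cmod_ge_0 th); nra. }
rewrite tan_neg in Lm.
apply (jump_of_limits h (- tan alpha) (tan beta) Vm Vp (J eps) Sn M);
  [exact Lm|exact Lp'| |exact HS|exact HSl].
intros N s X Hs.
set (y := (- tan alpha + s * (tan beta + tan alpha))%R).
assert (Hy : (Rabs y < kap)%R) by (apply Rabs_def1; unfold y; nra).
assert (HX : (1 / 2 <= X)%R) by (unfold X; pose proof (pos_INR N); lra).
replace (RtoC X * ((1%R, (- tan alpha)%R) + RtoC s * ((1%R, tan beta) - (1%R, (- tan alpha)%R))))
  with ((X, X * y)%R : C).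
2:{ unfold Cmult, Cminus, Cplus, Copp, RtoC, y; cbn [fst snd]; f_equal; ring. }
specialize (H3 N y Hy); fold X in H3; split.
- apply ccont_laplace; right; apply Cmod_neq_0; lra.
- eapply Rle_trans; [apply (HB l X y 4%R)|].
  + lra.
  + lra.
  + exact H3.
  + specialize (Hl y ltac:(lra)); unfold K in Hl; pose proof (Cmod_ge_0 th); lra.
  + apply Rmult_le_compat_l; [exact HM|]; apply exp_le_mono; lra.
Qed.

(** For [sg = -1] the symmetry [borel_form_sym] turns theta into - theta, and the sign
    of d xi = - z dw comes out in front. *)
Lemma jump_at_poles (p : point) (sg : C) : on_TM p -> sg = 1 \/ sg = - (1) ->
  stokes_jump (gdot_series p) (sg * p cz)
    (fun eps => sg * Clog (1 + Cexp (sg * p cth - sg * p cz / eps))).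
Proof.
intros Hp Hsg.
assert (Hsg2 : sg * sg = 1) by (destruct Hsg as [-> | ->]; ring).
assert (Hsg1 : Cmod sg = 1%R)
  by (destruct Hsg as [-> | ->]; [apply Cmod_1|now rewrite Cmod_opp, Cmod_1]).
assert (Hsg0 : sg <> 0).
{ intros E; rewrite E, Cmult_0_l in Hsg2; apply RtoC_inj in Hsg2; lra. }
assert (HD : forall w, Cmod (Dsin (sg * w)) = Cmod (Dsin w)).
{ intros w; destruct Hsg as [-> | ->]; [now rewrite Cmult_1_l|].
  replace (- (1) * w) with (- w) by ring; now rewrite Dsin_opp, Cmod_opp. }
assert (Hnp : forall w, nonpole (sg * w) <-> nonpole w).
{ intros w; unfold nonpole; rewrite !Cmod_gt_0, HD; reflexivity. }
assert (Em : sg * p cz / p cz = sg) by (field; exact Hp).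
apply stokes_jump_intro with (1 / 2)%R; rewrite ?Em.
- exact Hp.
- now apply Cmult_neq_0.
- lra.
- intros x y Hx Hy; apply Hnp, nonpole_im; cbn [snd].
  apply Rmult_integral_contrapositive; split; [lra|].
  intros E; rewrite E, Rabs_R0 in Hy; lra.
- intros y Hy; exists (Rabs y / 4)%R; split; [lra|]; intros x Hx.
  rewrite HD; apply Rle_trans with (2 := Cmod_Dsin_ge _); cbn [snd].
  rewrite Rabs_mult, (Rabs_pos_eq x) by lra; nra.
- exists 2%R; split; [lra|]; intros N y _; rewrite HD.
  apply (Cmod_Dsin_half N); reflexivity.
- intros eps a b Ha Hb Heps Hl.
  set (th := p cth) in *; set (l := sg * p cz / eps) in *.
  set (q := Cexp (sg * th - l)).
  set (rho := fun n : nat => - sg * (RtoC ((-1) ^ n) * Cpow q n / (twopii * RtoC (INR n)))).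
  exists (sum_n_m (fun n => twopii * rho n) 1); split.
  + apply (sector_residues (fun w => nonpole (sg * w)));
      try lra.
    * apply Copen_nonpole_scal.
    * apply holo_laplace.
    * apply ccont_laplace; now left.
    * intros w Hw; now apply Hnp, nonpole_im.
    * intros n w Hw; apply Hnp; now apply (nonpole_between n).
    * intros n Hn e He.
      destruct (borel_form_residue (sg * th) l n Hn e He) as (d & Hd & H).
      destruct (nonpole_isolated (RtoC (INR n))) as (d' & Hd' & H').
      exists (Rmin d d'); split; [now apply Rmin_pos|]; intros v Hv Hvd.
      specialize (H v Hv (Rlt_le_trans _ _ _ Hvd (Rmin_l _ _))).
      assert (Hnv : nonpole (RtoC (INR n) + v)).
      { apply H'.
        - intros E; apply Hv; replace v with (RtoC (INR n) + v - RtoC (INR n)) by ring.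
          rewrite E; ring.
        - replace (RtoC (INR n) + v - RtoC (INR n)) with v by ring.
          apply (Rlt_le_trans _ _ _ Hvd (Rmin_r _ _)). }
      set (w := RtoC (INR n) + v) in *.
      assert (Eb : borel th (sg * w) = borel_form (sg * th) w).
      { unfold borel; destruct (Ceq_dec (sg * w) 0) as [E|_].
        - exfalso; revert E; apply Cmult_neq_0; [exact Hsg0|now apply nonpole_neq_0].
        - destruct Hsg as [-> | ->]; [now rewrite !Cmult_1_l|].
          replace (- (1) * w) with (- w) by ring.
          replace (- (1) * th) with (- th) by ring.
          rewrite <- (borel_form_sym (- th) w Hnv); f_equal; ring. }
      unfold laplace; rewrite Eb; unfold rho; fold q in H.
      match type of H with (Cmod ?x <= _)%R =>
        match goal with |- (Cmod ?y <= _)%R => replace y with (sg * x) by ring end end.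
      rewrite Cmod_mult; rewrite Hsg1; lra.
  + intros e He.
    assert (Hq : (Cmod q < 1)%R).
    { unfold q; rewrite Cmod_Cexp, <- exp_0; apply exp_increasing.
      pose proof (abs_fst_le (sg * th)) as B; rewrite Cmod_mult in B.
      rewrite Hsg1 in B.
      apply Rabs_le_between in B.
      change (fst (sg * th - l)) with (fst (sg * th)%C + - fst l)%R; lra. }
    destruct (log_series q Hq e He) as (N0 & HN0); exists N0; intros N HN.
    specialize (HN0 N HN).
    replace (sum_n_m (fun n => twopii * rho n) 1 N)
      with (sg * sum_n_m (fun n => - (Cpow (- q) n / RtoC (INR n))) 1 N).
    * match goal with |- (Cmod (sg * ?x - sg * ?y) <= _)%R =>
        replace (sg * x - sg * y) with (sg * (x - y)) by ring end.
      rewrite Cmod_mult; rewrite Hsg1; lra.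
    * clear - Hp; induction N as [|N IH].
      -- rewrite !sum_n_m_zero by lia; change (@zero C_AbelianMonoid) with (RtoC 0); ring.
      -- rewrite !sum_n_m_S, <- IH by lia.
         unfold rho; replace (- q) with (RtoC (-1) * q)
           by (change (RtoC (-1)) with (RtoC (- (1))%R); rewrite RtoC_opp; ring).
         rewrite Cpow_mult_l, <- RtoC_pow; in_C; field.
         split; [apply RtoC_S_neq_0|apply twopii_neq_0].
Qed.

(** If d / z is not real, the imaginary part of (d / z) w grows linearly in a thin
    sector around the positive axis, which therefore contains no pole. *)
Lemma jump_off_poles (p : point) (d : C) : on_TM p -> d <> 0 ->
  snd (d / p cz) <> 0%R -> stokes_jump (gdot_series p) d (fun _ => 0).
Proof.
intros Hp Hd Hm2.
set (m := d / p cz) in *.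
pose proof (Rabs_pos_lt _ Hm2) as Hpos.
set (k := (Rabs (snd m) / (2 * (Rabs (fst m) + 1)))%R).
pose proof (Rabs_pos (fst m)) as H0.
assert (Hk : (0 < k)%R) by (apply Rdiv_lt_0_compat; lra).
set (kap := Rmin k (1 / 2)).
assert (Hkap : (0 < kap <= 1 / 2)%R).
{ split; [apply Rmin_pos; lra|apply Rmin_r]. }
assert (Him : forall x y, (0 < x)%R -> (Rabs y < kap)%R ->
  (Rabs (snd m) / 2 * x <= Rabs (snd (m * (x, x * y)%R)%C))%R).
{ intros x y Hx Hy.
  assert (Hyk : (Rabs y < k)%R) by (apply Rlt_le_trans with (1 := Hy), Rmin_l).
  replace (snd (m * (x, x * y)%R)%C) with (x * (snd m + fst m * y))%R
    by (simpl; ring).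
  rewrite Rabs_mult, (Rabs_pos_eq x) by lra.
  assert (Ek : (k * (2 * (Rabs (fst m) + 1)) = Rabs (snd m))%R)
    by (unfold k; field; lra).
  assert (Hfy : (Rabs (fst m * y) <= Rabs (snd m) / 2)%R).
  { rewrite Rabs_mult; pose proof (Rabs_pos y); nra. }
  pose proof (Rabs_triang (snd m + fst m * y) (- (fst m * y))) as T.
  replace (snd m + fst m * y + - (fst m * y))%R with (snd m) in T by ring.
  rewrite Rabs_Ropp in T; nra. }
assert (HD : forall x y, (0 < x)%R -> (Rabs y < kap)%R ->
  (Rabs (snd m) / 2 * x <= Cmod (Dsin (m * (x, x * y)%R)))%R).
{ intros x y Hx Hy; apply Rle_trans with (2 := Cmod_Dsin_ge _); now apply Him. }
assert (Hnp : forall x y, (0 < x)%R -> (Rabs y < kap)%R -> nonpole (m * (x, x * y)%R)).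
{ intros x y Hx Hy; apply Cmod_neq_0; specialize (HD x y Hx Hy); nra. }
apply stokes_jump_intro with kap; fold m; try assumption.
- intros x y Hx Hy; apply Hnp; lra.
- intros y Hy; exists (Rabs (snd m) / 8)%R; split; [lra|]; intros x Hx.
  specialize (HD x y ltac:(lra) ltac:(lra)); nra.
- exists (Rabs (snd m) / 4)%R; split; [lra|]; intros N y Hy.
  pose proof (pos_INR N).
  specialize (HD (INR N + 1 / 2)%R y ltac:(lra) Hy); nra.
- intros eps a b Ha Hb Heps _; exists (fun _ => 0); split.
  + intros N X L U h.
    apply (triangle_at_origin (fun w => nonpole (m * w)) h L U 2).
    * apply Copen_nonpole_scal.
    * apply holo_laplace.
    * apply ccont_laplace; now left.
    * lra.
    * unfold X; pose proof (pos_INR N); lra.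
    * intros t s Ht Hs.
      replace (RtoC t * (L + RtoC s * (U - L))) with ((t, t * (- a + s * (b + a)))%R : C).
      2:{ unfold L, U, Cmult, Cminus, Cplus, Copp, RtoC; cbn [fst snd]; f_equal; ring. }
      apply Hnp; [lra|]; apply Rabs_def1; nra.
  + intros e He; exists O; intros N _.
    replace (0 - 0) with (RtoC 0) by ring; rewrite Cmod_0; lra.
Qed.

Theorem proposition5p3 :
  ((forall a b : C * C -> C, holomorphic_on_M a -> holomorphic_on_M b ->
    forall (n : Z) (i : coord) (p : point), on_TM p ->
    exp_Lie gdot (Ast a b) n i p = A1conn a b n i p)
   /\
   (forall (i : coord) (p : point), on_TM p ->
    resurgent (fun n : Z => gdot n i p)))
  /\
  (forall p : point, on_TM p ->
   let f1 : laurent C := fun n => x1 n p - x1st n p in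
   let f2 : laurent C := fun n => x2 n p - x2st n p in
   resurgent f1 /\ resurgent f2 /\
   (forall d : C, d <> 0 -> stokes_jump f1 d (fun _ => 0)) /\
   stokes_jump f2 (p cz)
     (fun eps => Clog (1 + Cexp (p cth - p cz / eps))) /\
   stokes_jump f2 (- p cz)
     (fun eps => - Clog (1 + Cexp (p cz / eps - p cth))) /\
   (forall d : C, d <> 0 -> ~ on_ray (p cz) d -> ~ on_ray (- p cz) d ->
    stokes_jump f2 d (fun _ => 0))).
Proof.
split; [split|].
- intros a b _ _ n i p Hp; now apply exp_Lie_Ast.
- intros i p Hp; destruct (coord_eqb i cthc) eqn:E.
  + replace i with cthc by (destruct i; simpl in E; congruence).
    now apply gdot_series_resurgent.
  + replace (fun n : Z => gdot n i p) with zero_series; [apply zero_resurgent|].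
    apply functional_extensionality; intros n; unfold zero_series, gdot.
    destruct (1 <=? n)%Z; [|reflexivity].
    unfold vscal, dd; destruct i; simpl in *; try discriminate; ring.
- intros p Hp f1 f2.
  assert (E1 : f1 = zero_series).
  { apply functional_extensionality; intros n; unfold f1, zero_series.
    rewrite x1_eq; ring. }
  assert (E2 : f2 = gdot_series p).
  { apply functional_extensionality; intros n; unfold f2, gdot_series.
    rewrite x2_eq; ring. }
  rewrite E1, E2.
  split; [apply zero_resurgent|split; [now apply gdot_series_resurgent|]].
  split; [intros; apply zero_jump|].
  split; [|split].
  + pose proof (jump_at_poles p 1 Hp (or_introl eq_refl)) as H.
    rewrite Cmult_1_l in H.
    replace (fun eps => Clog (1 + Cexp (p cth - p cz / eps)))
      with (fun eps => 1 * Clog (1 + Cexp (1 * p cth - p cz / eps))); [exact H|].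
    apply functional_extensionality; intros eps; now rewrite !Cmult_1_l.
  + pose proof (jump_at_poles p (- (1)) Hp (or_intror eq_refl)) as H.
    replace (- (1) * p cz) with (- p cz) in H by ring.
    replace (fun eps => - Clog (1 + Cexp (p cz / eps - p cth)))
      with (fun eps => - (1) * Clog (1 + Cexp (- (1) * p cth - - p cz / eps)));
      [exact H|].
    apply functional_extensionality; intros eps.
    replace (- (1) * p cth - - p cz / eps) with (p cz / eps - p cth)
      by (unfold Cdiv; ring).
    ring.
  + intros d Hd H1 H2; apply jump_off_poles; try assumption.
    intros E; set (x := fst (d / p cz)).
    assert (Ed : d = RtoC x * p cz).
    { replace (RtoC x) with (d / p cz); [field; exact Hp|].
      rewrite (surjective_pairing (d / p cz)), E; reflexivity. }
    destruct (Rtotal_order x 0) as [Hx|[Hx|Hx]].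
    * apply H2; exists (- x)%R; split; [lra|]; rewrite Ed, RtoC_opp; ring.
    * apply Hd; rewrite Ed, Hx; ring.
    * apply H1; exists x; split; [lra|exact Ed].
Qed.
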